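(* Let $\mathcal{A}$ be a unital $C^*$-algebra, faithfully represented as $\mathcal{A}\subseteq\mathcal{B}(\mathcal{H})$ on a Hilbert space $\mathcal{H}$. Let $Lip(\mathcal{A})\subseteq\mathcal{A}_{s.a}$ be a dense order unit space (with order unit $I$), let $L$ be a Lip norm on $Lip(\mathcal{A})$, so that $((Lip(\mathcal{A}),I),L)$ is a compact quantum metric space, and let $\nu$ be a state on $\mathcal{A}$. Let $$0\longrightarrow \mathcal{K}(l^2(\mathbb{N}))\otimes\mathcal{A}\stackrel{i}{\longrightarrow}\widetilde{\mathcal{A}_1}\stackrel{\pi}{\longrightarrow}\widetilde{\mathcal{A}_2}\longrightarrow 0$$ be a short exact sequence of $C^*$-algebras with $\widetilde{\mathcal{A}_1},\widetilde{\mathcal{A}_2}$ unital, and let $\sigma:\widetilde{\mathcal{A}_2}\to\widetilde{\mathcal{A}_1}$ be a positive unital linear splitting (so $\pi\circ\sigma=\mathrm{id}$). Let $(\mathcal{A}_2,L_2)$ be a compact quantum metric space, where $\mathcal{A}_2$ is a dense subspace of the space of selfadjoint elements of $\widetilde{\mathcal{A}_2}$ (with order unit the identity of $\widetilde{\mathcal{A}_2}$). Define $$\mathcal{A}_1=i(\widetilde{\mathcal{A}_\nu})\oplus\sigma(\mathcal{A}_2)\subseteq\widetilde{\mathcal{A}_1}.$$ Then for $k>2$ the map $L_1:\mathcal{A}_1\to\mathbb{R}_+$ given by $$L_1(a)=L_2(\pi(a))+L_k(a-\sigma\circ\pi(a))$$ is a Lip norm on $\mathcal{A}_1$.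
   Context: An order unit space is a real partially ordered vector space $A$ with a distinguished element $e$ (the order unit) such that (i) for each $a\in A$ there is $r\in\mathbb{R}$ with $a\le re$; (ii) if $a\in A$ and $a\le re$ for all real $r>0$, then $a\le 0$. Its norm is $\|a\|=\inf\{r\in\mathbb{R}: -re\le a\le re\}$. A state of $(A,e)$ is an element $\mu$ of the dual $A'$ of $(A,\|\cdot\|)$ with $\mu(e)=1=\|\mu\|'$, where $\|\cdot\|'$ is the dual norm; $S(A)$ is the set of states. A Lip norm on $A$ is a seminorm $L$ on $A$ such that (i) $L(a)=0$ iff $a\in\mathbb{R}e$; (ii) the topology on $S(A)$ from the metric $\rho_L(\mu,\lambda)=\sup\{|\mu(a)-\lambda(a)|: L(a)\le 1\}$ is the weak* topology. A compact quantum metric space is a pair $(A,L)$ of an order unit space $A$ and a Lip norm $L$ on it. $\mathcal{A}_{s.a}$ is the real partially ordered space of selfadjoint elements of $\mathcal{A}$; subspaces of selfadjoint elements of a unital $C^*$-algebra containing the identity are regarded as order unit spaces with the inherited order and order unit the identity. Elements of $\mathcal{K}(l^2(\mathbb{N}))\otimes\mathcal{A}$ ($\mathbb{N}=\{1,2,\dots\}$, $\mathcal{K}$ the compact operators) are written as infinite matrices $((a_{ij}))_{i,j\ge1}$ with entries in $\mathcal{A}$, acting on $l^2(\mathbb{N})\otimes\mathcal{H}$. $\widetilde{\mathcal{A}_\nu}$ is the collection of $((a_{ij}))\in\mathcal{K}(l^2(\mathbb{N}))\otimes\mathcal{A}$ such that (i) $a_{ij}\in Lip(\mathcal{A})$ for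 all $i,j$; (ii) $a_{ij}=a_{ji}$; (iii) $\sup_{i\ge1,j\ge1}(i+j)^k(L(a_{ij})+|\nu(a_{ij})|)<\infty$ for all $k$. For $((a_{ij}))\in\widetilde{\mathcal{A}_\nu}$ and real $k\geq 0$, $$L_k((a_{ij}))=\sup_{i\ge1,j\ge1}(i+j)^k\,(L(a_{ij})+|\nu(a_{ij})|).$$ In the claim, $L_2$ denotes the given Lip norm on $\mathcal{A}_2$ (not $L_k$ with $k=2$). For $a\in\mathcal{A}_1$ the element $a-\sigma\circ\pi(a)$ lies in $i(\widetilde{\mathcal{A}_\nu})$, and $L_k$ is evaluated on it through the identification of $\widetilde{\mathcal{A}_\nu}$ with $i(\widetilde{\mathcal{A}_\nu})$ via $i$. $\mathcal{A}_1$ is an order unit space with order unit the identity of $\widetilde{\mathcal{A}_1}$. *)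

(* Defs.v *)
From HB Require Import structures.
From mathcomp Require Import all_boot all_order all_algebra.
From mathcomp Require Import complex ring.
From mathcomp Require Import all_classical all_reals all_analysis.

Set Implicit Arguments.
Unset Strict Implicit.
Unset Printing Implicit Defensive.

Import Order.TTheory GRing.Theory Num.Theory.
Import numFieldNormedType.Exports.

Local Open Scope classical_set_scope.
Local Open Scope ring_scope.
Local Open Scope complex_scope.

(** Order unit spaces are represented as subsets [A] of an ambient real vector
    space [V], with an order [le] on [V] and a vector [e].  Functionals on [A]
    are functions on the subtype of [A]; a seminorm on [A] is a function on [V]
    whose values outside of [A] are never used. *)

Section OrderUnitSpace.
Variables (R : realType) (V : lmodType R).
Implicit Types (A : set V) (le : V -> V -> Prop) (e : V).

Record order_unit_space le e A : Prop := OrderUnitSpace {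
  ous_zero : A 0;
  ous_lin : forall (r : R) x y, A x -> A y -> A (r *: x + y);
  ous_refl : forall x, A x -> le x x;
  ous_anti : forall x y, A x -> A y -> le x y -> le y x -> x = y;
  ous_trans : forall x y z, A x -> A y -> A z -> le x y -> le y z -> le x z;
  ous_add : forall x y z, A x -> A y -> A z -> le x y -> le (x + z) (y + z);
  ous_scale : forall (r : R) x y, 0 <= r -> A x -> A y -> le x y ->
    le (r *: x) (r *: y);
  ous_unit : A e;
  ous_bounded : forall a, A a -> exists r : R, le a (r *: e);
  ous_archimedean : forall a, A a -> (forall r : R, 0 < r -> le a (r *: e)) ->
    le a 0
}.

Definition order_norm le e (a : V) : R :=
  inf [set r : R | le (- r *: e) a /\ le a (r *: e)].

Definition dual_norm le e A (mu : A -> R) : \bar R :=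
  ereal_sup [set (`|mu a|)%:E | a in [set a : A | order_norm le e (val a) <= 1]].

(* Membership of [mu] in the dual space is implied by [dual_norm le e mu = 1]. *)
Definition states le e A : set (A -> R) := [set mu |
  [/\ forall (r : R) (x y z : A),
        val z = r *: val x + val y -> mu z = r * mu x + mu y,
      forall u : A, val u = e -> mu u = 1
    & dual_norm le e mu = 1%E]].

Definition lip_dist A (L : V -> R) (mu lam : A -> R) : \bar R :=
  ereal_sup [set (`|mu a - lam a|)%:E | a in [set a : A | L (val a) <= 1]].

Record lip_norm le e A (L : V -> R) : Prop := LipNorm {
  lip_ge0 : forall x, A x -> 0 <= L x;
  lip_homog : forall (r : R) x, A x -> L (r *: x) = `|r| * L x;
  lip_triangle : forall x y, A x -> A y -> L (x + y) <= L x + L y;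
  lip_eq0 : forall x, A x -> (L x = 0 <-> exists r : R, x = r *: e);
  (* [lip_dist L] and the weak* topology have the same open subsets of the
     state space *)
  lip_weak_star : forall U : set (A -> R), U `<=` states le e (A := A) ->
    ((forall mu, U mu -> exists2 eps : R, 0 < eps &
        forall lam, states le e lam -> (lip_dist L mu lam < eps%:E)%E -> U lam)
     <-> exists2 O : set {ptws A -> R}, open O &
           U = states le e (A := A) `&` O)
}.

Definition compact_quantum_metric_space le e A (L : V -> R) : Prop :=
  order_unit_space le e A /\ lip_norm le e A L.

End OrderUnitSpace.

(* The multiplication is part of the mixin because [GRing.Algebra] cannot be
   joined with [CompleteNormedModule]: [NumDomain] is the only structure above
   both rings and normed modules. *)
HB.mixin Record isCStar (R : realType) A of CompleteNormedModule R[i] A := {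
  cone : A;
  cmul : A -> A -> A;
  star : A -> A;
  cmulA : associative cmul;
  cmul1l : left_id cone cmul;
  cmul1r : right_id cone cmul;
  cmul_linearl : forall (c : R[i]) x y z,
    cmul (c *: x + y) z = c *: cmul x z + cmul y z;
  cmul_linearr : forall (c : R[i]) x y z,
    cmul z (c *: x + y) = c *: cmul z x + cmul z y;
  starK : involutive star;
  star_antilinear : forall (c : R[i]) x y,
    star (c *: x + y) = c^* *: star x + star y;
  starM : forall x y, star (cmul x y) = cmul (star y) (star x);
  cstar_normM : forall x y : A, `|cmul x y| <= `|x| * `|y|;
  cstar_norm : forall x : A, `|cmul (star x) x| = `|x| ^+ 2
}.

#[short(type="cstarType")]
HB.structure Definition CStar (R : realType) :=
  {A of isCStar R A & CompleteNormedModule R[i] A}.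

Arguments cone {R s}.

HB.mixin Record isHilbert (R : realType) H of CompleteNormedModule R[i] H := {
  dot : H -> H -> R[i];
  dot_linear : forall (c : R[i]) x y z, dot (c *: x + y) z = c * dot x z + dot y z;
  dot_conj : forall x y, dot y x = (dot x y)^*;
  dot_norm : forall x : H, dot x x = `|x| ^+ 2
}.

#[short(type="hilbertType")]
HB.structure Definition Hilbert (R : realType) :=
  {H of isHilbert R H & CompleteNormedModule R[i] H}.

Definition realified (R : realType) (V : lmodType R[i]) : Type := V.

Section Realified.
Variables (R : realType) (V : lmodType R[i]).

HB.instance Definition _ := GRing.Zmodule.copy (realified V) V.

Definition real_scale (r : R) (v : realified V) : realified V :=
  r%:C *: (v : V).

Fact real_scaleA r s v : real_scale r (real_scale s v) = real_scale (r * s) v.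
Proof. by rewrite /real_scale scalerA rmorphM. Qed.

Fact real_scale1 : left_id 1 real_scale.
Proof. by move=> v; rewrite /real_scale rmorph1 scale1r. Qed.

Fact real_scaleDr : right_distributive real_scale +%R.
Proof. by move=> r u v; rewrite /real_scale scalerDr. Qed.

Fact real_scaleDl v : {morph real_scale^~ v : r s / r + s}.
Proof. by move=> r s; rewrite /real_scale rmorphD scalerDl. Qed.

HB.instance Definition _ := GRing.Zmodule_isLmodule.Build R (realified V)
  real_scaleA real_scale1 real_scaleDr real_scaleDl.

End Realified.

Section CStarNotions.
Variables (R : realType) (A : cstarType R).

Definition selfadjoint : set (realified A) := [set a | star (a : A) = a].

Definition invertible (a : A) : Prop := exists b : A, cmul a b = cone /\ cmul b a = cone.

Definition spectrum (a : A) : set R[i] := [set l | ~ invertible (a - l *: cone)].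

(* On [R[i]], [0 <= l] means that [l] is real and nonnegative. *)
Definition positive (a : A) : Prop :=
  star a = a /\ (forall l, spectrum a l -> 0 <= l).

Definition cstar_le (a b : realified A) : Prop := positive ((b : A) - (a : A)).

Definition cstar_state (nu : A -> R[i]) : Prop :=
  [/\ linear_for *%R nu, forall a, positive a -> 0 <= nu a & nu cone = 1].

Definition cstar_cqms (S : set (realified A)) (L : realified A -> R) : Prop :=
  compact_quantum_metric_space cstar_le (cone : A) S L.

Definition dense_in_selfadjoint (S : set (realified A)) : Prop :=
  S `<=` selfadjoint /\ selfadjoint `<=` closure (S : set A).

End CStarNotions.

Record star_hom (R : realType) (A B : cstarType R) (f : A -> B) : Prop := StarHom {
  star_hom_linear : linear f;
  star_homM : forall x y, f (cmul x y) = cmul (f x) (f y);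
  star_hom_star : forall x, f (star x) = star (f x)
}.

Record positive_unital_splitting (R : realType) (A B : cstarType R)
    (p : A -> B) (s : B -> A) : Prop := PositiveUnitalSplitting {
  splitting_linear : linear s;
  splitting_positive : forall b, positive b -> positive (s b);
  splitting_unital : s cone = cone;
  splittingK : cancel s p
}.

Record faithful_rep (R : realType) (A : cstarType R) (H : hilbertType R)
    (rho : A -> H -> H) : Prop := FaithfulRep {
  rep_op_linear : forall a, linear (rho a);
  rep_op_continuous : forall a, continuous (rho a);
  rep_linear : forall (c : R[i]) a b x,
    rho (c *: a + b) x = c *: rho a x + rho b x;
  repM : forall a b x, rho (cmul a b) x = rho a (rho b x);
  rep_star : forall a x y, dot (rho a x) y = dot x (rho (star a) y);
  rep_inj : injective rho
}.

Definition normR (R : realType) (V : normedModType R[i]) (x : V) : R :=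
  complex.Re `|x|.

Section NormR.
Variables (R : realType) (V : normedModType R[i]).
Implicit Types x y : V.

Lemma normRE x : (normR x)%:C = `|x|.
Proof. by rewrite /normR RRe_real// ger0_real. Qed.

Lemma normR_ge0 x : 0 <= normR x.
Proof. by rewrite -ler0c normRE. Qed.

Lemma normRD x y : normR (x + y) <= normR x + normR y.
Proof. by rewrite -lecR rmorphD/= !normRE ler_normD. Qed.

Lemma normRZ (c : R[i]) x : normR (c *: x) = normR (c : R[i]^o) * normR x.
Proof. by apply: complexI; rewrite rmorphM/= !normRE normrZ. Qed.

End NormR.

Section L2.
Variables (R : realType) (V : normedModType R[i]).

Definition sqsum (x : nat -> V) : \bar R :=
  (\sum_(n <oo) ((normR (x n)) ^+ 2)%:E)%E.

Definition sqsummable : {pred nat -> V} := fun x => (sqsum x < +oo)%E.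

Fact sqsummable_submod : GRing.submod_closed sqsummable.
Proof.
have sq0 (z : V) : (0 <= ((normR z) ^+ 2)%:E :> \bar R)%E.
  by rewrite lee_fin sqr_ge0.
split=> [|c x y].
  rewrite /in_mem/= /sqsummable /sqsum eseries0 ?ltry// => n _ _.
  by rewrite /normR normr0/= expr0n.
rewrite /in_mem/= /sqsummable => xfin yfin.
pose F n := ((2 * normR (c : R[i]^o) ^+ 2)%:E * ((normR (x n)) ^+ 2)%:E
             + 2%:E * ((normR (y n)) ^+ 2)%:E)%E.
apply: (@le_lt_trans _ _ (\sum_(n <oo) F n)%E).
  apply: lee_nneseries => [n _ _|n _]; first exact: sq0.
  rewrite /F -!EFinM -EFinD lee_fin.
  apply: (@le_trans _ _ ((normR (c : R[i]^o) * normR (x n) + normR (y n)) ^+ 2)).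
    rewrite ler_sqr ?nnegrE ?normR_ge0//.
      by rewrite -normRZ normRD.
    by rewrite addr_ge0// ?normR_ge0// -normRZ normR_ge0.
  have := sqr_ge0 (normR (c : R[i]^o) * normR (x n) - normR (y n)).
  set u := normR (c : R[i]^o) * _; set v := normR _ => uv.
  rewrite -mulrA -exprMn -/u -subr_ge0.
  rewrite (_ : _ - _ = (u - v) ^+ 2)//.
  by ring.
have c0 : 0 <= 2 * normR (c : R[i]^o) ^+ 2 by rewrite mulr_ge0// sqr_ge0.
rewrite /F nneseriesD//.
- rewrite !nneseriesZl//.
  by rewrite lte_add_pinfty// lte_mul_pinfty// ?lee_fin.
- by move=> n _ _; rewrite mule_ge0// ?lee_fin ?sq0//.
- by move=> n _ _; rewrite mule_ge0// ?lee_fin.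
Qed.

HB.instance Definition _ :=
  GRing.isSubmodClosed.Build R[i] (nat -> V) sqsummable sqsummable_submod.

(* l^2(N) is [l2 R[i]^o] and l^2(N) (x) H is [l2 H]. *)
Record l2 : Type := MkL2 { l2_seq :> nat -> V; _ : l2_seq \in sqsummable }.

HB.instance Definition _ := [isSub for l2_seq].
HB.instance Definition _ := [Choice of l2 by <:].
HB.instance Definition _ := [SubChoice_isSubZmodule of l2 by <:].
HB.instance Definition _ := [SubZmodule_isSubLmodule of l2 by <:].

Definition l2_norm (x : l2) : R := Num.sqrt (fine (sqsum x)).

Fact l2_single_subproof (j : nat) (v : V) :
  (fun n => if n == j then v else 0) \in sqsummable.
Proof.
rewrite /in_mem/= /sqsummable /sqsum (@nneseries_split _ _ 0 j.+1)//; last first.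
  by move=> k _; rewrite lee_fin sqr_ge0.
rewrite eseries0 ?adde0; last first.
  move=> k; rewrite add0n => jk _; rewrite gtn_eqF// /normR normr0/= expr0n//.
by rewrite sumEFin ltry.
Qed.

Definition l2_single (j : nat) (v : V) : l2 := MkL2 (l2_single_subproof j v).

End L2.

Section Operators.
Variables (R : realType) (V : normedModType R[i]).
Implicit Types S T : l2 V -> l2 V.

Definition op_bound T : set R :=
  [set M | 0 <= M /\ forall x, l2_norm (T x) <= M * l2_norm x].

Definition bounded_op T : Prop := linear T /\ op_bound T !=set0.

Definition op_norm T : R := inf (op_bound T).

Definition compact_op T : Prop :=
  linear T /\
  forall x : nat -> l2 V, (forall n, l2_norm (x n) <= 1) ->
  exists (phi : nat -> nat) (y : l2 V),
    {homo phi : m n / (m < n)%N} /\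
    l2_norm (T (x (phi n)) - y) @[n --> \oo] --> (0 : R).

End Operators.

Section L2Hilbert.
Variables (R : realType) (H : hilbertType R).

Definition l2_dot (x y : l2 H) : R[i] :=
  limn (fun n => \sum_(k < n) complex.Re (dot (x k) (y k)))
  +i* limn (fun n => \sum_(k < n) complex.Im (dot (x k) (y k))).

Definition l2_adjoint (S T : l2 H -> l2 H) : Prop :=
  forall x y, l2_dot (S x) y = l2_dot x (T y).

Fact l2_tensor_subproof (x : l2 R[i]^o) (v : H) :
  (fun n => x n *: v) \in @sqsummable R H.
Proof.
case: x => x /=; rewrite /in_mem/= /sqsummable /sqsum => xfin.
rewrite (@eq_eseriesr _ _
  (fun n => ((normR v ^+ 2)%:E * ((normR (x n)) ^+ 2)%:E)%E)); last first.
  by move=> n _; rewrite normRZ exprMn mulrC EFinM.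
rewrite nneseriesZl//; last by move=> n _; rewrite lee_fin sqr_ge0.
by rewrite lte_mul_pinfty// lee_fin sqr_ge0.
Qed.

Definition l2_tensor (x : l2 R[i]^o) (v : H) : l2 H :=
  MkL2 (l2_tensor_subproof x v).

Definition op_tensor (k : l2 R[i]^o -> l2 R[i]^o) (t : H -> H)
    (T : l2 H -> l2 H) : Prop :=
  bounded_op T /\ forall x v, T (l2_tensor x v) = l2_tensor (k x) (t v).

End L2Hilbert.

Section CompactTensor.
Variables (R : realType) (A : cstarType R) (H : hilbertType R).
Variable rho : A -> H -> H.
Implicit Types T : l2 H -> l2 H.

Definition algebraic_compact_tensor : set (l2 H -> l2 H) := [set T |
  exists (n : nat) (k : 'I_n -> l2 R[i]^o -> l2 R[i]^o) (a : 'I_n -> A)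
         (t : 'I_n -> l2 H -> l2 H),
    (forall m, compact_op (k m) /\ op_tensor (k m) (rho (a m)) (t m)) /\
    T = \sum_(m < n) t m].

Definition compact_tensor : set (l2 H -> l2 H) := [set T |
  bounded_op T /\
  forall eps : R, 0 < eps -> exists2 S,
    algebraic_compact_tensor S & op_norm (T - S) < eps].

(* The entry [a_ij] of the matrix of [T]; it exists and is unique when [T] is in
   [compact_tensor] and [rho] is a faithful representation.  The indices
   [0, 1, ...] used here stand for the indices [1, 2, ...] of N. *)
Definition entry T (i j : nat) : A :=
  xget cone [set a | forall v, T (l2_single j v) i = rho a v].

(* An injective *-homomorphism from [compact_tensor] to [B]; the values of
   [iota] on other maps are irrelevant. *)
Record compact_tensor_embedding (B : cstarType R) (iota : (l2 H -> l2 H) -> B) :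
  Prop := CompactTensorEmbedding {
  embed_linear : forall (c : R[i]) S T, compact_tensor S -> compact_tensor T ->
    iota (c *: S + T) = c *: iota S + iota T;
  embedM : forall S T, compact_tensor S -> compact_tensor T ->
    iota (S \o T) = cmul (iota S) (iota T);
  embed_star : forall S T, compact_tensor S -> compact_tensor T ->
    l2_adjoint S T -> iota T = star (iota S);
  embed_inj : forall S T, compact_tensor S -> compact_tensor T ->
    iota S = iota T -> S = T
}.

Record short_exact (B C : cstarType R) (iota : (l2 H -> l2 H) -> B)
    (p : B -> C) : Prop := ShortExact {
  exact_embed : compact_tensor_embedding iota;
  exact_hom : star_hom p;
  exact_surj : forall c, exists b, p b = c;
  exact_ker : forall b, p b = 0 <-> exists2 T, compact_tensor T & iota T = b
}.

Variables (LipA : set (realified A)) (L : realified A -> R) (nu : A -> R[i]).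

Definition weighted_entries (k : R) T : set R :=
  [set ((i.+1 + j.+1)%:R `^ k) *
         (L (entry T i j) + complex.Re `|nu (entry T i j)|)
  | i in [set: nat] & j in [set: nat]].

Definition A_nu : set (l2 H -> l2 H) := [set T |
  [/\ compact_tensor T,
      forall i j, LipA (entry T i j),
      forall i j, entry T i j = entry T j i
    & forall k : R, 0 <= k -> has_ubound (weighted_entries k T)]].

Definition Lk (k : R) T : R := sup (weighted_entries k T).

Variables (B C : cstarType R) (iota : (l2 H -> l2 H) -> B) (p : B -> C)
  (s : C -> B) (A2 : set (realified C)) (L2 : realified C -> R).

Definition A_one : set (realified B) :=
  [set iota T + s c | T in A_nu & c in A2].

Definition embed_inv (b : B) : l2 H -> l2 H :=
  'pinv_(fun=> 0) A_nu iota b.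

Definition L_one (k : R) (a : realified B) : R :=
  L2 (p a) + Lk k (embed_inv (a - s (p a))).

End CompactTensor.

(* Main.v *)
Require Import Defs.
From mathcomp Require Import all_boot all_order all_algebra.
From mathcomp Require Import complex ring lra.
From mathcomp Require Import all_classical all_reals all_analysis.

Set Implicit Arguments.
Unset Strict Implicit.
Unset Printing Implicit Defensive.

Import Order.TTheory GRing.Theory Num.Theory.
Import numFieldNormedType.Exports.

Local Open Scope classical_set_scope.
Local Open Scope ring_scope.
Local Open Scope complex_scope.

(** The sum [A1] consists of elements [iota T + s c] with [T] a symmetric, rapidly
    decaying matrix and [c] in [A2], and [p (iota T + s c) = c] makes the
    decomposition unique; on it [L1] is [L2 c + Lk k T] ([L_oneE]). The seminorm
    properties of [L1] are inherited from [L2] and [Lk], and its kernel is reduced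
    to scalars because [Lk k T = 0] kills every entry of [T] ([Lk_eq0]). What needs
    proof is that [A1] is an order unit space and that the metric of [L1] induces
    the weak-* topology on its states.

    The order. The positive cone of a C-star-algebra is compared with squares of
    selfadjoint elements. A fixed point iteration gives the square root of [1 - h]
    for [h] in the unit ball ([sqrt_fixpoint]), and a unitary built from it shows
    that squares are described by a norm inequality ([sq_ball], [ball_sq]). So
    squares form a convex cone, the inequalities [- t <= x <= t] bound the norm
    ([sq_between]), and the cone is the one defined by the spectrum ([positiveP]).
    Consequently star homomorphisms are contractive ([star_hom_contractive]), and
    an element whose quadratic form is nonnegative in a faithful representation is
    positive ([vector_form_ge0_sq]); in particular such representations are
    isometric. The order unit axioms follow ([order_unit_space_us]), and the states
    of a unital subspace are its positive unital functionals ([state_ev_ge0],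
    [positive_state]).

    Matrices. Compact matrices have entries in [A], which determine them
    ([ct_entry], [ct_ext]). If the entries of [T] are dominated by a summable double
    sequence, the images under [iota] of the truncations of [T] converge to
    [iota T] ([iota_trunc_cvg]): the limit exists in the algebra, lies in the kernel
    of [p], which is the image of [iota], and has the same entries. This gives
    the selfadjointness of [iota T] and a bound for the norm of tails.

    The topology. A segment argument shows that the states of [LipA] are at bounded
    distance from [nu] ([lip_dist_bounded]). Vector functionals compute norms, hence
    the norm on [LipA] is bounded by a multiple of [L a + |nu a|] ([normR_le_lip]).
    The entries of [T] with [Lk k T <= 1] are therefore bounded by a multiple of
    [(i + j)^(-k)], and [k > 2] makes the tails of such matrices uniformly small
    ([uniform_tail]). For [lam] a state near [mu] in the weak-* topology, the
    difference of [mu] and [lam] on the unit ball of [L1] is then small for three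
    reasons: tails are small; on the finite head, polarization expresses both states
    by the positive functionals [a |-> mu (gram i j a)], which are multiples of
    states of [LipA] and are compared by the metric of [L] ([near_gram]); on
    [s A2], both restrict to states of [A2], which are compared by the metric of
    [L2] ([near_split]). This is [near_lip_dist_one]; in the other direction each
    evaluation is Lipschitz for [L1] ([lip_weak_star_of_near]). *)

(** * Real-valued norms of complex normed modules *)

Section NormR.
Variables (R : realType) (V : normedModType R[i]).
Implicit Types (x y : V) (r : R).

Lemma normR_real r : normR (r%:C : R[i]^o) = `|r|.
Proof. by apply: complexI; rewrite normRE normc_def/= expr0n addr0 sqrtr_sqr. Qed.

Lemma normRZr r x : normR (r%:C *: x) = `|r| * normR x.
Proof. by rewrite normRZ normR_real. Qed.

Lemma normR0 : normR (0 : V) = 0.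
Proof. by rewrite /normR normr0. Qed.

Lemma normRN x : normR (- x) = normR x.
Proof. by rewrite /normR normrN. Qed.

Lemma normR_distC x y : normR (x - y) = normR (y - x).
Proof. by rewrite -normRN opprB. Qed.

Lemma normR_eq0 x : normR x = 0 -> x = 0.
Proof. by move=> x0; apply/eqP; rewrite -normr_eq0 -normRE x0. Qed.

Lemma normR_le_dist x y : normR x <= normR y + normR (x - y).
Proof. by rewrite -{1}(subrK y x) addrC normRD. Qed.

Lemma normR_sum (I : Type) (r : seq I) (P : pred I) (F : I -> V) :
  normR (\sum_(i <- r | P i) F i) <= \sum_(i <- r | P i) normR (F i).
Proof.
elim/big_ind2: _ => //; first by rewrite normR0.
by move=> x a y b xa yb; rewrite (le_trans (normRD _ _))// lerD.
Qed.

Lemma normR_le0 x : normR x <= 0 -> x = 0.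
Proof. by move=> x0; apply: normR_eq0; apply/le_anti; rewrite x0 normR_ge0. Qed.

Lemma cvg_normRP (u : nat -> V) (l : V) :
  (u @ \oo --> l) <->
  (forall e, 0 < e -> \forall n \near \oo, normR (l - u n) < e).
Proof.
split=> [/cvgrPdist_lt ul e e0|ul].
  have e0' : 0 < e%:C :> R[i] by rewrite ltcR.
  by apply: filterS (ul _ e0') => n; rewrite -normRE ltcR.
apply/cvgrPdist_lt => e e0.
have eE : (complex.Re e)%:C = e by rewrite RRe_real// gtr0_real.
have r0 : 0 < complex.Re e by rewrite -ltcR eE.
by apply: filterS (ul _ r0) => n; rewrite -normRE -ltcR eE.
Qed.

Lemma cvg_normR_le (u : nat -> V) (l : V) (M : R) :
  u @ \oo --> l -> (\forall n \near \oo, normR (u n) <= M) -> normR l <= M.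
Proof.
move=> /cvg_normRP ul uM; apply/ler_addgt0Pr => e e0.
have [n [ln un]] := filter_ex (filterI (ul _ e0) uM).
by rewrite (le_trans (normR_le_dist l (u n)))// lerD// ltW.
Qed.

End NormR.

(** * Limits of sequences with summable increments *)

Section SummableLimit.
Variables (R : realType) (V : completeNormedModType R[i]).

Lemma increments_le (u : nat -> V) (sg : nat -> R) :
  (forall n, normR (u n.+1 - u n) <= sg n.+1 - sg n) ->
  forall n m, (n <= m)%N -> normR (u m - u n) <= sg m - sg n.
Proof.
move=> usg n; elim=> [|m IH]; first by rewrite leqn0 => /eqP->; rewrite !subrr normR0.
rewrite leq_eqVlt => /predU1P[->|]; first by rewrite !subrr normR0.
rewrite ltnS => /IH nm.
rewrite -(subrKA (u m)) -(subrKA (sg m)) (le_trans (normRD _ _))//.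
by rewrite lerD.
Qed.

(** Domination by the increments of a real sequence is the form shared by the
    iteration for square roots, the Neumann series, and double sums of matrix
    units. *)
Lemma summable_limit (u : nat -> V) (sg : nat -> R) (M : R) :
  (forall n, normR (u n.+1 - u n) <= sg n.+1 - sg n) ->
  (forall n, sg n <= M) -> exists l : V, u @ \oo --> l.
Proof.
move=> usg sgM; have sgu := increments_le usg.
have sgnd : nondecreasing_seq sg.
  by move=> n m /sgu H; rewrite -subr_ge0 (le_trans _ H)// normR_ge0.
have : cvgn sg.
  by apply: nondecreasing_is_cvgn => //; exists M => _ [n _ <-].
move=> /cauchy_cvgP/cauchyP sgc.
suff : cvgn u by move=> /cvg_ex.
apply/cauchy_cvgP/cauchyP => e e0.
have eE : (complex.Re e)%:C = e by rewrite RRe_real// gtr0_real.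
have r0 : 0 < complex.Re e / 2 by rewrite divr_gt0// -ltcR eE.
have [s [N _ sN]] := sgc _ r0.
exists (u N); exists N => // n /= Nn.
rewrite -ball_normE/= -normRE -[e]eE ltcR normR_distC (le_lt_trans (sgu _ _ Nn))//.
have := sN n Nn; have := sN N (leqnn N); rewrite -!ball_normE/=.
rewrite !ltr_norml => /andP[a b] /andP[c d]; lra.
Qed.

Lemma cvg_increments (u : nat -> V) (sg : nat -> R) (l : V) (s : R) :
  (forall n, normR (u n.+1 - u n) <= sg n.+1 - sg n) ->
  u @ \oo --> l -> sg @ \oo --> s -> forall n, normR (l - u n) <= s - sg n.
Proof.
move=> usg ul sgs n; have sgu := increments_le usg.
have sgnd : nondecreasing_seq sg.
  apply/nondecreasing_seqP => m; rewrite -subr_ge0.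
  by rewrite (le_trans _ (usg m))// normR_ge0.
have sle m : sg m <= s.
  rewrite -(cvg_lim _ sgs)//; apply: nondecreasing_cvgn_le => //.
  by apply/cvg_ex; exists s.
apply: (@cvg_normR_le _ _ (fun m => u m - u n)).
  by apply: cvgB => //; exact: cvg_cst.
exists n => // m /= /sgu /le_trans; apply; by rewrite lerD2r.
Qed.

End SummableLimit.

(** * C-star-algebras: elementary calculus *)

Reserved Notation "x ** y" (at level 40, left associativity).

Lemma conjC_real (R : realType) (r : R) : Num.conj (r%:C : R[i]) = r%:C.
Proof. exact: conjc_real. Qed.

Section CStarAlgebra.
Variables (R : realType) (A : cstarType R).
Implicit Types (x y z a b h : A) (r t : R) (c : R[i]).
Local Notation "x ** y" := (cmul x y).
Local Notation I := (@cone R A).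

Lemma cmulDl x y z : (x + y) ** z = x ** z + y ** z.
Proof. by have := cmul_linearl 1 x y z; rewrite !scale1r. Qed.

Lemma cmulDr z x y : z ** (x + y) = z ** x + z ** y.
Proof. by have := cmul_linearr 1 x y z; rewrite !scale1r. Qed.

Lemma cmul0l z : 0 ** z = 0.
Proof. by apply: (addrI (0 ** z)); rewrite -cmulDl !addr0. Qed.

Lemma cmul0r z : z ** 0 = 0.
Proof. by apply: (addrI (z ** 0)); rewrite -cmulDr !addr0. Qed.

Lemma cmulZl c x z : (c *: x) ** z = c *: (x ** z).
Proof. by have := cmul_linearl c x 0 z; rewrite cmul0l !addr0. Qed.

Lemma cmulZr c z x : z ** (c *: x) = c *: (z ** x).
Proof. by have := cmul_linearr c x 0 z; rewrite cmul0r !addr0. Qed.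

Lemma cmulNl x z : (- x) ** z = - (x ** z).
Proof. by rewrite -scaleN1r cmulZl scaleN1r. Qed.

Lemma cmulNr z x : z ** (- x) = - (z ** x).
Proof. by rewrite -scaleN1r cmulZr scaleN1r. Qed.

Lemma cmulBl x y z : (x - y) ** z = x ** z - y ** z.
Proof. by rewrite cmulDl cmulNl. Qed.

Lemma cmulBr z x y : z ** (x - y) = z ** x - z ** y.
Proof. by rewrite cmulDr cmulNr. Qed.

Lemma starD x y : star (x + y) = star x + star y.
Proof. by have := star_antilinear 1 x y; rewrite conjC1 !scale1r. Qed.

Lemma star0 : star (0 : A) = 0.
Proof. by apply: (addrI (star 0)); rewrite -starD !addr0. Qed.

Lemma starZ c x : star (c *: x) = Num.conj c *: star x.
Proof. by have := star_antilinear c x 0; rewrite star0 !addr0. Qed.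

Lemma starZr r x : star (r%:C *: x) = r%:C *: star x.
Proof. by rewrite starZ conjC_real. Qed.

Lemma starN x : star (- x) = - star x.
Proof.
by apply/eqP; rewrite -addr_eq0 -starD addNr star0.
Qed.

Lemma starB x y : star (x - y) = star x - star y.
Proof. by rewrite starD starN. Qed.

Lemma star_cone : star I = I.
Proof. by rewrite -{2}[I]starK -[star I]cmul1l starM starK cmul1l. Qed.

Lemma normR_star x : normR (star x) = normR x.
Proof.
suff le y : normR y <= normR (star y) by apply/le_anti; rewrite -{2}[x]starK !le.
have [->|y0] := eqVneq (normR y) 0; first exact: normR_ge0.
have yp : 0 < normR y by rewrite lt_neqAle eq_sym y0 normR_ge0.
rewrite -(ler_pM2r yp) -lecR !rmorphM/= !normRE -expr2 -cstar_norm.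
exact: cstar_normM.
Qed.

Lemma normRM x y : normR (x ** y) <= normR x * normR y.
Proof. by rewrite -lecR rmorphM/= !normRE cstar_normM. Qed.

Lemma normR_starM x : normR (star x ** x) = normR x ^+ 2.
Proof. by apply: complexI; rewrite rmorphXn/= !normRE cstar_norm. Qed.

Lemma normR_sqr x : star x = x -> normR (x ** x) = normR x ^+ 2.
Proof. by move=> sx; rewrite -normR_starM sx. Qed.

Lemma normR_cone : normR I <= 1.
Proof.
have := normR_starM I; rewrite star_cone cmul1l => /eqP.
rewrite -subr_eq0 expr2 -{1}[normR I]mulr1 -mulrBr mulf_eq0 => /orP[/eqP->//|].
by rewrite subr_eq0 => /eqP <-.
Qed.

Lemma cvg_cmulr (u : nat -> A) (l : A) z : u @ \oo --> l ->
  (fun n => z ** u n) @ \oo --> z ** l.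
Proof.
move=> /cvg_normRP ul; apply/cvg_normRP => e e0.
have z0 : 0 < normR z + 1 by rewrite ltr_wpDl ?normR_ge0.
apply: filterS (ul (e / (normR z + 1)) _) => [n|]; last by rewrite divr_gt0.
rewrite ltr_pdivlMr// => lu; rewrite -cmulBr (le_lt_trans (normRM _ _))//.
by rewrite (le_lt_trans _ lu)// mulrC ler_wpM2l ?normR_ge0// lerDl.
Qed.

Lemma cvg_cmull (u : nat -> A) (l : A) z : u @ \oo --> l ->
  (fun n => u n ** z) @ \oo --> l ** z.
Proof.
move=> /cvg_normRP ul; apply/cvg_normRP => e e0.
have z0 : 0 < normR z + 1 by rewrite ltr_wpDl ?normR_ge0.
apply: filterS (ul (e / (normR z + 1)) _) => [n|]; last by rewrite divr_gt0.
rewrite ltr_pdivlMr// => lu; rewrite -cmulBl (le_lt_trans (normRM _ _))//.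
by rewrite (le_lt_trans _ lu)// ler_wpM2l ?normR_ge0// lerDl.
Qed.

Lemma cvg_star (u : nat -> A) (l : A) : u @ \oo --> l ->
  (fun n => star (u n)) @ \oo --> star l.
Proof.
move=> /cvg_normRP ul; apply/cvg_normRP => e e0.
by apply: filterS (ul e e0) => n; rewrite -starB normR_star.
Qed.

Lemma cstar_lim_unique (u : nat -> A) (l l' : A) :
  u @ \oo --> l -> u @ \oo --> l' -> l = l'.
Proof. by move=> ul ul'; exact: (cvg_unique _ ul ul'). Qed.

Lemma cvg_cmul_sqr (u : nat -> A) (l : A) M :
  (forall n, normR (u n) <= M) -> u @ \oo --> l ->
  (fun n => u n ** u n) @ \oo --> l ** l.
Proof.
move=> uM ul; have lM : normR l <= M.
  by apply: cvg_normR_le ul _; apply: nearW.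
have M0 : 0 <= M := le_trans (normR_ge0 l) lM.
move: ul => /cvg_normRP ul; apply/cvg_normRP => e e0.
have z0 : 0 < M + M + 1 by rewrite ltr_wpDl// addr_ge0.
apply: filterS (ul (e / (M + M + 1)) _) => [n|]; last by rewrite divr_gt0.
rewrite ltr_pdivlMr// => lu.
rewrite -(subrKA (l ** u n)) -cmulBr -cmulBl.
rewrite (le_lt_trans (normRD _ _))//.
have := normRM l (l - u n); have := normRM (l - u n) (u n).
have := normR_ge0 (l - u n); have := uM n; have := normR_ge0 (u n).
have := normR_ge0 l.
move: lM lu; nra.
Qed.

Definition commutes x y := x ** y = y ** x.

Lemma comm_sym x y : commutes x y -> commutes y x. Proof. by []. Qed.

Lemma commD x y z : commutes x y -> commutes x z -> commutes x (y + z).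
Proof. by rewrite /commutes cmulDl cmulDr => -> ->. Qed.

Lemma commN x y : commutes x y -> commutes x (- y).
Proof. by rewrite /commutes cmulNl cmulNr => ->. Qed.

Lemma commB x y z : commutes x y -> commutes x z -> commutes x (y - z).
Proof. by move=> xy xz; apply: commD => //; apply: commN. Qed.

Lemma commZ x c y : commutes x y -> commutes x (c *: y).
Proof. by rewrite /commutes cmulZl cmulZr => ->. Qed.

Lemma comm1 x : commutes x I. Proof. by rewrite /commutes cmul1l cmul1r. Qed.

Lemma commM x y z : commutes x y -> commutes x z -> commutes x (y ** z).
Proof. by rewrite /commutes => xy xz; rewrite cmulA xy -cmulA xz cmulA. Qed.

End CStarAlgebra.

(** * Square roots and the positive cone *)

Section Positivity.
Variables (R : realType) (A : cstarType R).
Implicit Types (x y z a b h : A) (r t : R) (c : R[i]).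
Local Notation "x ** y" := (cmul x y).
Local Notation I := (@cone R A).

(** Iterates of [y |-> (h + y^2) / 2]: at a fixed point, [(1 - y)^2 = 1 - h]. *)
Definition sqrt_iter h n : A := iter n (fun y => 2^-1%:C *: (h + y ** y)) 0.

(** The scalar iterates for [h = 1], which increase to [1] and dominate
    [sqrt_iter h] increment by increment when [h] is in the unit ball. *)
Definition sqrt_bound n : R := iter n (fun t => 2^-1 * (1 + t ^+ 2)) 0.

Lemma sqrt_bound_ge0 n : 0 <= sqrt_bound n.
Proof. by elim: n => //= n IH; rewrite mulr_ge0// addr_ge0// sqr_ge0. Qed.

Lemma sqrt_bound_le1 n : sqrt_bound n <= 1.
Proof. by elim: n => //= n IH; have := sqrt_bound_ge0 n; nra. Qed.

Lemma comm_sqrt_iter z h n : commutes z h -> commutes z (sqrt_iter h n).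
Proof.
move=> zh; elim: n => [|n IH] /=; first by rewrite /commutes cmul0l cmul0r.
by apply: commZ; apply: commD => //; apply: commM.
Qed.

Lemma sqrt_iter_le h n : normR h <= 1 -> normR (sqrt_iter h n) <= sqrt_bound n.
Proof.
move=> h1; elim: n => [|n IH] /=; first by rewrite normR0.
rewrite normRZr ger0_norm// ler_wpM2l// (le_trans (normRD _ _))// lerD//.
rewrite (le_trans (normRM _ _))// expr2.
by rewrite ler_pM ?normR_ge0.
Qed.

Lemma cmul_diff_sqr x y : commutes x y -> x ** x - y ** y = (x - y) ** (x + y).
Proof.
by move=> xy; rewrite cmulBl !cmulDr xy opprD addrA addrK.
Qed.

Lemma sqrt_iter_increments h n : normR h <= 1 ->
  normR (sqrt_iter h n.+1 - sqrt_iter h n) <= sqrt_bound n.+1 - sqrt_bound n.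
Proof.
move=> h1; elim: n => [|n IH].
  rewrite !subr0 /= cmul0l addr0 normRZr ger0_norm// expr0n addr0.
  by rewrite ler_wpM2l.
set p := sqrt_iter h n.+1 in IH *; set q := sqrt_iter h n in IH *.
rewrite [sqrt_iter h n.+2]/= [sqrt_bound n.+2]/= -/p.
have -> : p = 2^-1%:C *: (h + q ** q) by [].
have -> : 2^-1%:C *: (h + p ** p) - 2^-1%:C *: (h + q ** q) =
          2^-1%:C *: ((p - q) ** (p + q)).
  rewrite -cmul_diff_sqr; last by apply: comm_sqrt_iter; apply/comm_sym/comm_sqrt_iter.
  by rewrite -scalerBr opprD addrACA subrr add0r.
rewrite normRZr ger0_norm//.
set P := sqrt_bound n.+1 in IH *; set Q := sqrt_bound n in IH *.
have -> : P = 2^-1 * (1 + Q ^+ 2) by [].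
rewrite -mulrBr opprD addrACA subrr add0r ler_wpM2l//.
rewrite (le_trans (normRM _ _))// subr_sqr ler_pM ?normR_ge0//.
by rewrite (le_trans (normRD _ _))// lerD ?sqrt_iter_le.
Qed.

(** The iterates converge because [sqrt_bound] does, and their limit inherits from
    them selfadjointness and commutation. *)
Lemma sqrt_fixpoint h : normR h <= 1 -> exists y,
  [/\ normR y <= 1, y + y = h + y ** y, star h = h -> star y = y
    & forall z, commutes z h -> commutes z y].
Proof.
move=> h1.
have yle1 n : normR (sqrt_iter h n) <= 1.
  by rewrite (le_trans (sqrt_iter_le n h1))// sqrt_bound_le1.
have [y hy] := summable_limit (fun n => sqrt_iter_increments n h1) sqrt_bound_le1.
exists y; split.
- by apply: cvg_normR_le hy _; apply: nearW.
- have yS : (fun n => sqrt_iter h n.+1) @ \oo --> 2^-1%:C *: (h + y ** y).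
    apply: cvgZr; apply: cvgD; first exact: cvg_cst.
    exact: (cvg_cmul_sqr yle1 hy).
  have yS' : (fun n => sqrt_iter h n.+1) @ \oo --> y by rewrite (cvg_shiftS (sqrt_iter h)).
  rewrite {1 2}(cstar_lim_unique yS' yS).
  by rewrite -scalerDl -rmorphD/= -div1r -splitr scale1r.
- move=> sh; apply: (cstar_lim_unique (cvg_star hy)); rewrite (_ : (fun n => _) = sqrt_iter h)//.
  apply/funext; elim=> [|n IH] /=; first by rewrite star0.
  by rewrite starZr starD starM IH sh.
- move=> z zh; apply: (cstar_lim_unique (cvg_cmulr (z := z) hy)).
  rewrite (_ : (fun n => _) = (fun n => sqrt_iter h n ** z)); first exact: cvg_cmull.
  by apply/funext => n; apply: comm_sqrt_iter.
Qed.

Definition scal r : A := r%:C *: I.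

Lemma scalD r t : scal (r + t) = scal r + scal t.
Proof. by rewrite /scal rmorphD scalerDl. Qed.

Lemma scalN r : scal (- r) = - scal r.
Proof. by rewrite /scal rmorphN scaleNr. Qed.

Lemma scalB r t : scal (r - t) = scal r - scal t.
Proof. by rewrite scalD scalN. Qed.

Lemma scal0 : scal 0 = 0. Proof. by rewrite /scal rmorph0 scale0r. Qed.

Lemma scal1 : scal 1 = I. Proof. by rewrite /scal rmorph1 scale1r. Qed.

Lemma scalZ r t : r%:C *: scal t = scal (r * t).
Proof. by rewrite /scal scalerA rmorphM. Qed.

Lemma scalMl r x : scal r ** x = r%:C *: x.
Proof. by rewrite cmulZl cmul1l. Qed.

Lemma scalMr r x : x ** scal r = r%:C *: x.
Proof. by rewrite cmulZr cmul1r. Qed.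

Lemma star_scal r : star (scal r) = scal r.
Proof. by rewrite starZr star_cone. Qed.

Lemma normR_scal r : normR (scal r) <= `|r|.
Proof. by rewrite normRZr ler_piMr// normR_cone. Qed.

Lemma comm_scal x r : commutes x (scal r).
Proof. by rewrite /commutes scalMl scalMr. Qed.

(** [x] and [v] are the real and imaginary parts of the normal element
    [u = x + i v], and [star u ** u = x^2 + v^2], so the norm of [u] is known and
    bounds that of [x]. *)
Lemma normR_sum_sqr x v : star x = x -> star v = v -> commutes x v ->
  normR x ^+ 2 <= normR (x ** x + v ** v).
Proof.
move=> sx sv xv; pose j : R[i] := 'i; pose u := x + j *: v.
have su : star u = x - j *: v.
  rewrite starD starZ sx sv (_ : Num.conj j = - j) ?scaleNr//.
  by rewrite /j /Num.conj/=; congr Complex; rewrite oppr0.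
have j2 : j * j = -1 by rewrite -expr2 sqr_i.
have uu : star u ** u = x ** x + v ** v.
  rewrite su cmulBl !cmulDr !cmulZl !cmulZr xv scalerA j2 scaleN1r.
  by rewrite opprD opprK addrA addrK.
have xE : 2%:C *: x = u + star u.
  by rewrite su addrACA subrr addr0 -{2 3}[x]scale1r -scalerDl -rmorphD.
rewrite -uu normR_starM ler_sqr ?nnegrE ?normR_ge0//.
rewrite -(ler_pM2l (ltr0n _ 2)) -{1}[2%:R]ger0_norm// -normRZr xE.
by rewrite (le_trans (normRD _ _))// normR_star mulr2n mulrDl mul1r.
Qed.

Lemma sqr_one_sub y h : y + y = h + y ** y -> (I - y) ** (I - y) = I - h.
Proof.
move=> yE; have -> : h = y + y - y ** y by rewrite yE addrK.
by rewrite cmulBl !cmulBr !cmul1l cmul1r -!addrA -opprD.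
Qed.

(** With [v] a square root of [1 - x^2], the element [x + i v] is unitary, which
    bounds [v] by [1]. *)
Lemma normR_one_sub_sqr x : star x = x -> normR x <= 1 -> normR (I - x ** x) <= 1.
Proof.
move=> sx x1.
have xx1 : normR (x ** x) <= 1 by rewrite normR_sqr// expr_le1// normR_ge0.
have [y [_ yE sy cy]] := sqrt_fixpoint xx1.
have sv : star (I - y) = I - y by rewrite starB star_cone sy// starM sx.
have vv : (I - y) ** (I - y) = I - x ** x.
  exact: sqr_one_sub.
have xv : commutes x (I - y).
  by apply: commB; [exact: comm1|apply: cy; rewrite /commutes cmulA].
rewrite -vv normR_sqr//; have := normR_sum_sqr sv sx (comm_sym xv).
by rewrite vv subrK => /le_trans; apply; exact: normR_cone.
Qed.

Lemma normR_scal_sub_sqr x m : star x = x -> 0 < m -> normR x <= m ->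
  normR (scal (m ^+ 2) - x ** x) <= m ^+ 2.
Proof.
move=> sx m0 xm; pose x' := m^-1%:C *: x.
have sx' : star x' = x' by rewrite starZr sx.
have x'1 : normR x' <= 1.
  by rewrite normRZr gtr0_norm ?invr_gt0// mulrC ler_pdivrMr// mul1r.
have -> : scal (m ^+ 2) - x ** x = (m ^+ 2)%:C *: (I - x' ** x').
  rewrite scalerBr cmulZl cmulZr !scalerA -!rmorphM/=; congr (_ - _).
  by rewrite -invfM -expr2 divff ?gt_eqF ?exprn_gt0// scale1r.

rewrite normRZr ger0_norm ?sqr_ge0// -[leRHS]mulr1 ler_wpM2l ?sqr_ge0//.
exact: normR_one_sub_sqr.
Qed.

Lemma sqrt_of_ball t a : 0 < t -> star a = a -> normR (scal t - a) <= t ->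
  exists y, [/\ star y = y, y ** y = a, normR (scal (Num.sqrt t) - y) <= Num.sqrt t
    & forall z, commutes z a -> commutes z y].
Proof.
move=> t0 sa at_; pose h := t^-1%:C *: (scal t - a).
have h1 : normR h <= 1.
  by rewrite normRZr gtr0_norm ?invr_gt0// mulrC ler_pdivrMr// mul1r.
have [y [y1 yE sy cy]] := sqrt_fixpoint h1.
exists ((Num.sqrt t)%:C *: (I - y)); split.
- by rewrite starZr starB star_cone sy// starZr starB star_scal sa.
- rewrite cmulZl cmulZr scalerA -rmorphM/= -expr2 sqr_sqrtr ?ltW//.
  rewrite (sqr_one_sub yE) scalerBr scalerA -rmorphM/= divff ?gt_eqF//.
  by rewrite scale1r opprB addrC subrK.
- rewrite scalerBr opprB addrCA subrr addr0 normRZr ger0_norm ?sqrtr_ge0//.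
  by rewrite ler_piMr// sqrtr_ge0.
- move=> z za; apply: commZ; apply: commB; first exact: comm1.
  by apply: cy; apply: commZ; apply: commB => //; exact: comm_scal.
Qed.

(** Positivity in algebraic form; [positiveP] identifies it with the cone of
    selfadjoint elements of nonnegative spectrum. *)
Definition is_square a := exists2 y, star y = y & y ** y = a.

Lemma sq_sa a : is_square a -> star a = a.
Proof. by case=> y sy <-; rewrite starM sy. Qed.

(** Together with [ball_sq], this describes squares by a norm inequality, a
    condition that is visibly stable under addition. *)
Lemma sq_ball a : is_square a -> exists2 t, 0 < t & normR (scal t - a) <= t.
Proof.
case=> y sy <-; exists ((normR y + 1) ^+ 2).
  by rewrite exprn_gt0// ltr_wpDl ?normR_ge0.
by apply: normR_scal_sub_sqr; rewrite ?ltr_wpDl ?normR_ge0// lerDl.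
Qed.

Lemma ball_sq t a : 0 < t -> star a = a -> normR (scal t - a) <= t -> is_square a.
Proof. by move=> t0 sa at_; have [y [sy yy _ _]] := sqrt_of_ball t0 sa at_; exists y. Qed.

(** The root given by [sqrt_of_ball] lies in a ball which consists of squares
    itself, so that roots of roots exist. *)
Lemma sq_root a : is_square a -> exists y,
  [/\ star y = y, y ** y = a, is_square y & forall z, commutes z a -> commutes z y].
Proof.
move=> qa; have [t t0 at_] := sq_ball qa.
have [y [sy yy yt cy]] := sqrt_of_ball t0 (sq_sa qa) at_.
exists y; split=> //; apply: (ball_sq _ sy yt); by rewrite sqrtr_gt0.
Qed.

Lemma sqD a b : is_square a -> is_square b -> is_square (a + b).
Proof.
move=> qa qb; have [t t0 at_] := sq_ball qa; have [s s0 bs] := sq_ball qb.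
apply: (@ball_sq (t + s)); first exact: addr_gt0.
  by rewrite starD !sq_sa.
by rewrite scalD opprD addrACA (le_trans (normRD _ _))// lerD.
Qed.

Lemma sqZ r a : 0 <= r -> is_square a -> is_square (r%:C *: a).
Proof.
move=> r0 [y sy <-]; exists ((Num.sqrt r)%:C *: y); first by rewrite starZr sy.
by rewrite cmulZl cmulZr scalerA -rmorphM/= -expr2 sqr_sqrtr.
Qed.

Lemma sq_cone : is_square I.
Proof. by exists I; rewrite ?star_cone ?cmul1l. Qed.

Lemma sq_scal r : 0 <= r -> is_square (scal r).
Proof. by move=> r0; apply: sqZ => //; exact: sq_cone. Qed.

Lemma sq0 : is_square 0. Proof. by rewrite -scal0; exact: sq_scal. Qed.

Lemma sqM a b : is_square a -> is_square b -> commutes a b -> is_square (a ** b).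
Proof.
move=> /sq_root[y [sy yy _ cy]] /sq_root[z [sz zz _ cz]] ab.
have yz : commutes y z by apply: cz; apply: comm_sym; apply: cy; exact: comm_sym.
exists (y ** z); first by rewrite starM sy sz yz.
by rewrite -yy -zz -!cmulA; congr cmul; rewrite !cmulA yz.
Qed.

(** Apply [normR_sum_sqr] to [x] and the square root of [t - x^2]. *)
Lemma normR_sq_le t x : 0 <= t -> star x = x -> is_square (scal t - x ** x) ->
  normR x ^+ 2 <= t.
Proof.
move=> t0 sx /sq_root[v [sv vv _ cv]].
have xv : commutes x v.
  by apply: cv; apply: commB; [exact: comm_scal|rewrite /commutes cmulA].
rewrite (le_trans (normR_sum_sqr sx sv xv))// vv addrC subrK.
by rewrite (le_trans (normR_scal _))// ger0_norm.
Qed.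

(** The product of the commuting squares [t - x] and [t + x] is [t^2 - x^2]. *)
Lemma sq_between t x : 0 <= t -> star x = x ->
  is_square (scal t - x) -> is_square (scal t + x) -> normR x <= t.
Proof.
move=> t0 sx tx tx'; rewrite -ler_sqr ?nnegrE ?normR_ge0//.
apply: normR_sq_le; rewrite ?sqr_ge0//.
have : is_square ((scal t - x) ** (scal t + x)).
  apply: sqM => //; apply: commD; apply: comm_sym; apply: commB => //;
    by [exact: comm_scal|exact/comm_sym/comm_scal].
rewrite -cmul_diff_sqr; last exact/comm_sym/comm_scal.
by rewrite scalMl scalZ -expr2.
Qed.

Lemma sq_normR_le t x : star x = x -> normR x <= t -> is_square (scal t - x).
Proof.
move=> sx xt; have t0 := le_trans (normR_ge0 x) xt.
have [t0'|t0'] := eqVneq t 0.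
  move: xt; rewrite t0' => /normR_le0 ->; rewrite scal0 subrr; exact: sq0.
apply: (@ball_sq t); first by rewrite lt_neqAle eq_sym t0'.
  by rewrite starB star_scal sx.
by rewrite opprB addrCA subrr addr0.
Qed.

Lemma sq_normR_le' t x : star x = x -> normR x <= t -> is_square (scal t + x).
Proof.
by move=> sx xt; rewrite -[x]opprK; apply: sq_normR_le; rewrite ?starN ?sx ?normRN.
Qed.

Lemma sq_anti a : is_square a -> is_square (- a) -> a = 0.
Proof.
move=> qa qNa; apply: normR_le0; apply: sq_between => //; first exact: sq_sa.
  by rewrite scal0 add0r.
by rewrite scal0 add0r.
Qed.

End Positivity.

(** * Positivity through the spectrum *)

Section Spectrum.
Variables (R : realType) (A : cstarType R).
Implicit Types (x y z a b h : A) (r t : R) (c : R[i]).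
Local Notation "x ** y" := (cmul x y).
Local Notation I := (@cone R A).
Local Notation scal := (@scal R A).

Lemma neumann_invertible h : normR h < 1 -> invertible (I - h).
Proof.
move=> h1; set r := normR h in h1; have r0 : 0 <= r := normR_ge0 h.
pose u n := iter n (fun z => I + h ** z) 0.
pose sg n := (1 - r ^+ n) / (1 - r).
have r1 : 0 < 1 - r by rewrite subr_gt0.
have sgS n : sg n.+1 - sg n = r ^+ n.
  rewrite /sg exprS; field; by rewrite gt_eqF.
have uS n : normR (u n.+1 - u n) <= sg n.+1 - sg n.
  rewrite sgS; elim: n => [|n IH].
    by rewrite subr0 /= cmul0r addr0 normR_cone.
  have -> : u n.+2 - u n.+1 = h ** (u n.+1 - u n).
    by rewrite cmulBr /= opprD addrACA subrr add0r.
  by rewrite (le_trans (normRM _ _))// exprS ler_wpM2l.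
have sgM n : sg n <= (1 - r)^-1.
  by rewrite ler_piMl ?invr_ge0 ?(ltW r1)// gerBl exprn_ge0.
have [z uz] := summable_limit uS sgM.
have uz' : u n.+1 @[n --> \oo] --> z by rewrite (cvg_shiftS u).
have zE : z = I + h ** z.
  apply: (cstar_lim_unique uz'); apply: cvgD; first exact: cvg_cst.
  exact: cvg_cmulr.
have hz : commutes h z.
  apply: (cstar_lim_unique (cvg_cmulr (z := h) uz)).
  rewrite (_ : (fun n => _) = (fun n => u n ** h)); first exact: cvg_cmull.
  apply/funext; elim=> [|n IH] /=; first by rewrite cmul0l cmul0r.
  by rewrite cmulDl cmulDr cmul1l cmul1r -cmulA -IH.
exists z; rewrite cmulBl cmulBr cmul1l cmul1r -hz {1 3}zE addrK; by [].
Qed.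

Lemma invertibleZ c x : c != 0 -> invertible x -> invertible (c *: x).
Proof.
move=> c0 [y [xy yx]]; exists (c^-1 *: y).
by rewrite !cmulZl !cmulZr !scalerA xy yx mulfV// mulVf// scale1r.
Qed.

Lemma invertible_comm_factor x y : commutes x y -> invertible (x ** y) -> invertible x.
Proof.
move=> xy [q [xyq qxy]]; exists (y ** q); split; first by rewrite cmulA.
have qyx : q ** y ** x = I by rewrite -cmulA -xy.
suff -> : y ** q = q ** y by [].
by rewrite -[LHS]cmul1l -qyx -!cmulA [x ** _]cmulA xyq cmul1r.
Qed.

Lemma invertibleM x y : invertible x -> invertible y -> invertible (x ** y).
Proof.
move=> [x' [xx' x'x]] [y' [yy' y'y]]; exists (y' ** x'); split.
  by rewrite cmulA -[x ** y ** y']cmulA yy' cmul1r.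
by rewrite cmulA -[y' ** x' ** x]cmulA x'x cmul1r.
Qed.

Lemma invertible_scal_sub t a : normR a < t -> invertible (scal t - a).
Proof.
move=> at_; have t0 : 0 < t := le_lt_trans (normR_ge0 a) at_.
have -> : scal t - a = t%:C *: (I - t^-1%:C *: a).
  by rewrite scalerBr scalerA -rmorphM/= divff ?gt_eqF// scale1r.
apply: invertibleZ; first by rewrite eq_complex/= eqxx andbT gt_eqF.
apply: neumann_invertible; rewrite normRZr gtr0_norm ?invr_gt0//.
by rewrite mulrC ltr_pdivrMr// mul1r.
Qed.

Lemma sq_invertible t a : is_square a -> 0 < t -> invertible (a + scal t).
Proof.
move=> /sq_ball[s s0 as_] t0.
have -> : a + scal t = scal (s + t) - (scal s - a).
  by rewrite scalD opprB [RHS]addrC addrA subrK.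
by apply: invertible_scal_sub; rewrite (le_lt_trans as_)// ltrDl.
Qed.

(** For [l = al + i be] with [be] nonzero, [a - l] divides [(a - al)^2 + be^2],
    which is invertible as a square plus a positive scalar. *)
Lemma sq_positive a : is_square a -> positive a.
Proof.
move=> qa; split; first exact: sq_sa.
move=> [al be] nl; apply: contrapT => l0; apply: nl.
have [b0|b0] := eqVneq be 0.
  have al0 : al < 0.
    by rewrite ltNge; apply/negP => al0; apply: l0; rewrite b0 lecE/= eqxx.
  have := @sq_invertible (- al) a qa; rewrite oppr_gt0 => /(_ al0).
  by rewrite scalN b0.
pose b := a - scal al; pose j : R[i] := 'i; pose d := (be%:C * j) *: I.
have j2 : j * j = -1 by rewrite -expr2 sqr_i.
have xE : a - (al +i* be) *: I = b - d.
  rewrite /b /d /scal -addrA -opprD -scalerDl; congr (_ - _ *: _).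
  by rewrite /j /=; simpc.
have bd : commutes b d by apply: commZ; exact: comm1.
have bds : commutes b (b + d) by exact: commD.
rewrite xE; apply: (@invertible_comm_factor _ (b + d)).
  apply: comm_sym; apply: commB; first exact: comm_sym.
  by apply: comm_sym; apply: commD => //; exact: comm_sym.
rewrite -cmul_diff_sqr//.
have -> : b ** b - d ** d = b ** b + scal (be ^+ 2).
  congr (_ + _); rewrite /d cmulZl cmulZr cmul1l scalerA mulrACA j2 mulrN1.
  by rewrite scaleNr opprK -rmorphM.
apply: sq_invertible; last by rewrite exprn_even_gt0.
by exists b => //; rewrite starB star_scal sq_sa.
Qed.

(** If [r - h] and [r + h] are invertible, then [q = r^2 - h^2] is a square with
    inverse [w], and [q (M - w) = M q - 1] is a square as soon as [M] bounds the
    norm of [w]; hence [h^2 <= r^2 - 1 / M], against [normR h = r]. *)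
Lemma norm_in_spectrum h : star h = h -> 0 < normR h ->
  invertible (scal (normR h) - h) -> invertible (scal (normR h) + h) -> False.
Proof.
set r := normR h => sh r0 i1 i2.
have hr : commutes h (scal r) by exact: comm_scal.
pose q := (scal r - h) ** (scal r + h).
have qE : q = scal (r ^+ 2) - h ** h.
  by rewrite /q -cmul_diff_sqr// scalMl scalZ -expr2.
have qq : is_square q.
  apply: sqM; [exact: sq_normR_le|exact: sq_normR_le'|].
  apply: commD; first by apply: comm_scal.
  by apply: comm_sym; apply: commB.
have [w [qw wq]] : invertible q by exact: invertibleM.
have [y [sy yy _ cy]] := sq_root qq.
have cw z : commutes z q -> commutes z w.
  move=> zq; rewrite /commutes -[LHS]cmul1l -wq -[LHS]cmulA [q ** (_ ** _)]cmulA -zq.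
  by rewrite -(cmulA z) qw cmul1r.
have sw : star w = w.
  have sq_ : star w ** q = I by rewrite -[q](sq_sa qq) -starM qw star_cone.
  by rewrite -[LHS]cmul1r -qw cmulA sq_ cmul1l.
have yw : commutes y w by apply: cw; rewrite /commutes -yy cmulA.
have qw' : is_square w.
  exists (y ** w); first by rewrite starM sy sw yw.
  by rewrite {1}yw -[LHS]cmulA [y ** (_ ** _)]cmulA yy qw cmul1r.
(* The second summand makes [r^2 - 1 / M] nonnegative. *)
pose M := normR w + r ^- 2.
have M0 : 0 < M by rewrite ltr_wpDl ?normR_ge0// invr_gt0 exprn_gt0.
have Mw : is_square (scal M - w) by apply: sq_normR_le => //; rewrite lerDl invr_ge0 exprn_ge0// ltW.
have : is_square (M^-1%:C *: (q ** (scal M - w))).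
  apply: sqZ; first by rewrite invr_ge0 ltW.
  by apply: sqM => //; apply: commB; [exact: comm_scal|exact: cw].
have -> : M^-1%:C *: (q ** (scal M - w)) = scal (r ^+ 2 - M^-1) - h ** h.
  rewrite cmulBr qw scalMr scalerBr scalerA -rmorphM/= mulVf ?gt_eqF// scale1r.
  by rewrite qE scalB addrAC.
have Mr : M^-1 <= r ^+ 2.
  rewrite -[r ^+ 2]invrK lef_pV2 ?posrE ?invr_gt0 ?exprn_gt0//.
  by rewrite lerDr normR_ge0.
move=> /(normR_sq_le _ sh); rewrite subr_ge0 => /(_ Mr).
by rewrite -/r lerDl oppr_ge0 leNgt invr_gt0 M0.
Qed.

(** Otherwise [h = scal s - a] has norm larger than [s], and neither sign of that
    norm can be spectral for [h]: one sign contradicts the nonnegative spectrum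
    of [a], the other its norm. *)
Lemma positive_sq a : positive a -> is_square a.
Proof.
move=> [sa spa]; pose s := normR a + 1.
have s0 : 0 < s by rewrite ltr_wpDl ?normR_ge0.
pose h := scal s - a; have sh : star h = h by rewrite starB star_scal sa.
have [hs|hs] := leP (normR h) s; first exact: (@ball_sq _ _ s).
exfalso; apply: (norm_in_spectrum sh); first exact: lt_trans hs.
  have -> : scal (normR h) - h = a - (- (normR h - s))%:C *: I.
    rewrite /h opprB addrCA -scalB; congr (_ + _).
    by rewrite rmorphN scaleNr opprK.
  apply: contrapT => /spa; rewrite ler0c oppr_ge0 subr_le0 leNgt hs; exact/negP.
have -> : scal (normR h) + h = scal (normR h + s) - a by rewrite scalD addrA.
by apply: invertible_scal_sub; rewrite ltr_wpDl ?normR_ge0// ltrDl.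
Qed.

Lemma positiveP a : positive a <-> is_square a.
Proof. by split; [exact: positive_sq|exact: sq_positive]. Qed.

End Spectrum.

(** * Linear maps given by a predicate *)

Section LinearMaps.
Variables (K : pzRingType) (U V : lmodType K) (f : U -> V).
Hypothesis f_lin : linear f.

Lemma lin0 : f 0 = 0.
Proof. by have := f_lin (-1) 0 0; rewrite scaler0 addr0 scaleN1r addNr. Qed.

Lemma linD x y : f (x + y) = f x + f y.
Proof. by have := f_lin 1 x y; rewrite !scale1r. Qed.

Lemma linZ c x : f (c *: x) = c *: f x.
Proof. by have := f_lin c x 0; rewrite !addr0 lin0 addr0. Qed.

Lemma linN x : f (- x) = - f x.
Proof. by rewrite -scaleN1r linZ scaleN1r. Qed.

Lemma linB x y : f (x - y) = f x - f y.
Proof. by rewrite linD linN. Qed.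

Lemma lin_sum (J : Type) (r : seq J) (P : pred J) (F : J -> U) :
  f (\sum_(i <- r | P i) F i) = \sum_(i <- r | P i) f (F i).
Proof. by elim/big_rec2: _ => [|i y z _ <-]; rewrite ?lin0 ?linD. Qed.

End LinearMaps.

(** * Contractivity of star homomorphisms *)

Section StarHom.
Variables (R : realType) (A B : cstarType R) (f : A -> B).
Hypothesis fh : star_hom f.
Let f_lin := star_hom_linear fh.

Lemma star_hom_sq a : is_square a -> is_square (f a).
Proof.
case=> y sy <-; exists (f y); last by rewrite (star_homM fh).
by rewrite -(star_hom_star fh) sy.
Qed.

(** [f cone] is a projection, so [cone - f cone] is a square even when [f] is not
    unital. *)
Lemma star_hom_sq_scal r b : 0 <= r -> is_square (f (scal A r) + b) -> is_square (scal B r + b).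
Proof.
move=> r0 qb.
have -> : scal B r + b = r%:C *: (cone - f cone) + (f (scal A r) + b).
  by rewrite (linZ f_lin) scalerBr addrA subrK.
apply: sqD => //; apply: sqZ => //.
have se : star (f cone) = f cone by rewrite -(star_hom_star fh) star_cone.
exists (cone - f cone); first by rewrite starB star_cone se.
by rewrite cmulBl !cmulBr !cmul1l cmul1r -(star_homM fh) cmul1l subrr subr0.
Qed.

(** [f] preserves the inequalities [- t <= star x ** x <= t], and these determine
    the norm. *)
Lemma star_hom_contractive x : normR (f x) <= normR x.
Proof.
rewrite -ler_sqr ?nnegrE ?normR_ge0// -!normR_starM.
rewrite -(star_hom_star fh) -(star_homM fh); set a := cmul (star x) x.
have sa : star a = a by rewrite /a starM starK.
apply: sq_between; first exact: normR_ge0.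
- by rewrite -(star_hom_star fh) sa.
- apply: star_hom_sq_scal; first exact: normR_ge0.
  by rewrite -(linB f_lin); apply: star_hom_sq; apply: sq_normR_le.
- apply: star_hom_sq_scal; first exact: normR_ge0.
  by rewrite -(linD f_lin); apply: star_hom_sq; apply: sq_normR_le'.
Qed.

End StarHom.

(** * Hilbert spaces *)

Section HilbertSpace.
Variables (R : realType) (H : hilbertType R).
Implicit Types (x y z : H) (c : R[i]).

Lemma dotDl x y z : dot (x + y) z = dot x z + dot y z.
Proof. by have := dot_linear 1 x y z; rewrite scale1r mul1r. Qed.

Lemma dot0l z : dot 0 z = 0 :> R[i].
Proof. by apply: (addrI (dot 0 z)); rewrite -dotDl !addr0. Qed.

Lemma dotZl c x z : dot (c *: x) z = c * dot x z.
Proof. by have := dot_linear c x 0 z; rewrite dot0l !addr0. Qed.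

Lemma dotNl x z : dot (- x) z = - dot x z.
Proof. by rewrite -scaleN1r dotZl mulN1r. Qed.

Lemma dot0r z : dot z 0 = 0 :> R[i].
Proof. by rewrite dot_conj dot0l rmorph0. Qed.

Lemma dotBl x y z : dot (x - y) z = dot x z - dot y z.
Proof. by rewrite dotDl dotNl. Qed.

Lemma dotBr z x y : dot z (x - y) = dot z x - dot z y.
Proof. by rewrite dot_conj dotBl rmorphB [dot z x]dot_conj [dot z y]dot_conj. Qed.

Lemma dot_normR x : dot x x = (normR x ^+ 2)%:C.
Proof. by rewrite dot_norm -normRE rmorphXn. Qed.

End HilbertSpace.

(** * Faithful representations *)

Section FaithfulRepresentation.
Variables (R : realType) (A : cstarType R) (H : hilbertType R).
Variable rho : A -> H -> H.
Hypothesis rf : faithful_rep rho.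
Implicit Types (a b : A) (v w : H).
Local Notation I := (@cone R A).
Local Notation "x ** y" := (cmul x y).
Let P v := rho I v.

(** The real part makes the quadratic form of any element real-valued; on
    selfadjoint elements nothing is lost. *)
Definition vector_form v a : R := complex.Re (dot (rho a v) v).

Lemma repD a b v : rho (a + b) v = rho a v + rho b v.
Proof. by have := rep_linear rf 1 a b v; rewrite !scale1r. Qed.

Lemma rep0 v : rho 0 v = 0.
Proof. by apply: (addrI (rho 0 v)); rewrite -repD !addr0. Qed.

Lemma repZ c a v : rho (c *: a) v = c *: rho a v.
Proof. by have := rep_linear rf c a 0 v; rewrite rep0 !addr0. Qed.

Lemma repN a v : rho (- a) v = - rho a v.
Proof. by rewrite -scaleN1r repZ scaleN1r. Qed.

Lemma repB a b v : rho (a - b) v = rho a v - rho b v.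
Proof. by rewrite repD repN. Qed.

Lemma rep_0r a : rho a 0 = 0. Proof. exact: lin0 (rep_op_linear rf a). Qed.

Lemma rep_eq0 a : (forall v, rho a v = 0) -> a = 0.
Proof.
by move=> a0; apply: (rep_inj rf); apply/funext => v; rewrite a0 rep0.
Qed.

Lemma rep_cone a v : rho a (P v) = rho a v.
Proof. by rewrite /P -(repM rf) cmul1r. Qed.

Lemma vector_formD v a b : vector_form v (a + b) = vector_form v a + vector_form v b.
Proof. by rewrite /vector_form repD dotDl raddfD. Qed.

Lemma vector_formB v a b : vector_form v (a - b) = vector_form v a - vector_form v b.
Proof. by rewrite /vector_form repB dotBl raddfB. Qed.

Lemma vector_formN v a : vector_form v (- a) = - vector_form v a.
Proof. by rewrite /vector_form repN dotNl raddfN. Qed.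

Lemma vector_formZ v (r : R) a : vector_form v (r%:C *: a) = r * vector_form v a.
Proof. by rewrite /vector_form repZ dotZl; case: (dot _ _) => p q /=; rewrite mul0r subr0. Qed.

Lemma vector_form_starM v a : vector_form v (star a ** a) = normR (rho a v) ^+ 2.
Proof. by rewrite /vector_form (repM rf) (rep_star rf) starK dot_normR. Qed.

Lemma vector_form_cone v : vector_form v I = normR (P v) ^+ 2.
Proof. by rewrite -vector_form_starM star_cone cmul1l. Qed.

Lemma vector_form_scal v r : vector_form v (scal A r) = r * normR (P v) ^+ 2.
Proof. by rewrite vector_formZ vector_form_cone. Qed.

Lemma vector_form_sq_ge0 v a : is_square a -> 0 <= vector_form v a.
Proof. by case=> y sy <-; rewrite -{1}sy vector_form_starM sqr_ge0. Qed.

(** Let [m] be the absolute value of [b] and [c = m - b], twice the negative part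
    of [b]. Then [b c = - m c], so that [c b c = - c m c] while its quadratic
    form is nonnegative; as [m] is a square this gives [m c = 0], and then
    [c^2 = 2 m c = 0]. *)
Lemma vector_form_ge0_sq b : star b = b -> (forall v, 0 <= vector_form v b) -> is_square b.
Proof.
move=> sb vb.
have [m [sm mm qm cm]] : exists y, [/\ star y = y, y ** y = b ** b, is_square y
    & forall z, commutes z (b ** b) -> commutes z y].
  by apply: sq_root; exists b.
have [g [sg gg _ cg]] := sq_root qm.
have bm : commutes b m by apply: cm; rewrite /commutes cmulA.
pose c := m - b.
have sc : star c = c by rewrite starB sm sb.
have cmm : commutes c m by apply: comm_sym; apply: commB => //; exact: comm_sym.
have cgg : commutes c g by exact: cg.
have bc : b ** c = - (m ** c).
  by rewrite /c !cmulBr mm bm opprB.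
have gc0 : g ** c = 0.
  apply: rep_eq0 => v; apply: normR_le0.
  have gcE : star (g ** c) ** (g ** c) = - (star c ** b ** c).
    rewrite starM sg sc -!cmulA bc cmulNr opprK; congr cmul.
    by rewrite cmulA gg.
  have : 0 <= vector_form (rho c v) b := vb _.
  have -> : vector_form (rho c v) b = vector_form v (star c ** b ** c).
    by rewrite /vector_form !(repM rf); congr complex.Re; rewrite [RHS](rep_star rf) starK.
  rewrite -[_ ** c]opprK -gcE vector_formN vector_form_starM oppr_ge0 => gc.
  have : normR (rho (g ** c) v) ^+ 2 == 0 by rewrite eq_le gc sqr_ge0.
  by rewrite sqrf_eq0 => /eqP->.
have cc : c ** c = 0.
  rewrite {1}/c cmulBl bc opprK.
  by rewrite -gg -!cmulA gc0 !cmul0r addr0.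
have c0 : c = 0.
  by apply: normR_eq0; apply/eqP; rewrite -sqrf_eq0 -normR_sqr// cc normR0.
by rewrite -(subKr m b) -/c c0 subr0.
Qed.

(** Faithful representations are isometric: the quadratic forms of
    [d^2 - star a ** a] and [d^2 + star a ** a] are nonnegative. *)
Lemma rep_bounded_below a d : 0 <= d ->
  (forall v, normR (rho a v) <= d * normR v) -> normR a <= d.
Proof.
move=> d0 ad; rewrite -ler_sqr ?nnegrE ?normR_ge0// -normR_starM.
have saa : star (star a ** a) = star a ** a by rewrite starM starK.
apply: sq_between => //; first exact: sqr_ge0.
  apply: vector_form_ge0_sq; first by rewrite starB star_scal saa.
  move=> v; rewrite vector_formB vector_form_scal vector_form_starM subr_ge0 -rep_cone -exprMn.
  by rewrite ler_sqr ?nnegrE ?normR_ge0// mulr_ge0// normR_ge0.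
apply: vector_form_ge0_sq; first by rewrite starD star_scal saa.
move=> v; rewrite vector_formD vector_form_scal vector_form_starM addr_ge0 ?sqr_ge0//.
by rewrite mulr_ge0// sqr_ge0.
Qed.

(** [rho I] is an orthogonal projection, possibly different from the identity. *)
Lemma rep_cone_le v : normR (P v) <= normR v.
Proof.
rewrite -ler_sqr ?nnegrE ?normR_ge0// -lecR -!dot_normR.
have PP : dot (P v) (P v) = dot (P v) v.
  by rewrite (rep_star rf) star_cone rep_cone [RHS](rep_star rf) star_cone.
have PP' : dot (P v) (P v) = dot v (P v).
  by rewrite dot_conj PP [RHS]dot_conj.
rewrite -subr_ge0.
have -> : dot v v - dot (P v) (P v) = dot (v - P v) (v - P v).
  by rewrite dotBl !dotBr -PP -PP' subrr subr0.
by rewrite dot_normR ler0c sqr_ge0.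
Qed.

Lemma rep_bounded a v : normR (rho a v) <= normR a * normR v.
Proof.
rewrite -ler_sqr ?nnegrE ?mulr_ge0 ?normR_ge0// -vector_form_starM.
have : is_square (scal A (normR a ^+ 2) - star a ** a).
  by apply: sq_normR_le; rewrite ?starM ?starK// normR_starM.
move/(vector_form_sq_ge0 v); rewrite vector_formB vector_form_scal subr_ge0 => /le_trans; apply.
rewrite exprMn ler_wpM2l ?sqr_ge0// ler_sqr ?nnegrE ?normR_ge0//.
exact: rep_cone_le.
Qed.

(** Apply [vector_form_ge0_sq] to [t - a] and [t + a]: vector functionals compute the
    norm of selfadjoint elements. *)
Lemma normR_le_vec a t : star a = a -> 0 <= t ->
  (forall v, `|vector_form v a| <= t * vector_form v I) -> normR a <= t.
Proof.
move=> sa t0 at_; apply: sq_between => //; apply: vector_form_ge0_sq.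
- by rewrite starB star_scal sa.
- move=> v; have := at_ v; rewrite vector_formB vector_formZ ler_norml => /andP[_].
  by rewrite subr_ge0.
- by rewrite starD star_scal sa.
- move=> v; have := at_ v; rewrite vector_formD vector_formZ ler_norml => /andP[+ _].
  by rewrite -subr_ge0 opprK addrC.
Qed.

End FaithfulRepresentation.

(** * Pointwise convergence of functionals *)

Section Pointwise.
Variables (R : realType) (X : choiceType).

Lemma ptws_cvgP (F : set_system {ptws X -> R}) (f : {ptws X -> R}) : Filter F ->
  F --> f <-> forall x, (fun g : {ptws X -> R} => g x) @ F --> f x.
Proof.
move=> FF; rewrite cvg_sup; split=> Ff x.
  have := Ff x; rewrite cvg_image; last first.
    by rewrite eqEsubset; split=> v // _; exists (cst v).
  apply: cvg_trans => W /=; rewrite ?nbhs_simpl /fmap /= => [[W' + <-]].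
  by apply: filterS => g W'g /=; exists g.
rewrite cvg_image; last by rewrite eqEsubset; split=> v // _; exists (cst v).
move=> W //=; rewrite ?nbhs_simpl => /Ff Q'; exists (@^~ x @^-1` W) => //.
by rewrite eqEsubset; split => [j [? + <-//]|j Wj]; exists (fun _ => j).
Qed.

Lemma ptws_eval_cvg (f : {ptws X -> R}) x :
  (fun g : {ptws X -> R} => g x) @ nbhs f --> f x.
Proof. by move: x; apply/ptws_cvgP. Qed.

End Pointwise.

(** * Metric and weak-* neighbourhoods of states *)

Section LipWeakStar.
Variables (R : realType) (V : lmodType R) (le : V -> V -> Prop) (e : V).
Variables (A : set V) (L : V -> R).
Local Notation S := (@states R V le e A).
Implicit Types mu lam nu : A -> R.

Lemma lip_dist_ub mu lam (a : A) : L (val a) <= 1 ->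
  ((`|mu a - lam a|)%:E <= lip_dist L mu lam)%E.
Proof. by move=> La; apply: ereal_sup_ubound; exists a. Qed.

Lemma lip_dist_triangle nu mu lam :
  (lip_dist L mu lam <= lip_dist L mu nu + lip_dist L nu lam)%E.
Proof.
apply: ge_ereal_sup => _ [a La <-].
rewrite (@le_trans _ _ (`|mu a - nu a| + `|nu a - lam a|)%:E)//.
  by rewrite lee_fin ler_distD.
by rewrite EFinD leeD// lip_dist_ub.
Qed.

Lemma lip_norm0 : lip_norm le e A L -> A 0 -> L 0 = 0.
Proof. by move=> lipL A0; apply/(lip_eq0 lipL) => //; exists 0; rewrite scale0r. Qed.

Lemma lip_dist_ge0 mu lam : lip_norm le e A L -> A 0 -> (0 <= lip_dist L mu lam)%E.
Proof.
move=> lipL A0; pose a : A := SigSub (mem_set A0).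
by rewrite (le_trans _ (@lip_dist_ub mu lam a _)) ?lee_fin// (lip_norm0 lipL).
Qed.

Lemma lip_dist_self mu (eps : R) : 0 < eps -> (lip_dist L mu mu < eps%:E)%E.
Proof.
move=> e0; rewrite (@le_lt_trans _ _ 0%E)//; apply: ge_ereal_sup => _ [a La <-].
by rewrite subrr normr0.
Qed.

(** Open metric balls are metrically open by the triangle inequality, hence weak-*
    open by the hypothesis on [L]. *)
Lemma near_lip_dist mu (eps : R) : lip_norm le e A L -> A 0 -> S mu -> 0 < eps ->
  \forall lam \near (mu : {ptws A -> R}), S lam -> (lip_dist L mu lam < eps%:E)%E.
Proof.
move=> lipL A0 Smu e0.
pose U := [set lam | S lam /\ (lip_dist L mu lam < eps%:E)%E].
have US : U `<=` S by move=> lam [].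
have [W oW UW] : exists2 W : set {ptws A -> R}, open W & U = S `&` W.
  apply/(lip_weak_star lipL US) => lam [Slam ml].
  have [r mlr] : exists r : R, lip_dist L mu lam = r%:E.
    have := lip_dist_ge0 mu lam lipL A0; case: lip_dist ml => // r _ _.
    by exists r.
  exists (eps - r); first by rewrite subr_gt0 -lte_fin -mlr.
  move=> kap Skap lk; rewrite /U /=; split=> //.
  rewrite (le_lt_trans (lip_dist_triangle lam _ _))// mlr.
  by rewrite -[eps](subrKC r) EFinD lteD2lE.
have Umu : U mu by rewrite /U /=; split=> //; exact: lip_dist_self.
have Wmu : W mu by move: Umu; rewrite UW => -[].
apply: filterS (open_nbhs_nbhs (conj oW Wmu)) => lam Wlam Slam.
have : U lam by rewrite UW; split.
by case.
Qed.

Lemma state_scale mu (x z : A) (r : R) : A 0 -> S mu ->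
  val z = r *: val x -> mu z = r * mu x.
Proof.
move=> A0 [mul _ _] zE; pose o : A := SigSub (mem_set A0).
have o0 : mu o = 0.
  have := mul 1 o o o; rewrite /= scaler0 addr0 => /(_ erefl) /eqP.
  by rewrite mul1r -subr_eq0 opprD addrA subrr sub0r oppr_eq0 => /eqP.
by rewrite (mul r x o) ?o0 ?addr0//= zE addr0.
Qed.

(** Only the inclusion of weak-* neighbourhoods in metric balls has content: in the
    other direction, metric balls around a state converge to it pointwise because
    evaluation at [x] is Lipschitz with constant [L x + 1]. *)
Lemma lip_weak_star_of_near :
  A 0 -> (forall x, A x -> 0 <= L x) ->
  (forall (r : R) x, A x -> A (r *: x)) ->
  (forall (r : R) x, A x -> L (r *: x) = `|r| * L x) ->
  (forall mu (eps : R), S mu -> 0 < eps -> \forall lam \near (mu : {ptws A -> R}),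
     S lam -> (lip_dist L mu lam < eps%:E)%E) ->
  forall U : set (A -> R), U `<=` S ->
    ((forall mu, U mu -> exists2 eps : R, 0 < eps &
        forall lam, S lam -> (lip_dist L mu lam < eps%:E)%E -> U lam)
     <-> exists2 W : set {ptws A -> R}, open W & U = S `&` W).
Proof.
move=> A0 L0 AZ LZ near_ball U US; split=> [Uopen|[W oW UW] mu Umu].
  exists (interior [set lam : {ptws A -> R} | S lam -> U lam]).
    exact: open_interior.
  apply/seteqP; split=> [mu Umu|mu [Smu]]; last first.
    by move=> /interior_subset; exact.
  split; first exact: US.
  have [eps e0 Ueps] := Uopen mu Umu.
  have nb := near_ball _ _ (US _ Umu) e0.
  apply: (@filterS _ _ (nbhs_filter (mu : {ptws A -> R})) _ _ _ nb) => lam ml Slam.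
  exact: Ueps (ml _).
have Smu : S mu := US _ Umu.
pose F : set_system {ptws A -> R} := filter_from [set eps : R | 0 < eps]
  (fun eps => [set lam | S lam /\ (lip_dist L mu lam < eps%:E)%E]).
have FF : Filter F.
  apply: filter_from_filter; first by exists 1; rewrite /= ltr01.
  move=> i j /= i0 j0; exists (Num.min i j); first by rewrite /= lt_min i0.
  by move=> lam [Slam]; rewrite EFin_min lt_min => /andP[li lj].
have Fmu : F --> (mu : {ptws A -> R}).
  apply/ptws_cvgP => a; apply/cvgrPdist_lt => d d0.
  have Aa : A (val a) by exact: set_mem (valP a).
  have La1 : 0 < L (val a) + 1 by rewrite ltr_wpDl// L0.
  exists (d / (L (val a) + 1)); first by rewrite /= divr_gt0.
  pose c := (L (val a) + 1)^-1.
  (* Rescaling by [L + 1] rather than [L] avoids a separate case for [L = 0]. *)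
pose a' : A := SigSub (mem_set (AZ c _ Aa)).
  have a'E lam : S lam -> lam a = (L (val a) + 1) * lam a'.
    move=> Slam; rewrite (state_scale (z := a') (x := a) (r := c) A0 Slam)//.
    by rewrite mulrA divff ?mul1r// gt_eqF.
  have La' : L (val a') <= 1.
    rewrite /= LZ// gtr0_norm ?invr_gt0// mulrC ler_pdivrMr// mul1r lerDl.
    exact: ler01.
  move=> lam [Slam ml]; rewrite /= (a'E mu)// (a'E lam)// -mulrBr.
  rewrite normrM gtr0_norm// mulrC -ltr_pdivlMr// -lte_fin (le_lt_trans _ ml)//.
  exact: lip_dist_ub.
have /Fmu[eps /= e0 Weps] : nbhs (mu : {ptws A -> R}) W.
  by apply: open_nbhs_nbhs; split=> //; move: Umu; rewrite UW => -[].
exists eps => // lam Slam ml; rewrite UW; split=> //; exact: Weps.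
Qed.

End LipWeakStar.

(** * Functionals on a subspace, evaluated at vectors *)

Section Evaluation.
Variables (R : realType) (V : Type) (S : set V).

(** States are functions on a subtype; [ev] extends them by [0] so that they can be
    applied to vectors computed in the ambient algebra. *)
Definition ev (mu : S -> R) (x : V) : R :=
  if pselect (S x) is left Sx then mu (SigSub (mem_set Sx)) else 0.

Lemma evE (mu : S -> R) x (Sx : S x) : ev mu x = mu (SigSub (mem_set Sx)).
Proof.
rewrite /ev; case: pselect => // Sx'.
by congr mu; apply: val_inj.
Qed.

Lemma ev_val (mu : S -> R) (a : S) : ev mu (val a) = mu a.
Proof.
by rewrite (evE _ (set_mem (valP a))); congr mu; apply: val_inj.
Qed.

End Evaluation.

(** * Unital subspaces of selfadjoint elements and their states *)

Section UnitalSubspace.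
Variables (R : realType) (A : cstarType R).
Implicit Types (a x y : A) (r t : R).
Local Notation I := (@cone R A).
Local Notation scal := (@scal R A).

Lemma cstar_leP x y : cstar_le x y <-> is_square (y - x).
Proof. exact: positiveP. Qed.

Lemma cstar_le_scalr a r : @cstar_le R A a (r *: (I : realified A)) <-> is_square (scal r - a).
Proof. exact: cstar_leP. Qed.

Lemma cstar_le_scall a r :
  @cstar_le R A (- r *: (I : realified A)) a <-> is_square (scal r + a).
Proof.
have -> : scal r + a = a - scal (- r) by rewrite scalN opprK addrC.
exact: cstar_leP.
Qed.

(** All order unit spaces of the theorem are of this form, and then the order unit
    axioms and the description of states follow from the positive cone. *)
Record unital_subspace (S : set A) : Prop := UnitalSubspace {
  us_lin : forall (r : R) x y, S x -> S y -> S (r%:C *: x + y);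
  us_cone : S I;
  us_sa : forall x, S x -> star x = x
}.

Lemma cqms_unital_subspace (S : set (realified A)) (L : realified A -> R) :
  dense_in_selfadjoint S -> cstar_cqms S L -> unital_subspace S.
Proof.
move=> [Ssa _] [oS _]; split=> [r x y Sx Sy||x /Ssa//].
  exact: (ous_lin oS).
exact: (ous_unit oS).
Qed.

Variable S : set A.
Hypothesis uS : unital_subspace S.

Lemma us0 : S 0.
Proof. by have := us_lin uS (-1) (us_cone uS) (us_cone uS); rewrite rmorphN1 scaleN1r addNr. Qed.

Lemma usZ r x : S x -> S (r%:C *: x).
Proof. by move=> Sx; have := us_lin uS r Sx us0; rewrite addr0. Qed.

Lemma usD x y : S x -> S y -> S (x + y).
Proof. by move=> Sx Sy; have := us_lin uS 1 Sx Sy; rewrite rmorph1 scale1r. Qed.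

Lemma usN x : S x -> S (- x).
Proof. by move=> /(usZ (-1)); rewrite rmorphN1 scaleN1r. Qed.

Lemma usB x y : S x -> S y -> S (x - y).
Proof. by move=> Sx /usN; exact: usD. Qed.

Lemma us_scal r : S (scal r).
Proof. exact: usZ (us_cone uS). Qed.

Lemma us_sum (J : Type) (s : seq J) (P : pred J) (F : J -> A) :
  (forall i, P i -> S (F i)) -> S (\sum_(i <- s | P i) F i).
Proof. by move=> SF; apply: big_ind => //; [exact: us0|exact: usD]. Qed.

Lemma order_unit_space_us : @order_unit_space R (realified A) (@cstar_le R A) I S.
Proof.
split.
- exact: us0.
- by move=> r x y Sx Sy; apply: us_lin.
- by move=> x Sx; apply/cstar_leP; rewrite subrr; exact: sq0.
- move=> x y Sx Sy /cstar_leP xy /cstar_leP yx; apply/esym/eqP; rewrite -subr_eq0.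
  by apply/eqP/(@sq_anti R A); rewrite ?opprB.
- move=> x y z _ _ _ /cstar_leP xy /cstar_leP yz; apply/cstar_leP.
  by rewrite -(subrKA y); exact: sqD.
- move=> x y z _ _ _ /cstar_leP xy; apply/cstar_leP.
  by rewrite opprD addrACA subrr addr0.
- move=> r x y r0 _ _ /cstar_leP xy; apply/cstar_leP.
  by have := sqZ r0 xy; rewrite scalerBr.
- exact: us_cone.
- move=> a Sa; exists (normR (a : A)); apply/cstar_leP.
  exact: sq_normR_le (us_sa uS Sa) (lexx _).
- move=> a Sa ar; apply/cstar_leP; rewrite sub0r.
  have sa := us_sa uS Sa.
  apply/positiveP; split; first by rewrite starN sa.
  move=> l nl.
  have lr r : 0 < r -> 0 <= l + r%:C.
    move=> /ar/cstar_leP/positiveP[_]; apply => -[b ib]; apply: nl; exists b.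
    suff <- : scal r - a - (l + r%:C) *: I = - a - l *: I by [].
    by rewrite scalerDl opprD [- _ - _]addrC addrACA subrr add0r.
  case: l lr {nl} => p q lr.
  have := lr 1 ltr01; rewrite lecE/= addr0 => /andP[/eqP q0 _].
  rewrite lecE/= q0 eqxx/=; apply/ler_addgt0Pr => r r0.
  by have := lr r r0; rewrite lecE/= => /andP[].
Qed.

Local Notation states := (@states R (realified A) (@cstar_le R A) I S).
Implicit Types mu : S -> R.

Lemma state_ev_lin mu r x y : states mu -> S x -> S y ->
  ev mu (r%:C *: x + y) = r * ev mu x + ev mu y.
Proof.
move=> [mul _ _] Sx Sy; rewrite (evE _ (us_lin uS r Sx Sy)) !evE.
by apply: mul.
Qed.

Lemma state_ev_cone mu : states mu -> ev mu I = 1.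
Proof. by move=> [_ mu1 _]; rewrite (evE _ (us_cone uS)) mu1. Qed.

Lemma state_ev0 mu : states mu -> ev mu 0 = 0.
Proof.
move=> Smu; have := state_ev_lin (-1) Smu us0 us0.
by rewrite scaler0 addr0 mulN1r addNr.
Qed.

Lemma state_evD mu x y : states mu -> S x -> S y -> ev mu (x + y) = ev mu x + ev mu y.
Proof.
by move=> Smu Sx Sy; have := state_ev_lin 1 Smu Sx Sy; rewrite scale1r mul1r.
Qed.

Lemma state_evZ mu r x : states mu -> S x -> ev mu (r%:C *: x) = r * ev mu x.
Proof.
by move=> Smu Sx; have := state_ev_lin r Smu Sx us0; rewrite !addr0 state_ev0// addr0.
Qed.

Lemma state_evN mu x : states mu -> S x -> ev mu (- x) = - ev mu x.
Proof.
by move=> Smu Sx; have := state_evZ (-1) Smu Sx; rewrite rmorphN1 scaleN1r mulN1r.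
Qed.

Lemma state_evB mu x y : states mu -> S x -> S y -> ev mu (x - y) = ev mu x - ev mu y.
Proof. by move=> Smu Sx Sy; rewrite state_evD ?state_evN//; exact: usN. Qed.

Lemma state_ev_sum mu (J : Type) (s : seq J) (F : J -> A) : states mu ->
  (forall i, S (F i)) -> ev mu (\sum_(i <- s) F i) = \sum_(i <- s) ev mu (F i).
Proof.
move=> Smu SF; elim: s => [|i s IH]; first by rewrite !big_nil state_ev0.
by rewrite !big_cons state_evD ?IH//; apply: us_sum.
Qed.

(** A positive [a] of norm [t] satisfies [-1 <= (2/t) a - 1 <= 1], so a functional
    of dual norm [1] is at least [-1] there. *)
Lemma state_ev_ge0 mu a : states mu -> S a -> is_square a -> 0 <= ev mu a.
Proof.
move=> Smu Sa qa; have [_ _ mu1] := Smu.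
have sa := us_sa uS Sa.
have [t0|t0] := eqVneq (normR a) 0.
  by rewrite (normR_eq0 t0) state_ev0.
have {}t0 : 0 < normR a by rewrite lt_neqAle eq_sym t0 normR_ge0.
set t := normR a in t0.
have t2 : 0 < 2 / t by rewrite divr_gt0.
pose b := (2 / t)%:C *: a - I.
have Sb : S b by apply: usB; [exact: usZ|exact: us_cone].
have b1 : @order_norm R (realified A) (@cstar_le R A) I b <= 1.
  rewrite /order_norm; set E := [set r | _].
  have E1 : E 1.
    split; [apply/cstar_le_scall|apply/cstar_le_scalr]; rewrite scal1.
      by rewrite addrC subrK; apply: sqZ => //; exact: ltW.
    have -> : I - b = (2 / t)%:C *: (scal t - a).
      rewrite scalerBr scalZ divfK ?gt_eqF// opprB addrA -scal1 -scalD.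
      by rewrite -[2%:R]/(1 + 1).
    by apply: sqZ; [exact: ltW|exact: sq_normR_le].
  have [iE|iE] := pselect (has_inf E); first by apply: inf_lbound => //; case: iE.
  by rewrite inf_out.
have : ((`|ev mu b|)%:E <= 1)%E.
  by rewrite -mu1 evE; apply: ereal_sup_ubound; eexists; [|reflexivity].
rewrite lee_fin state_evB ?state_evZ ?state_ev_cone//; last 2 first.
- exact: usZ.
- exact: us_cone.
by rewrite ler_norml => /andP[+ _]; rewrite lerBrDl subrr pmulr_rge0.
Qed.

Lemma state_ev_le mu a t : states mu -> S a -> normR a <= t -> `|ev mu a| <= t.
Proof.
move=> Smu Sa at_; have sa := us_sa uS Sa.
have tE : ev mu (scal t) = t by rewrite state_evZ ?state_ev_cone ?mulr1//; exact: us_cone.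
have := @state_ev_ge0 mu (scal t - a) Smu (usB (us_scal t) Sa) (sq_normR_le sa at_).
have := @state_ev_ge0 mu (scal t + a) Smu (usD (us_scal t) Sa) (sq_normR_le' sa at_).
rewrite state_evB ?state_evD ?tE//; try exact: us_scal.
by rewrite ler_norml => h1 h2; lra.
Qed.

(** Converse of [state_ev_ge0]: positivity bounds [f a] by every [r] with
    [- r <= a <= r], and [f I = 1] shows that the bound is attained. *)
Lemma positive_state (f : A -> R) :
  (forall r x y, S x -> S y -> f (r%:C *: x + y) = r * f x + f y) ->
  f I = 1 -> (forall a, S a -> is_square a -> 0 <= f a) ->
  states (fun a : S => f (val a)).
Proof.
move=> fl f1 fp.
have f0 : f 0 = 0.
  by have := fl (-1) _ _ us0 us0; rewrite scaler0 addr0 mulN1r addNr.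
have fZ r x : S x -> f (r%:C *: x) = r * f x.
  by move=> Sx; have := fl r _ _ Sx us0; rewrite f0 !addr0.
have fscal r : f (scal r) = r by rewrite fZ ?f1 ?mulr1//; exact: us_cone.
have fD x y : S x -> S y -> f (x + y) = f x + f y.
  by move=> Sx Sy; have := fl 1 _ _ Sx Sy; rewrite scale1r mul1r.
have fN x : S x -> f (- x) = - f x.
  by move=> Sx; have := fZ (-1) _ Sx; rewrite rmorphN1 scaleN1r mulN1r.
pose E (a : A) := [set r : R | @cstar_le R A (- r *: (I : realified A)) a /\
  @cstar_le R A a (r *: (I : realified A))].
have fE a r : S a -> E a r -> `|f a| <= r.
  move=> Sa [/cstar_le_scall h1 /cstar_le_scalr h2].
  have := fp _ (usD (us_scal r) Sa) h1; have := fp _ (usB (us_scal r) Sa) h2.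
  rewrite !fD ?fN ?fscal//; try exact: us_scal; try exact: usN.
  by rewrite ler_norml => k1 k2; lra.
have E0 a : S a -> E a !=set0.
  move=> Sa; exists (normR a); have sa := us_sa uS Sa.
  split; [apply/cstar_le_scall|apply/cstar_le_scalr].
    exact: sq_normR_le'.
  exact: sq_normR_le.
split.
- by move=> r x y z zE; rewrite zE; apply: fl; apply: set_mem; exact: valP.
- by move=> u uE; rewrite uE.
- apply/le_anti/andP; split.
    apply: ge_ereal_sup => _ [a a1 <-]; rewrite lee_fin.
    have Sa : S (val a) by apply: set_mem; exact: valP.
    apply: le_trans a1; apply: lb_le_inf; first exact: E0.
    by move=> r; exact: fE.
  apply: ereal_sup_ubound; exists (SigSub (mem_set (us_cone uS))) => /=.
    apply: inf_lbound.
      by exists 1 => r /(fE _ _ (us_cone uS)); rewrite f1 normr1.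
    split; [apply/cstar_le_scall|apply/cstar_le_scalr]; rewrite scal1.
      by apply: sqD; exact: sq_cone.
    by rewrite subrr; exact: sq0.
  by rewrite f1 normr1.
Qed.

End UnitalSubspace.

(** * Finite diameter of the state space *)

Section LipNormBound.
Variables (R : realType) (A : cstarType R).
Implicit Types (a x y : A) (r t : R).
Local Notation I := (@cone R A).
Local Notation scal := (@scal R A).
Variables (S : set A) (L : A -> R).
Hypothesis uS : unital_subspace S.
Local Notation states := (@states R (realified A) (@cstar_le R A) I S).
Hypothesis lipL : @lip_norm R (realified A) (@cstar_le R A) I S L.

Lemma lip_scale r a : S a -> L (r%:C *: a) = `|r| * L a.
Proof. exact: lip_homog lipL r a. Qed.

Lemma lip_add a b : S a -> S b -> L (a + b) <= L a + L b.
Proof. exact: lip_triangle lipL a b. Qed.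

Lemma convex_state (mu lam : S -> R) t : states mu -> states lam -> 0 <= t <= 1 ->
  states (fun a : S => mu a + t * (lam a - mu a)).
Proof.
move=> Smu Slam /andP[t0 t1].
pose f a := ev mu a + t * (ev lam a - ev mu a).
rewrite (_ : (fun a : S => _) = (fun a : S => f (val a))); last first.
  by apply/funext => a; rewrite /f !ev_val.
apply: (positive_state uS).
- by move=> r x y Sx Sy; rewrite /f !(state_ev_lin uS)//; ring.
- by rewrite /f !(state_ev_cone uS)// subrr mulr0 addr0.
- move=> a Sa qa; have := state_ev_ge0 uS Smu Sa qa.
  have := state_ev_ge0 uS Slam Sa qa; rewrite /f; nra.
Qed.

(** Moving from [mu] towards any state [lam] by a fixed small proportion [t] stays
    in the pointwise neighbourhood of [mu] where [lip_dist] is below [1], and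
    [lip_dist] scales linearly along the segment; so [1 / t] bounds the distance
    to every state. *)
Lemma lip_dist_bounded (mu : S -> R) : states mu ->
  exists2 D : R, 0 < D & forall lam, states lam ->
    forall a, S a -> `|ev lam a - ev mu a| <= D * L a.
Proof.
move=> Smu.
have nb := near_lip_dist lipL (us0 uS) Smu ltr01.
(* Initial parts of the segments from [mu] to the states: they shrink to [mu]
   because states are bounded at each vector. *)
pose F : set_system {ptws S -> R} := filter_from [set t : R | 0 < t <= 1]
  (fun t => [set kap | exists2 s, 0 <= s <= t & exists2 lam, states lam &
     kap = (fun a : S => mu a + s * (lam a - mu a))]).
have FF : Filter F.
  apply: filter_from_filter; first by exists 1; rewrite /= ltr01 lexx.
  move=> i j /= /andP[i0 i1] /andP[j0 j1]; exists (Num.min i j).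
    by rewrite /= lt_min i0 j0 ge_min i1.
  move=> kap [s /andP[s0]]; rewrite le_min => /andP[si sj] [lam Slam ->].
  by split; exists s; rewrite ?s0 ?si ?sj//; exists lam.
have Fmu : F --> (mu : {ptws S -> R}).
  apply/ptws_cvgP => a; apply/cvgrPdist_lt => d d0.
  have Sa : S (val a) by exact: set_mem (valP a).
  pose M := 2 * normR (val a : A) + 1.
  have M0 : 0 < M by rewrite ltr_wpDl// mulr_ge0// normR_ge0.
  exists (Num.min 1 (d / M / 2)).
    by rewrite /= lt_min ltr01 !divr_gt0//= ge_min lexx.
  move=> kap [s /andP[s0]]; rewrite le_min => /andP[_ sd] [lam Slam ->] /=.
  rewrite opprD addrA subrr sub0r normrN normrM (ger0_norm s0).
  have lm : `|lam a - mu a| <= M.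
    rewrite (le_trans (ler_normB _ _))// -!ev_val.
    have := state_ev_le uS Slam Sa (lexx _); have := state_ev_le uS Smu Sa (lexx _).
    by rewrite /M; lra.
  have : s * `|lam a - mu a| <= d / M / 2 * M by rewrite ler_pM.
  have -> : d / M / 2 * M = d / 2 by field; rewrite gt_eqF.
  by move/le_lt_trans; apply; rewrite ltr_pdivrMr// ltr_pMr// ltr1n.
have [t /andP[t0 t1] nbt] := Fmu _ nb.
exists t^-1; first by rewrite invr_gt0.
move=> lam Slam.
pose kap (a : S) := mu a + t * (lam a - mu a).
have Skap : states kap by apply: convex_state => //; rewrite ltW.
have mk : (@lip_dist R (realified A) S L mu kap < 1%:E)%E.
  apply: (nbt kap) => //; exists t; first by rewrite lexx ltW.
  by exists lam.
have le1 a : S a -> L a <= 1 -> `|ev lam a - ev mu a| <= t^-1.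
  move=> Sa La; rewrite !(evE _ Sa); set a' : S := SigSub _.
  have := lt_le_trans mk (lexx _) => /ltW; move/(le_trans (@lip_dist_ub R (realified A) S L mu kap a' La)).
  rewrite lee_fin /kap opprD addrA subrr sub0r normrN normrM gtr0_norm//.
  by rewrite -ler_pdivlMl// mulr1.
move=> a Sa.
have [La0|La0] := eqVneq (L a) 0.
  have [r ->] := (lip_eq0 lipL Sa).1 La0.
  rewrite -[r *: _]/(r%:C *: I) !(state_evZ uS)// ?(state_ev_cone uS)// ?subrr ?normr0;
    try exact: us_cone uS.
  by rewrite lip_scale ?mulr_ge0 ?invr_ge0 ?(ltW t0) ?(lip_ge0 lipL)//; exact: us_cone uS.
have La : 0 < L a by rewrite lt_neqAle eq_sym La0 (lip_ge0 lipL).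
have := le1 ((L a)^-1%:C *: a) (usZ uS _ Sa).
rewrite lip_scale// gtr0_norm ?invr_gt0// mulVf// => /(_ (lexx _)).
rewrite !(state_evZ uS)// -mulrBr normrM gtr0_norm ?invr_gt0//.
by rewrite mulrC ler_pdivrMr.
Qed.

End LipNormBound.

(** * The norm is bounded by the Lip norm *)

Section StateBound.
Variables (R : realType) (A : cstarType R) (H : hilbertType R).
Variables (rho : A -> H -> H) (S : set A) (L : A -> R) (nu : A -> R[i]).
Hypothesis rf : faithful_rep rho.
Hypothesis uS : unital_subspace S.
Hypothesis lipL : @lip_norm R (realified A) (@cstar_le R A) (@cone R A) S L.
Hypothesis snu : cstar_state nu.
Local Notation I := (@cone R A).
Local Notation states := (@states R (realified A) (@cstar_le R A) I S).
Implicit Types (a b : A) (r : R).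

Definition nuR a := complex.Re (nu a).

Lemma nuR_lin r a b : nuR (r%:C *: a + b) = r * nuR a + nuR b.
Proof.
have [nul _ _] := snu; rewrite /nuR nul raddfD/=.
by case: (nu a) => p q /=; rewrite mul0r subr0.
Qed.

Lemma nuR_sq a : is_square a -> 0 <= nuR a.
Proof.
have [_ nup _] := snu; move=> /sq_positive/nup; rewrite lecE => /andP[_].
by [].
Qed.

Lemma nuR_cone : nuR I = 1. Proof. by have [_ _ nu1] := snu; rewrite /nuR nu1. Qed.

(** [normR a + a] is positive, so [nu] takes a real value on it. *)
Lemma nu_real a : star a = a -> complex.Re `|nu a| = `|nuR a|.
Proof.
have [nul nup nu1] := snu; move=> sa.
suff im0 : complex.Im (nu a) = 0.
  rewrite /nuR; case: (nu a) im0 => p q /= ->.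
  by rewrite expr0n addr0 sqrtr_sqr.
have : 0 <= nu (scal A (normR a) + a).
  by apply/nup/sq_positive/sq_normR_le'.
rewrite nul nu1 mulr1 lecE raddfD/= => /andP[+ _].
by rewrite add0r eq_sym => /eqP.
Qed.

Lemma nu_state : states (fun a : S => nuR (val a)).
Proof.
apply: (positive_state uS) => [r x y _ _||a _]; [exact: nuR_lin|exact: nuR_cone|].
exact: nuR_sq.
Qed.

(** Normalized vector functionals are states, hence at bounded [lip_dist] from [nu],
    and they compute the norm. *)
Lemma normR_le_lip : exists2 D : R, 0 < D &
  forall a, S a -> normR a <= D * (L a + complex.Re `|nu a|).
Proof.
have [D D0 Db] := lip_dist_bounded uS lipL nu_state.
exists (D + 1); first by rewrite addr_gt0.
move=> a Sa; have sa := us_sa uS Sa; rewrite nu_real//.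
have La := lip_ge0 lipL Sa.
suff le : normR a <= D * L a + `|nuR a|.
  by rewrite (le_trans le)//; have := normr_ge0 (nuR a); nra.
apply: (normR_le_vec rf sa).
  by rewrite addr_ge0// mulr_ge0// ltW.
move=> v; set m := vector_form rho v I.
have mE : m = normR (rho I v) ^+ 2 by exact: vector_form_cone.
have [m0|m0] := eqVneq m 0.
  have Pv0 : rho I v = 0.
    by apply: normR_eq0; apply/eqP; rewrite -sqrf_eq0 -mE m0.
  rewrite m0 mulr0 /vector_form -(rep_cone rf) Pv0 (rep_0r rf) dot0l/=.
  by rewrite normr0.
have {}m0 : 0 < m by rewrite lt_neqAle eq_sym m0 mE sqr_ge0.
pose f b := vector_form rho v b / m.
have Sf : states (fun b : S => f (val b)).
  apply: (positive_state uS) => [r x y _ _||b _ qb].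
  - by rewrite /f (vector_formD rf) (vector_formZ rf) mulrDl mulrA.
  - by rewrite /f divff// gt_eqF.
  - by rewrite /f divr_ge0 ?(ltW m0)//; exact: vector_form_sq_ge0.
have := Db _ Sf a Sa; rewrite !evE /=.
have -> : vector_form rho v a = f a * m by rewrite /f divfK// gt_eqF.
rewrite normrM (gtr0_norm m0) ler_pM2r// => h.
by rewrite -[f a](subrK (nuR a)) (le_trans (ler_normD _ _))// lerD2r.
Qed.

End StateBound.

(** * The space of square-summable sequences *)

Section L2Norm.
Variables (R : realType) (V : normedModType R[i]).
Implicit Types (x y : l2 V) (v : V) (M : R).

Let psum (x : nat -> V) n : R := \sum_(0 <= k < n) normR (x k) ^+ 2.

Lemma sqsum_ge0 (x : nat -> V) : (0 <= sqsum x)%E.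
Proof. by apply: nneseries_ge0 => n _ _; rewrite lee_fin sqr_ge0. Qed.

Lemma l2_norm_ge0 x : 0 <= l2_norm x. Proof. exact: sqrtr_ge0. Qed.

Lemma l2_normE x : ((l2_norm x ^+ 2)%:E = sqsum x)%E.
Proof.
have x0 := sqsum_ge0 x.
have xfin : (sqsum x < +oo)%E by case: x {x0} => x xP /=; exact: xP.
rewrite /l2_norm sqr_sqrtr ?fine_ge0// fineK//.
by rewrite ge0_fin_numE.
Qed.

Lemma psum_le x n : psum x n <= l2_norm x ^+ 2.
Proof.
rewrite -lee_fin l2_normE /psum -sumEFin.
by apply: nneseries_lim_ge => k _ _; rewrite lee_fin sqr_ge0.
Qed.

Lemma l2_norm_le x M : 0 <= M -> (forall n, psum x n <= M ^+ 2) -> l2_norm x <= M.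
Proof.
move=> M0 xM; rewrite -ler_sqr ?nnegrE ?l2_norm_ge0// -lee_fin l2_normE.
rewrite /sqsum; apply: lime_le.
  by apply: is_cvg_nneseries => k _ _; rewrite lee_fin sqr_ge0.
by apply: nearW => n; rewrite sumEFin lee_fin; exact: xM.
Qed.

Lemma l2_comp_le x i : normR (x i) <= l2_norm x.
Proof.
rewrite -ler_sqr ?nnegrE ?l2_norm_ge0 ?normR_ge0//.
rewrite (le_trans _ (psum_le x i.+1))// /psum big_nat_recr//= lerDr.
by apply: sumr_ge0 => k _; exact: sqr_ge0.
Qed.

Lemma l2_singleE j v n : l2_single j v n = if n == j then v else 0.
Proof. by []. Qed.

Lemma l2_addE x y n : (x + y) n = x n + y n. Proof. by []. Qed.

Lemma l2_oppE x n : (- x) n = - x n. Proof. by []. Qed.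

Lemma l2_scaleE c x n : (c *: x) n = c *: x n. Proof. by []. Qed.

Lemma l2_zeroE n : (0 : l2 V) n = 0. Proof. by []. Qed.

Lemma l2_ext x y : (forall n, x n = y n) -> x = y.
Proof. by move=> xy; apply: val_inj; apply/funext. Qed.

Lemma l2_sumE (J : Type) (s : seq J) (P : pred J) (F : J -> l2 V) n :
  (\sum_(i <- s | P i) F i) n = \sum_(i <- s | P i) F i n.
Proof. by elim/big_rec2: _ => [|i a b _ <-]. Qed.

Lemma l2_single_lin j c v w :
  l2_single j (c *: v + w) = c *: l2_single j v + l2_single j w.
Proof.
apply: l2_ext => n; rewrite l2_addE l2_scaleE !l2_singleE.
by case: ifP; rewrite ?scaler0 ?addr0.
Qed.

Lemma l2_norm_single j v : l2_norm (l2_single j v) = normR v.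
Proof.
apply/le_anti/andP; split; last first.
  by have := l2_comp_le (l2_single j v) j; rewrite l2_singleE eqxx.
apply: l2_norm_le; first exact: normR_ge0.
move=> n; rewrite /psum.
have [jn|nj] := ltnP j n; last first.
  rewrite big_nat big1 ?sqr_ge0// => k /andP[_ kn].
  by rewrite l2_singleE ltn_eqF ?(leq_trans kn)// normR0 expr0n.
rewrite (bigD1_seq j) ?mem_index_iota ?iota_uniq//= eqxx big1 ?addr0//.
by move=> k kj; rewrite (negbTE kj) normR0 expr0n.
Qed.

Lemma l2_norm0 : l2_norm (0 : l2 V) = 0.
Proof.
apply/le_anti; rewrite l2_norm_ge0 andbT; apply: l2_norm_le => // n.
by rewrite /psum big1 ?expr0n// => k _; rewrite l2_zeroE normR0 expr0n.
Qed.

Lemma l2_norm_eq0 x : l2_norm x = 0 -> x = 0.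
Proof.
move=> x0; apply: l2_ext => n; apply: normR_le0.
by have := l2_comp_le x n; rewrite x0.
Qed.

Lemma l2_normZ c x : l2_norm (c *: x) <= normR (c : R[i]^o) * l2_norm x.
Proof.
apply: l2_norm_le; first by rewrite mulr_ge0 ?normR_ge0 ?l2_norm_ge0.
move=> n; rewrite /psum; under eq_bigr do rewrite l2_scaleE normRZ exprMn.
by rewrite -big_distrr/= exprMn ler_wpM2l ?sqr_ge0// psum_le.
Qed.

(** The constant [2] stands in for Minkowski's inequality: estimates of operators
    below matter only up to a constant. *)
Lemma l2_normD x y : l2_norm (x + y) <= 2 * (l2_norm x + l2_norm y).
Proof.
have nx := l2_norm_ge0 x; have ny := l2_norm_ge0 y.
apply: l2_norm_le; first by rewrite mulr_ge0// addr_ge0.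
move=> n.
apply: (@le_trans _ _ (2 * (psum x n + psum y n))).
  rewrite /psum -big_split/= big_distrr/=; apply: ler_sum => k _.
  suff : normR (x k + y k) ^+ 2 <= 2 * (normR (x k) ^+ 2 + normR (y k) ^+ 2) by [].
  have := normRD (x k) (y k); have := normR_ge0 (x k); have := normR_ge0 (y k).
  have := normR_ge0 (x k + y k).
  by have := sqr_ge0 (normR (x k) - normR (y k)); nra.
have := psum_le x n; have := psum_le y n; nra.
Qed.

Definition l2_trunc N x : l2 V := \sum_(k < N) l2_single k (x k).

Lemma l2_truncE N x n : l2_trunc N x n = if (n < N)%N then x n else 0.
Proof.
rewrite /l2_trunc l2_sumE; case: ltnP => nN.
  rewrite (bigD1 (Ordinal nN))//= eqxx big1 ?addr0// => k kn.
  by case: eqP => // nk; move: kn; rewrite -val_eqE/= nk eqxx.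
by rewrite big1// => k _; rewrite l2_singleE gtn_eqF// (leq_trans (ltn_ord k)).
Qed.

Lemma l2_trunc_cvg x e : 0 < e -> exists N, l2_norm (x - l2_trunc N x) < e.
Proof.
move=> e0.
have e2 : 0 < (e / 2) ^+ 2 by rewrite exprn_gt0// divr_gt0.
have [N hN] : exists N, l2_norm x ^+ 2 - (e / 2) ^+ 2 < psum x N.
  apply: contrapT => /forallNP hN.
  have : (sqsum x <= (l2_norm x ^+ 2 - (e / 2) ^+ 2)%:E)%E.
    rewrite /sqsum; apply: lime_le.
      by apply: is_cvg_nneseries => k _ _; rewrite lee_fin sqr_ge0.
    apply: nearW => n; rewrite sumEFin lee_fin leNgt; apply/negP; exact: hN.
  by rewrite -l2_normE lee_fin; lra.
exists N; apply: (@le_lt_trans _ _ (e / 2)); last first.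
  by rewrite ltr_pdivrMr// ltr_pMr// ltr1n.
apply: l2_norm_le; first by rewrite ltW// divr_gt0.
move=> n.
have tE k : (x - l2_trunc N x) k = if (k < N)%N then 0 else x k.
  by rewrite l2_addE l2_oppE l2_truncE; case: ifP; rewrite ?subrr ?subr0.
pose t k := if (k < N)%N then 0 else normR (x k) ^+ 2.
suff : \sum_(0 <= k < n) t k <= (e / 2) ^+ 2.
  apply: le_trans; rewrite le_eqVlt; apply/orP; left; apply/eqP.
  by apply: eq_bigr => k _; rewrite tE /t; case: ifP; rewrite ?normR0 ?expr0n.
apply: (@le_trans _ _ (psum x (maxn n N) - psum x N)); last first.
  by have := psum_le x (maxn n N); lra.
rewrite /psum (big_cat_nat (leq0n N) (leq_maxr n N))/= addrAC subrr add0r.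
have [nN|Nn] := leqP n N.
  rewrite big_nat big1; first by apply: sumr_ge0 => k _; exact: sqr_ge0.
  by move=> k /andP[_ kn]; rewrite /t (leq_trans kn nN).
rewrite (big_cat_nat (leq0n N) (ltnW Nn))/=.
rewrite big_nat big1 ?add0r; last by move=> k /andP[_ kN]; rewrite /t kN.
rewrite big_nat [leRHS]big_nat; apply: ler_sum => k /andP[Nk _].
by rewrite /t ltnNge Nk.
Qed.

End L2Norm.

(** * Bounded operators on square-summable sequences *)

Section BoundedOperators.
Variables (R : realType) (V : normedModType R[i]).
Implicit Types (S T : l2 V -> l2 V) (x y : l2 V) (v : V) (M N : R).

Lemma op_bound_lin (c : R[i]) S T M N : op_bound S M -> op_bound T N ->
  op_bound (c *: S + T) (2 * (normR (c : R[i]^o) * M + N)).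
Proof.
move=> [M0 SM] [N0 TN]; split.
  by rewrite mulr_ge0// addr_ge0// mulr_ge0 ?normR_ge0.
move=> x; rewrite (le_trans (l2_normD (c *: S x) (T x)))// -mulrA ler_wpM2l//.
rewrite mulrDl lerD// (le_trans (l2_normZ _ _))// -mulrA.
by rewrite ler_wpM2l ?normR_ge0.
Qed.

Lemma linear_lin (c : R[i]) S T : linear S -> linear T -> linear (c *: S + T).
Proof.
move=> Sl Tl d x y.
have -> : (c *: S + T) (d *: x + y) = c *: S (d *: x + y) + T (d *: x + y) by [].
rewrite Sl Tl scalerDr addrACA; congr (_ + _).
by rewrite [RHS](scalerDr d (c *: S x) (T x)) !scalerA mulrC.
Qed.

Lemma bounded_op_lin (c : R[i]) S T : bounded_op S -> bounded_op T ->
  bounded_op (c *: S + T).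
Proof.
move=> [Sl [M SM]] [Tl [N TN]]; split; first exact: linear_lin.
by exists (2 * (normR (c : R[i]^o) * M + N)); exact: op_bound_lin.
Qed.

Lemma op_bound0 : op_bound (0 : l2 V -> l2 V) 0.
Proof. by split=> // x; rewrite l2_norm0 mul0r. Qed.

Lemma bounded_op0 : bounded_op (0 : l2 V -> l2 V).
Proof.
by split; [move=> c x y; rewrite scaler0 addr0|exists 0; exact: op_bound0].
Qed.

Lemma op_bound_comp S T M N : op_bound S M -> op_bound T N ->
  op_bound (S \o T) (M * N).
Proof.
move=> [M0 SM] [N0 TN]; split; first exact: mulr_ge0.
by move=> x; rewrite (le_trans (SM _))// -mulrA ler_wpM2l.
Qed.

Lemma bounded_op_comp S T : bounded_op S -> bounded_op T -> bounded_op (S \o T).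
Proof.
move=> [Sl [M SM]] [Tl [N TN]]; split; first by move=> c x y /=; rewrite Tl Sl.
by exists (M * N); exact: op_bound_comp.
Qed.

Lemma op_norm_le T M : op_bound T M -> op_norm T <= M.
Proof. by move=> TM; apply: inf_lbound => //; exists 0 => N []. Qed.

Lemma op_norm_lt T e : bounded_op T -> op_norm T < e ->
  exists2 M, M < e & op_bound T M.
Proof.
move=> [_ T0] Te; have hT : has_inf (op_bound T) by split=> //; exists 0 => N [].
have e0 : 0 < e - op_norm T by rewrite subr_gt0.
have [M TM Me] := inf_adherent e0 hT.
by exists M => //; rewrite (lt_le_trans Me)// addrC subrK.
Qed.

(** Finitely supported sequences are dense. *)
Lemma bounded_op_ext S T : bounded_op S -> bounded_op T ->
  (forall j v, S (l2_single j v) = T (l2_single j v)) -> S = T.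
Proof.
move=> Sb Tb ST; apply/funext => x; apply/eqP; rewrite -subr_eq0; apply/eqP.
have [Dl [M [M0 DM]]] := bounded_op_lin (-1) Tb Sb.
pose D := -1 *: T + S; have {}Dl : linear D := Dl.
have DE y : D y = S y - T y.
  by rewrite (_ : D y = -1 *: T y + S y)// addrC scaleN1r.
have D0 j v : D (l2_single j v) = 0 by rewrite DE ST subrr.
rewrite -DE; apply: l2_norm_eq0; apply/le_anti; rewrite l2_norm_ge0 andbT.
apply/ler_addgt0Pr => e e0; rewrite add0r.
have M1 : 0 < M + 1 by rewrite ltr_wpDl.
have [N xN] := l2_trunc_cvg x (divr_gt0 e0 M1).
have -> : D x = D (x - l2_trunc N x).
  by rewrite (linB Dl) (lin_sum Dl) big1 ?subr0// => k _; exact: D0.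
rewrite (le_trans (DM _))//.
move: xN; rewrite ltr_pdivlMr// => xN.
by have := l2_norm_ge0 (x - l2_trunc N x); nra.
Qed.

End BoundedOperators.

(** * Scalar matrix units are compact *)

Section ScalarCompactOperators.
Variable R : realType.
Local Notation C := (R[i]^o).
Implicit Types (k : l2 C -> l2 C).

Lemma normR_complex (z : C) :
  normR z ^+ 2 = complex.Re z ^+ 2 + complex.Im z ^+ 2.
Proof.
case: z => p q; have -> : normR (p +i* q : C) = Num.sqrt (p ^+ 2 + q ^+ 2) by [].
by rewrite sqr_sqrtr// addr_ge0// sqr_ge0.
Qed.

Lemma bolzano_weierstrass_complex (z : nat -> C) : (forall n, normR (z n) <= 1) ->
  exists (phi : nat -> nat) (l : C), {homo phi : m n / (m < n)%N} /\
    normR (z (phi n) - l) @[n --> \oo] --> (0 : R).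
Proof.
move=> z1.
have Rez n : `|complex.Re (z n)| <= 1 /\ `|complex.Im (z n)| <= 1.
  have := normR_complex (z n); have := z1 n; have := normR_ge0 (z n) => h1 h2 h3.
  by split; rewrite -[leRHS]normr1 -ler_sqr ?nnegrE ?normr_ge0// !real_normK ?num_real//;
    nra.
have bnd (u : nat -> R) : (forall n, `|u n| <= 1) -> bounded_fun u.
  move=> u1; exists 1; split; first exact: num_real.
  by move=> M M1 n _ /=; rewrite (le_trans (u1 n))// ltW.
have [f fi /cvg_ex[a /= fa]] := bolzano_weierstrass (bnd _ (fun n => (Rez n).1)).
have [g gi /cvg_ex[b /= gb]] := bolzano_weierstrass (bnd _ (fun n => (Rez (f n)).2)).
have {}fi : {mono f : n m / (n <= m)%N} by move=> n m; exact: fi.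
have {}gi : {mono g : n m / (n <= m)%N} by move=> n m; exact: gi.
have gn n : (n <= g n)%N.
  elim: n => // n IH; apply: (leq_ltn_trans IH).
  by rewrite ltnNge gi -ltnNge.
have mono (h : nat -> nat) : {mono h : n m / (n <= m)%N} -> {homo h : m n / (m < n)%N}.
  by move=> hi m n mn; rewrite ltnNge hi -ltnNge.
exists (f \o g), (a +i* b); split.
  by move=> m n mn; apply: (mono _ fi); apply: (mono _ gi).
apply/cvgrPdist_lt => e e0; have e2 : 0 < e / 2 by rewrite divr_gt0.
have [N1 _ h1] := (cvgrPdist_lt _ _).1 fa _ e2.
have [N2 _ h2] := (cvgrPdist_lt _ _).1 gb _ e2.
exists (maxn N1 N2) => // n /=; rewrite geq_max => /andP[n1 n2].
rewrite sub0r normrN ger0_norm ?normR_ge0//.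
have := h1 _ (leq_trans n1 (gn n)); have := h2 _ n2; rewrite /=.
set p := z _ => /[!ltr_norml] /andP[? ?] /andP[? ?].
rewrite -ltr_sqr ?nnegrE ?normR_ge0 ?ltW// normR_complex raddfB raddfB/=.
nra.
Qed.

Definition matrix_unit i j (x : l2 C) : l2 C := l2_single i (x j).

Lemma matrix_unit_linear i j : linear (matrix_unit i j).
Proof. by move=> c x y; rewrite /matrix_unit l2_addE l2_scaleE l2_single_lin. Qed.

Lemma matrix_unit_le i j x : l2_norm (matrix_unit i j x) <= l2_norm x.
Proof. by rewrite l2_norm_single l2_comp_le. Qed.

Lemma compact_matrix_unit i j : compact_op (matrix_unit i j).
Proof.
split; first exact: matrix_unit_linear.
move=> x x1.
have [|phi [l [phi_mono zl]]] := @bolzano_weierstrass_complex (fun n => x n j).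
  by move=> n; rewrite (le_trans (l2_comp_le _ _)).
exists phi, (l2_single i l); split=> //.
rewrite (_ : (fun n => _) = (fun n => normR (x (phi n) j - l)))//.
apply/funext => n; rewrite -(l2_norm_single i); congr l2_norm.
rewrite /matrix_unit; apply: l2_ext => m; rewrite l2_addE l2_oppE !l2_singleE.
by case: ifP; rewrite ?subr0.
Qed.

Lemma compact_op_comp_contraction k (e : l2 C -> l2 C) : compact_op k -> linear e ->
  (forall x, l2_norm (e x) <= l2_norm x) -> compact_op (k \o e).
Proof.
move=> [kl kc] el e1; split; first by move=> c x y /=; rewrite el kl.
by move=> x x1; apply: (kc (e \o x)) => n; rewrite (le_trans (e1 _)).
Qed.

End ScalarCompactOperators.

(** * Compact matrices and their entries *)

Section CompactTensorTheory.
Variables (R : realType) (A : cstarType R) (H : hilbertType R).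
Variable rho : A -> H -> H.
Hypothesis rf : faithful_rep rho.
Implicit Types (S T : l2 H -> l2 H) (a b : A) (x y : l2 H) (v : H).
Local Notation "x ** y" := (cmul x y).
Local Notation I := (@cone R A).
Local Notation ct := (compact_tensor rho).
Local Notation alg := (algebraic_compact_tensor rho).

Lemma alg_lin c S T : alg S -> alg T -> alg (c *: S + T).
Proof.
move=> [n [k [a [t [ht ->]]]]] [m [k' [a' [t' [ht' ->]]]]].
exists (n + m)%N, (fun i => match fintype.split i with inl j => k j | inr j => k' j end),
  (fun i => match fintype.split i with inl j => c *: a j | inr j => a' j end),
  (fun i => match fintype.split i with inl j => c *: t j | inr j => t' j end); split.
  move=> i; case: (fintype.split i) => j; last exact: ht'.
  have [kc [tb tt]] := ht j; split=> //; split.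
    by rewrite -[_ *: _]addr0; apply: bounded_op_lin => //; exact: bounded_op0.
  move=> x v; apply: l2_ext => l; rewrite [LHS]l2_scaleE tt /= (repZ rf).
  by rewrite !scalerA mulrC.
rewrite big_split_ord scaler_sumr /=; congr (_ + _).
  apply: eq_bigr => i _; case: splitP => j; last first.
    by move=> /= ij; have := ltn_ord i; rewrite ij ltnNge leq_addr.
  by move=> /= ij; rewrite (val_inj ij : i = j).
apply: eq_bigr => i _; case: splitP => j.
  by move=> /= ij; have := ltn_ord j; rewrite -ij ltnNge leq_addr.
by move=> /= /addnI ij; rewrite (val_inj ij : i = j).
Qed.

Lemma alg_bounded S : alg S -> bounded_op S.
Proof.
move=> [n [k [a [t [ht ->]]]]]; elim/big_ind: _ => [|P Q Pb Qb|i _].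
- exact: bounded_op0.
- by rewrite -[P]scale1r; exact: bounded_op_lin.
- by have [_ []] := ht i.
Qed.

(** Bounds of operators can be added and composed, unlike the infimum [op_norm]
    whose value says nothing on operators without a bound. *)
Lemma compact_tensorP T : ct T <-> (bounded_op T /\
  forall eps : R, 0 < eps -> exists S M, [/\ alg S, M < eps & op_bound (T - S) M]).
Proof.
have BB (P Q : l2 H -> l2 H) : bounded_op P -> bounded_op Q -> bounded_op (P - Q).
  by move=> Pb Qb; rewrite addrC -scaleN1r; exact: bounded_op_lin.
split=> -[Tb h]; split=> // eps e0.
  have [S aS TS] := h _ e0.
  have [M Me MS] := op_norm_lt (BB _ _ Tb (alg_bounded aS)) TS.
  by exists S, M.
have [S [M [aS Me MS]]] := h _ e0.
by exists S => //; rewrite (le_lt_trans (op_norm_le MS)).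
Qed.

Lemma ct_bounded T : ct T -> bounded_op T. Proof. by case. Qed.

Lemma ct_alg T : alg T -> ct T.
Proof.
move=> aT; apply/compact_tensorP; split; first exact: alg_bounded.
move=> eps e0; exists T, 0; split=> //; rewrite subrr; exact: op_bound0.
Qed.

Lemma alg0 : alg 0.
Proof.
exists 0%N, (fun=> 0), (fun=> 0), (fun=> 0); split; first by case.
by rewrite big_ord0.
Qed.

Lemma ct0 : ct 0. Proof. exact/ct_alg/alg0. Qed.

Lemma ct_lin c S T : ct S -> ct T -> ct (c *: S + T).
Proof.
move=> /compact_tensorP[Sb hS] /compact_tensorP[Tb hT].
apply/compact_tensorP; split; first exact: bounded_op_lin.
move=> eps e0; pose n := normR (c : R[i]^o) + 1.
have n0 : 0 < n by rewrite ltr_wpDl ?normR_ge0.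
have [|S' [M [aS' Me SM]]] := hS (eps / 4 / n); first by rewrite !divr_gt0.
have [|T' [N [aT' Ne TN]]] := hT (eps / 4); first by rewrite divr_gt0.
exists (c *: S' + T'), (2 * (normR (c : R[i]^o) * M + N)); split.
- exact: alg_lin.
- have M0 : 0 <= M by case: SM.
  move: Me; rewrite ltr_pdivlMr// => Me.
  have : normR (c : R[i]^o) * M <= M * n by rewrite mulrC ler_wpM2l// lerDl.
  lra.
- rewrite opprD addrACA -scalerBr; exact: op_bound_lin.
Qed.

Lemma ctD S T : ct S -> ct T -> ct (S + T).
Proof. by move=> cS cT; have := ct_lin 1 cS cT; rewrite scale1r. Qed.

Lemma ct_sum (J : Type) (s : seq J) (P : pred J) (F : J -> l2 H -> l2 H) :
  (forall i, P i -> ct (F i)) -> ct (\sum_(i <- s | P i) F i).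
Proof. by move=> SF; elim/big_ind: _ => [|S T cS cT|i Pi]; [exact: ct0|exact: ctD|exact: SF]. Qed.

(** The matrix unit [e_ij] tensored with [rho a]. *)
Definition unit_op i j a x : l2 H := l2_single i (rho a (x j)).

Lemma unit_op_linear i j a : linear (unit_op i j a).
Proof.
move=> c x y; have := l2_single_lin i c (rho a (x j)) (rho a (y j)).
by rewrite -(rep_op_linear rf a c (x j) (y j)).
Qed.

Lemma unit_op_bound i j a : op_bound (unit_op i j a) (normR a).
Proof.
split; first exact: normR_ge0.
move=> x; rewrite l2_norm_single (le_trans (rep_bounded rf _ _))//.
by rewrite ler_wpM2l ?normR_ge0// l2_comp_le.
Qed.

Lemma unit_op_bounded i j a : bounded_op (unit_op i j a).
Proof. by split; [exact: unit_op_linear|exists (normR a); exact: unit_op_bound]. Qed.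

Lemma unit_op_tensor i j a : op_tensor (matrix_unit i j) (rho a) (unit_op i j a).
Proof.
split; first exact: unit_op_bounded.
move=> x v; apply: l2_ext => n.
rewrite /unit_op /matrix_unit /= !(linZ (rep_op_linear rf a)).
by case: eqP => // _; rewrite scale0r.
Qed.

Lemma ct_unit i j a : ct (unit_op i j a).
Proof.
apply: ct_alg; exists 1%N, (fun=> matrix_unit i j), (fun=> a), (fun=> unit_op i j a).
split; last by rewrite big_ord1.
by move=> _; split; [exact: compact_matrix_unit|exact: unit_op_tensor].
Qed.

Lemma unit_op_lin i j (c : R[i]) a b :
  unit_op i j (c *: a + b) = c *: unit_op i j a + unit_op i j b.
Proof. by apply/funext => x; rewrite /unit_op (rep_linear rf) l2_single_lin. Qed.

Lemma unit_op_comp i j l m a b :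
  unit_op i j a \o unit_op l m b = if j == l then unit_op i m (a ** b) else 0.
Proof.
apply/funext => x.
have -> : (unit_op i j a \o unit_op l m b) x =
    l2_single i (rho a (if j == l then rho b (x m) else 0)) by [].
case: ifP => _; first by rewrite -(repM rf).
by rewrite (rep_0r rf); apply: l2_ext => n; rewrite l2_singleE; case: ifP.
Qed.

Lemma unit_op_single i j a l v n :
  unit_op i j a (l2_single l v) n = if (n == i) && (l == j) then rho a v else 0.
Proof.
rewrite /unit_op /= eq_sym [l == j]eq_sym; case: (i == n) => //=.
by case: (j == l); rewrite ?(rep_0r rf).
Qed.

(** Each scalar factor stays compact because the matrix unit is a contraction. *)
Lemma ct_comp_unit S j : ct S -> ct (S \o unit_op j j I).
Proof.
move=> /compact_tensorP[Sb hS]; apply/compact_tensorP; split.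
  by apply: bounded_op_comp => //; exact: unit_op_bounded.
move=> eps e0; have [S' [M [aS' Me SM]]] := hS _ e0.
have ub : op_bound (unit_op j j I) 1.
  have [_ h] := unit_op_bound j j I; split=> // x.
  rewrite (le_trans (h x))// ler_wpM2r ?l2_norm_ge0//; exact: normR_cone.
exists (S' \o unit_op j j I), (M * 1); split; last 2 first.
- by rewrite mulr1.
- exact: (op_bound_comp SM ub).
move: aS' => [n [k [a [t [ht ->]]]]].
exists n, (fun i => k i \o matrix_unit j j), a, (fun i => t i \o unit_op j j I).
split.
  move=> i; have [kc [tb tt]] := ht i; split.
    apply: compact_op_comp_contraction => //; first exact: matrix_unit_linear.
    exact: matrix_unit_le.
  split; first by apply: bounded_op_comp => //; exact: unit_op_bounded.
  move=> x v; rewrite /=; have [_ ->] := unit_op_tensor j j I.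
  by rewrite tt; apply: l2_ext => l /=; rewrite (rep_cone rf).
by apply/funext => x /=; rewrite !fct_sumE.
Qed.

Definition is_entry T i j a := forall v, T (l2_single j v) i = rho a v.

Lemma is_entry_uniq T i j a b : is_entry T i j a -> is_entry T i j b -> a = b.
Proof. by move=> Ta Tb; apply: (rep_inj rf); apply/funext => v; rewrite -Ta Tb. Qed.

Lemma alg_entry S i j : alg S -> exists a, is_entry S i j a.
Proof.
move=> [n [k [a [t [ht ->]]]]].
pose e : l2 R[i]^o := l2_single j (1 : R[i]^o).
exists (\sum_(m < n) (k m e i) *: a m) => v.
have -> : l2_single j v = l2_tensor e v.
  by apply: l2_ext => l /=; case: ifP; rewrite ?scale1r ?scale0r.
rewrite fct_sumE l2_sumE.
have -> : rho (\sum_(m < n) k m e i *: a m) v = \sum_(m < n) k m e i *: rho (a m) v.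
  by elim/big_rec2: _ => [|m y z _ <-]; rewrite ?(rep0 rf) ?(repD rf) ?(repZ rf).
by apply: eq_bigr => m _; have [_ [_ ->]] := ht m.
Qed.

(** As [rho] is isometric, the entries of algebraic approximations of [T] form a
    Cauchy sequence in [A]. *)
Lemma ct_entry T i j : ct T -> exists a, is_entry T i j a.
Proof.
move=> /compact_tensorP[_ hT].
have /choice[f hf] : forall n, exists p : (l2 H -> l2 H) * A * R,
    [/\ is_entry p.1.1 i j p.1.2, p.2 < 2^-1 ^+ n & op_bound (T - p.1.1) p.2].
  move=> n; have [|S [M [aS Mn SM]]] := hT (2^-1 ^+ n); first by rewrite exprn_gt0.
  by have [a Sa] := alg_entry i j aS; exists (S, a, M).
pose a n := (f n).1.2.
have dist n v : normR (T (l2_single j v) i - rho (a n) v) <= 2^-1 ^+ n * normR v.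
  have [ea Mn [_ TM]] := hf n; rewrite -ea.
  have := l2_comp_le ((T - (f n).1.1) (l2_single j v)) i.
  move/le_trans; apply; rewrite (le_trans (TM _))// l2_norm_single.
  by rewrite ler_wpM2r ?normR_ge0// ltW.
(* The increments of [sg] are [2 / 2^n], more than [1 / 2^n + 1 / 2^(n+1)]. *)
pose sg n : R := - (4 * 2^-1 ^+ n).
have inc n : normR (a n.+1 - a n) <= sg n.+1 - sg n.
  have -> : sg n.+1 - sg n = 2 * 2^-1 ^+ n by rewrite /sg exprS; field.
  have p0 : 0 < 2^-1 ^+ n :> R by rewrite exprn_gt0.
  apply: (rep_bounded_below rf); first by rewrite mulr_ge0// ltW.
  move=> v; rewrite (repB rf) -(subrKA (T (l2_single j v) i)).
  rewrite (le_trans (normRD _ _))// normR_distC.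
  have := dist n v; have := dist n.+1 v; rewrite exprS.
  by have := normR_ge0 v; nra.
have sg0 n : sg n <= 0 by rewrite oppr_le0 mulr_ge0// exprn_ge0.
have [b ab] := summable_limit inc sg0.
exists b => v; apply/eqP; rewrite -subr_eq0; apply/eqP/normR_le0.
apply/ler_addgt0Pr => e e0; rewrite add0r.
have v1 : 0 < normR v + 1 by rewrite ltr_wpDl ?normR_ge0.
have e' : 0 < e / 2 / (normR v + 1) by rewrite !divr_gt0.
have ab' := (cvg_normRP _ _).1 ab _ e'.
have g0 : (fun n => 2^-1 ^+ n : R) @ \oo --> (0 : R).
  by apply: cvg_expr; rewrite ger0_norm// invf_lt1// ltr1n.
have /cvgrPdist_lt/(_ _ e') g' := g0.
have [n [h1 h2]] := filter_ex (filterI ab' g').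
move: h2; rewrite /= sub0r normrN ger0_norm ?exprn_ge0// => h2.
rewrite -(subrKA (rho (a n) v)) (le_trans (normRD _ _))//.
have h3 := dist n v; have h4 := rep_bounded rf (a n - b) v.
rewrite -(repB rf); move: h1 h2; rewrite normR_distC !ltr_pdivlMr// => h1 h2.
have := normR_ge0 v; have := normR_ge0 (a n - b).
have : 0 <= 2^-1 ^+ n :> R by rewrite exprn_ge0.
nra.
Qed.

Lemma entryP T i j : ct T -> is_entry T i j (entry rho T i j).
Proof. by move=> /(ct_entry i j)[a Ta]; exact: (@xgetI A cone (is_entry T i j) a Ta). Qed.

Lemma entryE T i j a : is_entry T i j a -> entry rho T i j = a.
Proof.
move=> Ta; apply: (@is_entry_uniq T i j) => //.
exact: (@xgetI A cone (is_entry T i j) a Ta).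
Qed.

Lemma entry_lin c S T i j : ct S -> ct T ->
  entry rho (c *: S + T) i j = c *: entry rho S i j + entry rho T i j.
Proof.
move=> cS cT; apply: entryE => v.
by rewrite (rep_linear rf) -(entryP i j cS) -(entryP i j cT).
Qed.

Lemma entry0 i j : entry rho 0 i j = 0.
Proof. by apply: entryE => v; rewrite (rep0 rf). Qed.

Lemma entryD S T i j : ct S -> ct T ->
  entry rho (S + T) i j = entry rho S i j + entry rho T i j.
Proof. by move=> cS cT; have := entry_lin 1 i j cS cT; rewrite !scale1r. Qed.

Lemma entryZ c S i j : ct S -> entry rho (c *: S) i j = c *: entry rho S i j.
Proof.
by move=> cS; have := entry_lin c i j cS ct0; rewrite entry0 !addr0.
Qed.

Lemma entry_sum (J : Type) (s : seq J) (F : J -> l2 H -> l2 H) i j :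
  (forall m, ct (F m)) ->
  entry rho (\sum_(m <- s) F m) i j = \sum_(m <- s) entry rho (F m) i j.
Proof.
move=> cF; elim: s => [|m s IH]; first by rewrite !big_nil entry0.
by rewrite !big_cons entryD ?IH//; exact: ct_sum.
Qed.

Lemma entry_unit_op i j a n l :
  entry rho (unit_op i j a) n l = if (n == i) && (l == j) then a else 0.
Proof.
apply: entryE => v; rewrite unit_op_single.
by case: ifP => // _; rewrite (rep0 rf).
Qed.

Lemma ct_ext S T : ct S -> ct T ->
  (forall i j, entry rho S i j = entry rho T i j) -> S = T.
Proof.
move=> cS cT ST; apply: bounded_op_ext; [exact: ct_bounded|exact: ct_bounded|].
by move=> j v; apply: l2_ext => i; rewrite (entryP i j cS) (entryP i j cT) ST.
Qed.

(** The corner of [T] cut out by two diagonal matrix units is its entry; this is how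
    the entries are recovered on the other side of an embedding. *)
Lemma compress T i j : ct T ->
  unit_op i i I \o (T \o unit_op j j I) = unit_op i j (entry rho T i j).
Proof.
move=> cT; apply/funext => x; rewrite /unit_op /=.
by rewrite (entryP i j cT) (rep_cone rf) -(repM rf) cmul1l.
Qed.

(** Each of the two inner product series has a single nonzero term. *)
Lemma l2_adjoint_unit_op i j a : l2_adjoint (unit_op i j a) (unit_op j i (star a)).
Proof.
move=> x y.
have dot_lim (u : nat -> R[i]) n0 : (forall k, k != n0 -> u k = 0) ->
    limn (fun n => \sum_(k < n) complex.Re (u k)) +i*
    limn (fun n => \sum_(k < n) complex.Im (u k)) = u n0.
  move=> u0.
  have lim1 (w : nat -> R) : (forall k, k != n0 -> w k = 0) ->
      limn (fun n => \sum_(k < n) w k) = w n0.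
    move=> w0; apply/cvg_lim => //; apply: cvg_near_cst; exists n0.+1 => // n /= n0n.
    rewrite (bigD1 (Ordinal n0n))//= big1 ?addr0// => k kn.
    by apply: w0; move: kn; rewrite -val_eqE.
  rewrite (lim1 (fun k => complex.Re (u k))) 1?(lim1 (fun k => complex.Im (u k))).
  - by case: (u n0).
  - by move=> k /u0 ->.
  - by move=> k /u0 ->.
rewrite /l2_dot (dot_lim (fun k => dot (unit_op i j a x k) (y k)) i); last first.
  by move=> k ki; rewrite /unit_op l2_singleE (negbTE ki) dot0l.
rewrite (dot_lim (fun k => dot (x k) (unit_op j i (star a) y k)) j); last first.
  by move=> k kj; rewrite /unit_op l2_singleE (negbTE kj) dot0r.
by rewrite /unit_op !l2_singleE !eqxx (rep_star rf).
Qed.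

End CompactTensorTheory.

(** * Sums over growing squares of indices *)

Section SquareSums.
Variables (R : realType) (V : normedModType R[i]).

Definition square_sum (U : nmodType) (X : nat -> nat -> U) n :=
  \sum_(0 <= i < n) \sum_(0 <= j < n) X i j.

Lemma square_sumS (U : nmodType) (X : nat -> nat -> U) n :
  square_sum X n.+1 = square_sum X n +
  (\sum_(0 <= i < n) X i n + (\sum_(0 <= j < n) X n j + X n n)).
Proof.
rewrite /square_sum big_nat_recr//= [RHS]addrA big_nat_recr//=; congr (_ + _).
by rewrite -big_split/=; apply: eq_bigr => i _; rewrite big_nat_recr.
Qed.

Lemma square_sum_prod (K : R) (w : nat -> R) n :
  square_sum (fun i j => K * w i * w j) n = K * (\sum_(0 <= i < n) w i) ^+ 2.
Proof.
rewrite /square_sum expr2 mulrA [K * _]mulr_sumr mulr_suml; apply: eq_bigr => i _.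
by rewrite mulr_sumr.
Qed.

Lemma square_sum_increments (X : nat -> nat -> V) (Y : nat -> nat -> R) n :
  (forall i j, normR (X i j) <= Y i j) ->
  normR (square_sum X n.+1 - square_sum X n) <= square_sum Y n.+1 - square_sum Y n.
Proof.
move=> XY; rewrite !square_sumS [in leLHS]addrAC [in leRHS]addrAC !subrr !add0r.
rewrite (le_trans (normRD _ _))// lerD//.
  by rewrite (le_trans (normR_sum _ _ _))//; apply: ler_sum.
rewrite (le_trans (normRD _ _))// lerD//.
by rewrite (le_trans (normR_sum _ _ _))//; apply: ler_sum.
Qed.

End SquareSums.

(** * The embedding of compact matrices *)

Section Embedding.
Variables (R : realType) (A : cstarType R) (H : hilbertType R).
Variables (rho : A -> H -> H) (B C : cstarType R) (iota : (l2 H -> l2 H) -> B).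
Variable p : B -> C.
Hypothesis rf : faithful_rep rho.
Hypothesis ex : short_exact rho iota p.
Implicit Types (S T : l2 H -> l2 H) (a b : A).
Local Notation "x ** y" := (cmul x y).
Local Notation I := (@cone R A).
Local Notation ct := (compact_tensor rho).

Lemma iota_lin c S T : ct S -> ct T -> iota (c *: S + T) = c *: iota S + iota T.
Proof. exact: embed_linear (exact_embed ex) c S T. Qed.

Lemma iota0 : iota 0 = 0.
Proof.
have := iota_lin (-1) (ct0 rho) (ct0 rho).
by rewrite scaler0 addr0 scaleN1r addNr.
Qed.

Lemma iota_opD S T : ct S -> ct T -> iota (S + T) = iota S + iota T.
Proof. by move=> cS cT; have := iota_lin 1 cS cT; rewrite !scale1r. Qed.

Lemma iota_opZ c S : ct S -> iota (c *: S) = c *: iota S.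
Proof. by move=> cS; have := iota_lin c cS (ct0 rho); rewrite iota0 !addr0. Qed.

Lemma iota_sum (J : Type) (s : seq J) (F : J -> l2 H -> l2 H) : (forall i, ct (F i)) ->
  iota (\sum_(i <- s) F i) = \sum_(i <- s) iota (F i).
Proof.
move=> cF; elim: s => [|i s IH]; first by rewrite !big_nil iota0.
by rewrite !big_cons iota_opD ?IH//; exact: (ct_sum rf).
Qed.

Definition eunit i j a : B := iota (unit_op rho i j a).

Lemma eunit_lin i j : linear (eunit i j).
Proof.
move=> c a b; rewrite /eunit unit_op_lin// iota_lin//; exact: ct_unit.
Qed.

Lemma eunitM i j l m a b :
  eunit i j a ** eunit l m b = if j == l then eunit i m (a ** b) else 0.
Proof.
rewrite /eunit -(embedM (exact_embed ex)); [|exact: ct_unit|exact: ct_unit].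
by rewrite unit_op_comp//; case: ifP => _ //; rewrite iota0.
Qed.

Lemma eunit_star i j a : star (eunit i j a) = eunit j i (star a).
Proof.
apply/esym; apply: (embed_star (exact_embed ex)); [exact: ct_unit|exact: ct_unit|].
exact: l2_adjoint_unit_op.
Qed.

Lemma eunit_diag_hom j : star_hom (eunit j j).
Proof.
split; first exact: eunit_lin.
  by move=> a b; rewrite eunitM eqxx.
by move=> a; rewrite eunit_star.
Qed.

(** By the C-star identity it is enough to bound the diagonal units, and these give
    a star homomorphism. *)
Lemma eunit_norm i j a : normR (eunit i j a) <= normR a.
Proof.
rewrite -ler_sqr ?nnegrE ?normR_ge0// -!normR_starM eunit_star eunitM eqxx.
exact: star_hom_contractive (eunit_diag_hom j) _.
Qed.

Definition trunc T n : l2 H -> l2 H :=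
  square_sum (fun i j => unit_op rho i j (entry rho T i j)) n.

Lemma ct_trunc T n : ct (trunc T n).
Proof. by apply: (ct_sum rf) => i _; apply: (ct_sum rf) => j _; exact: ct_unit. Qed.

Lemma iota_trunc T n :
  iota (trunc T n) = square_sum (fun i j => eunit i j (entry rho T i j)) n.
Proof.
rewrite /trunc /square_sum iota_sum; last first.
  by move=> i; apply: (ct_sum rf) => j _; exact: ct_unit.
by apply: eq_bigr => i _; rewrite iota_sum// => j; exact: ct_unit.
Qed.

Lemma entry_trunc T n i j : entry rho (trunc T n) i j =
  if (i < n)%N && (j < n)%N then entry rho T i j else 0.
Proof.
rewrite /trunc /square_sum (entry_sum rf); last first.
  by move=> l; apply: (ct_sum rf) => m _; exact: (ct_unit rf).
have inner l : entry rho (\sum_(0 <= m < n) unit_op rho l m (entry rho T l m)) i j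
    = if (i == l) && (j < n)%N then entry rho T i j else 0.
  rewrite (entry_sum rf); last by move=> m; exact: (ct_unit rf).
  under eq_bigr do rewrite (entry_unit_op rf).
  case: eqP => [<-|_] /=; last by rewrite big1.
  have [jn|nj] := ltnP j n; last first.
    rewrite big_nat big1// => m /andP[_ mn]; case: eqP => // jm.
    by move: mn; rewrite -jm ltnNge nj.
  rewrite (bigD1_seq j) ?mem_index_iota ?iota_uniq//= eqxx big1 ?addr0//.
  by move=> m; rewrite eq_sym => /negbTE->.
under eq_bigr do rewrite inner.
have [i_n|ni] := ltnP i n; last first.
  rewrite big_nat big1// => m /andP[_ mn]; case: eqP => // im.
  by move: mn; rewrite -im ltnNge ni.
rewrite (bigD1_seq i) ?mem_index_iota ?iota_uniq//= eqxx big1 ?addr0//.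
by move=> m; rewrite eq_sym => /negbTE->.
Qed.

Lemma iota_compress T i j : ct T ->
  eunit i i I ** (iota T ** eunit j j I) = eunit i j (entry rho T i j).
Proof.
move=> cT; rewrite /eunit -(compress rf i j cT).
rewrite (embedM (exact_embed ex)); [|exact: ct_unit|exact: ct_comp_unit].
by rewrite (embedM (exact_embed ex)); [|exact: cT|exact: ct_unit].
Qed.

Lemma p_iota T : ct T -> p (iota T) = 0.
Proof. by move=> cT; apply/(exact_ker ex); exists T. Qed.

Lemma eunit_inj i j a b : eunit i j a = eunit i j b -> a = b.
Proof.
move=> /(embed_inj (exact_embed ex) (ct_unit rf i j a) (ct_unit rf i j b)) ab.
by have := entry_unit_op rf i j a i j; rewrite ab entry_unit_op// !eqxx.
Qed.

(** The images of the truncations converge by [eunit_norm]; their limit lies in the kernel of [p], which is closed, hence is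
    [iota S] with [S] a compact matrix; compressing by the diagonal matrix units
    shows that [S] and [T] have the same entries. *)
Lemma iota_trunc_cvg T (K W : R) (w : nat -> R) : ct T -> 0 <= K ->
  (forall i, 0 <= w i) -> (forall n, \sum_(0 <= i < n) w i <= W) ->
  (forall i j, normR (entry rho T i j) <= K * w i * w j) ->
  (fun n => iota (trunc T n)) @ \oo --> iota T.
Proof.
move=> cT K0 w0 wW Tw.
pose u n := iota (trunc T n).
pose sg := square_sum (fun i j => K * w i * w j).
have inc n : normR (u n.+1 - u n) <= sg n.+1 - sg n.
  rewrite /u !iota_trunc; apply: square_sum_increments => i j.
  exact: le_trans (eunit_norm _ _ _) (Tw i j).
have sgM n : sg n <= K * W ^+ 2.
  rewrite /sg square_sum_prod ler_wpM2l//.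
  have s0 : 0 <= \sum_(0 <= i < n) w i by apply: sumr_ge0.
  by rewrite ler_sqr ?nnegrE// (le_trans s0).
have [b ub] := summable_limit inc sgM.
have ph := exact_hom ex.
have pb : p b = 0.
  apply: normR_le0; apply/ler_addgt0Pr => e e0; rewrite add0r.
  have [n bn] := filter_ex ((cvg_normRP _ _).1 ub _ e0).
  rewrite -[p b]subr0 -(p_iota (ct_trunc T n)) -(linB (star_hom_linear ph)).
  by rewrite (le_trans (star_hom_contractive ph _))// ltW.
have [S cS Sb] := (exact_ker ex b).1 pb.
suff TS : T = S by rewrite {2}TS Sb.
apply: (ct_ext rf cT cS) => i j.
apply: (@eunit_inj i j); rewrite -!iota_compress// Sb.
apply: (@cstar_lim_unique _ _ (fun n => eunit i i I ** (u n ** eunit j j I))); last first.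
  by apply: cvg_cmulr; exact: cvg_cmull.
apply: cvg_near_cst; exists (maxn i j).+1 => // n /= ijn.
rewrite (iota_compress i j (ct_trunc T n)) (iota_compress i j cT).
rewrite entry_trunc (leq_ltn_trans (leq_maxl i j) ijn).
by rewrite (leq_ltn_trans (leq_maxr i j) ijn).
Qed.

Lemma iota_trunc_dist T (K W : R) (w : nat -> R) (l : R) n : ct T -> 0 <= K ->
  (forall i, 0 <= w i) -> (forall n, \sum_(0 <= i < n) w i <= W) ->
  (fun n => \sum_(0 <= i < n) w i) @ \oo --> l ->
  (forall i j, normR (entry rho T i j) <= K * w i * w j) ->
  normR (iota T - iota (trunc T n)) <= K * (l ^+ 2 - (\sum_(0 <= i < n) w i) ^+ 2).
Proof.
move=> cT K0 w0 wW wl Tw.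
have ul := iota_trunc_cvg cT K0 w0 wW Tw.
pose sg := square_sum (fun i j => K * w i * w j).
have inc m : normR (iota (trunc T m.+1) - iota (trunc T m)) <= sg m.+1 - sg m.
  rewrite !iota_trunc; apply: square_sum_increments => i j.
  exact: le_trans (eunit_norm _ _ _) (Tw i j).
have sgl : sg @ \oo --> K * l ^+ 2.
  rewrite (_ : sg = fun m => K * (\sum_(0 <= i < m) w i) ^+ 2); last first.
    by apply/funext => m; rewrite -square_sum_prod.
  by apply: cvgMr; rewrite expr2; under eq_fun do rewrite expr2; exact: cvgM.
have := cvg_increments inc ul sgl n.
by rewrite /sg square_sum_prod -mulrBr.
Qed.

End Embedding.

(** * Power sums *)

Section PowerSums.
Variables (R : realType) (h : R).
Hypothesis h1 : 1 < h.

Definition pow_weight (i : nat) : R := (i.+1%:R `^ h)^-1.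

Lemma pow_weight_ge0 i : 0 <= pow_weight i.
Proof. by rewrite invr_ge0 powR_ge0. Qed.

(** Discrete form of integrating [x^(-h)]: with [m = n + 1] one has
    [(m / n)^(h-1) >= 1 + (h - 1) ln (m / n) >= 1 + (h - 1) / m]. *)
Lemma pow_weight_telescope (n : nat) : (0 < n)%N ->
  (h - 1) * pow_weight n <= (n%:R `^ (h - 1))^-1 - (n.+1%:R `^ (h - 1))^-1.
Proof.
move=> n0; set s := h - 1; have s0 : 0 < s by rewrite subr_gt0.
set m : R := n.+1%:R; have n0' : 0 < n%:R :> R by rewrite ltr0n.
have m0 : 0 < m by rewrite ltr0n.
have mn : m = n%:R + 1 by rewrite /m -natr1.
have m1 : 1 < m by rewrite mn ltrDr.
have hE : pow_weight n = (m `^ s)^-1 / m.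
  by rewrite /pow_weight -/m -(mulr_powRB1 (ltW m0) (lt_trans ltr01 h1)) invfM mulrC.
have key : 1 + s / m <= m `^ s / n%:R `^ s.
  have -> : m `^ s / n%:R `^ s = expR (s * (ln m - ln n%:R)).
    rewrite /powR !gt_eqF// -expRN -expRD; congr expR; ring.
  rewrite (le_trans _ (expR_ge1Dx _))// lerD2l ler_wpM2l ?(ltW s0)//.
  have := @le_ln1Dx R (- m^-1); rewrite ltrN2 invf_lt1// => /(_ m1).
  have -> : 1 - m^-1 = n%:R / m by rewrite mn; field; rewrite -mn gt_eqF.
  by rewrite ln_div ?posrE// => H; rewrite -lerN2 opprB.
have pm : 0 < m `^ s by exact: powR_gt0.
have pn : 0 < n%:R `^ s :> R by exact: powR_gt0.
rewrite hE.
have -> : (n%:R `^ s)^-1 = (m `^ s / n%:R `^ s) / m `^ s.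
  by rewrite mulrAC divff ?mul1r// gt_eqF.
rewrite -[X in _ <= _ - X]mul1r -mulrBl mulrCA mulrC ler_wpM2r ?invr_ge0 ?(ltW pm)//.
by rewrite lerBrDl.
Qed.

Lemma pow_weight_sum_le n : \sum_(0 <= i < n) pow_weight i <= 1 + (h - 1)^-1.
Proof.
have s0 : 0 < h - 1 by rewrite subr_gt0.
have s0' : 0 <= (h - 1)^-1 by rewrite invr_ge0 ltW.
case: n => [|n]; first by rewrite big_geq// addr_ge0.
suff : \sum_(0 <= i < n.+1) pow_weight i <=
    1 + (h - 1)^-1 * (1 - (n.+1%:R `^ (h - 1))^-1).
  move/le_trans; apply; rewrite lerD2l ler_piMr// gerBl invr_ge0; exact: powR_ge0.
elim: n => [|n IH].
  by rewrite big_nat1 /pow_weight !powR1 !invr1 subrr mulr0 addr0.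
rewrite big_nat_recr//=.
have := @pow_weight_telescope n.+1 isT; rewrite -ler_pdivlMl//.
move: IH; set a := (n.+1%:R `^ _)^-1; set b := (n.+2%:R `^ _)^-1; lra.
Qed.

(** [(i + j)^(2 h)] dominates [i^h j^h], which separates the variables. *)
Lemma pow_weight_prod (i j : nat) :
  ((i.+1 + j.+1)%:R `^ (h + h))^-1 <= pow_weight i * pow_weight j.
Proof.
have h0 : 0 <= h by rewrite ltW// (lt_trans ltr01).
rewrite /pow_weight -invfM lef_pV2 ?posrE ?mulr_gt0 ?powR_gt0 ?ltr0n//.
rewrite powRD; last by rewrite pnatr_eq0 implybT.
by rewrite ler_pM ?powR_ge0// ge0_ler_powR ?nnegrE ?ler0n// ler_nat ?leq_addr ?leq_addl.
Qed.

End PowerSums.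

(** * Rapidly decaying symmetric matrices *)

Section RapidDecay.
Variables (R : realType) (A : cstarType R) (H : hilbertType R).
Variables (rho : A -> H -> H) (LipA : set (realified A)) (L : realified A -> R).
Variable nu : A -> R[i].
Hypothesis rf : faithful_rep rho.
Hypothesis uL : @unital_subspace R A LipA.
Hypothesis lipL : @lip_norm R (realified A) (@cstar_le R A) (@cone R A) LipA L.
Hypothesis snu : cstar_state nu.
Implicit Types (S T : l2 H -> l2 H) (a b : A) (r k : R).
Local Notation ct := (compact_tensor rho).
Local Notation Anu := (A_nu rho LipA L nu).
Local Notation Lk := (Lk rho L nu).
Local Notation weighted := (weighted_entries rho L nu).

(** The size of a single entry in the definition of [Lk]; by [normR_le_size] it
    dominates the norm, hence is a norm on [LipA]. *)
Definition lip_size a : R := L a + complex.Re `|nu a|.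

Lemma lip_sizeE a : LipA a -> lip_size a = L a + `|nuR nu a|.
Proof. by move=> La; rewrite /lip_size (nu_real snu (us_sa uL La)). Qed.

Lemma lip_size_ge0 a : LipA a -> 0 <= lip_size a.
Proof. by move=> La; rewrite lip_sizeE// addr_ge0// (lip_ge0 lipL). Qed.

Lemma nuRZ r a : nuR nu (r%:C *: a) = r * nuR nu a.
Proof.
have nu0 : nuR nu 0 = 0.
  by have := nuR_lin snu (-1) 0 0; rewrite scaler0 addr0 mulN1r addNr.
by have := nuR_lin snu r a 0; rewrite nu0 !addr0.
Qed.

Lemma nuRD a b : nuR nu (a + b) = nuR nu a + nuR nu b.
Proof. by have := nuR_lin snu 1 a b; rewrite scale1r mul1r. Qed.

Lemma lip_sizeZ r a : LipA a -> lip_size (r%:C *: a) = `|r| * lip_size a.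
Proof.
move=> La; rewrite !lip_sizeE//; last exact: usZ.
by rewrite (lip_scale lipL)// nuRZ normrM mulrDr.
Qed.

Lemma lip_sizeD a b : LipA a -> LipA b -> lip_size (a + b) <= lip_size a + lip_size b.
Proof.
move=> La Lb; rewrite !lip_sizeE//; last exact: usD.
rewrite addrACA lerD//; first exact: (lip_add lipL).
by rewrite nuRD ler_normD.
Qed.

Lemma lip_size0 : lip_size 0 = 0.
Proof.
have := lip_sizeZ 0 (us0 uL); rewrite scaler0 normr0 mul0r; exact.
Qed.

Definition weight k (i j : nat) : R := (i.+1 + j.+1)%:R `^ k.

Lemma weight_gt0 k i j : 0 < weight k i j.
Proof. by rewrite powR_gt0// ltr0n. Qed.

Lemma weight_ge1 k i j : 0 <= k -> 1 <= weight k i j.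
Proof.
move=> k0; have -> : 1 = 1 `^ k :> R by rewrite powR1.
by rewrite ge0_ler_powR ?nnegrE ?ler0n ?ler01// ler1n.
Qed.

Lemma A_nu_ct T : Anu T -> ct T. Proof. by case. Qed.

Lemma A_nu_lip T i j : Anu T -> LipA (entry rho T i j). Proof. by case. Qed.

Lemma weighted_le_Lk k T i j : 0 <= k -> Anu T ->
  weight k i j * lip_size (entry rho T i j) <= Lk k T.
Proof.
move=> k0 [_ _ _ hb]; apply: ub_le_sup; first exact: hb.
by exists i => //; exists j.
Qed.

Lemma Lk_le k T M : (forall i j, weight k i j * lip_size (entry rho T i j) <= M) ->
  Lk k T <= M.
Proof.
move=> hM; apply: ge_sup => [|_ [i _ [j _ <-]]]; last exact: hM.
by eexists; exists 0%N => //; exists 0%N.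
Qed.

Lemma Lk_ge0 k T : 0 <= k -> Anu T -> 0 <= Lk k T.
Proof.
move=> k0 aT; rewrite (le_trans _ (weighted_le_Lk 0 0 k0 aT))//.
by rewrite mulr_ge0 ?(ltW (weight_gt0 _ _ _))// lip_size_ge0//; exact: A_nu_lip.
Qed.

Lemma A_nu_intro T : ct T -> (forall i j, LipA (entry rho T i j)) ->
  (forall i j, entry rho T i j = entry rho T j i) ->
  (forall k, 0 <= k -> exists M, forall i j,
     weight k i j * lip_size (entry rho T i j) <= M) -> Anu T.
Proof.
move=> cT lT sT bT; split=> // k k0; have [M hM] := bT k k0.
by exists M => _ [i _ [j _ <-]]; exact: hM.
Qed.

Lemma A_nu_lin r S T : Anu S -> Anu T -> Anu (r%:C *: S + T).
Proof.
move=> aS aT; have cS := A_nu_ct aS; have cT := A_nu_ct aT.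
have eE i j : entry rho (r%:C *: S + T) i j =
    r%:C *: entry rho S i j + entry rho T i j by exact: entry_lin.
apply: A_nu_intro.
- exact: ct_lin.
- by move=> i j; rewrite eE; apply: us_lin => //; exact: A_nu_lip.
- move=> i j; rewrite !eE; case: aS => _ _ -> _; by case: aT => _ _ -> _.
- move=> k k0; exists (`|r| * Lk k S + Lk k T) => i j; rewrite eE.
  have lS := A_nu_lip i j aS; have lT := A_nu_lip i j aT.
  have := lip_sizeD (usZ uL r lS) lT; rewrite lip_sizeZ//.
  have := weighted_le_Lk i j k0 aS; have := weighted_le_Lk i j k0 aT.
  have w0 := weight_gt0 k i j => hT hS hD.
  apply: (le_trans (ler_wpM2l (ltW w0) hD)).
  by rewrite mulrDr lerD// mulrCA ler_wpM2l.
Qed.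

Lemma A_nu0 : Anu 0.
Proof.
apply: A_nu_intro.
- exact: ct0.
- by move=> i j; rewrite entry0//; exact: us0.
- by move=> i j; rewrite !entry0.
- by move=> k k0; exists 0 => i j; rewrite entry0// lip_size0 mulr0.
Qed.

Lemma A_nuZ r S : Anu S -> Anu (r%:C *: S).
Proof. by move=> aS; have := A_nu_lin r aS A_nu0; rewrite addr0. Qed.

Lemma LkZ_le k r T : 0 <= k -> Anu T -> Lk k (r%:C *: T) <= `|r| * Lk k T.
Proof.
move=> k0 aT; apply: Lk_le => i j.
rewrite entryZ//; last exact: A_nu_ct.
rewrite lip_sizeZ; last exact: A_nu_lip.
by rewrite mulrCA ler_wpM2l// weighted_le_Lk.
Qed.

Lemma LkZ k r T : 0 <= k -> Anu T -> Lk k (r%:C *: T) = `|r| * Lk k T.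
Proof.
move=> k0 aT; apply/le_anti; rewrite LkZ_le//=.
have [->|r0] := eqVneq r 0.
  by rewrite normr0 mul0r Lk_ge0//; exact: A_nuZ.
have := LkZ_le r^-1 k0 (A_nuZ r aT).
rewrite scalerA -rmorphM/= mulVf// scale1r normfV.
by rewrite ler_pdivlMl// normr_gt0.
Qed.

Lemma LkD k S T : 0 <= k -> Anu S -> Anu T -> Lk k (S + T) <= Lk k S + Lk k T.
Proof.
move=> k0 aS aT; apply: Lk_le => i j.
rewrite (entryD rf); [|exact: A_nu_ct|exact: A_nu_ct].
have lS := A_nu_lip i j aS; have lT := A_nu_lip i j aT.
apply: (le_trans (ler_wpM2l (ltW (weight_gt0 k i j)) (lip_sizeD lS lT))).
by rewrite mulrDr lerD// weighted_le_Lk.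
Qed.

Lemma normR_le_size : exists2 D : R, 0 < D &
  forall a, LipA a -> normR a <= D * lip_size a.
Proof. exact: (normR_le_lip rf uL lipL snu). Qed.

(** A matrix that vanishes for [Lk k] has vanishing entries by [normR_le_size]. *)
Lemma Lk_eq0 k T : 0 <= k -> Anu T -> Lk k T = 0 -> T = 0.
Proof.
move=> k0 aT LT; have [D D0 hD] := normR_le_size.
apply: (ct_ext rf (A_nu_ct aT) (ct0 rho)) => i j; rewrite entry0//.
have lT := A_nu_lip i j aT.
apply: normR_le0; rewrite (le_trans (hD _ lT))// pmulr_rle0//.
by rewrite -(pmulr_rle0 _ (weight_gt0 k i j)) -LT weighted_le_Lk.
Qed.

Lemma A_nu_finite T n : ct T -> (forall i j, LipA (entry rho T i j)) ->
  (forall i j, entry rho T i j = entry rho T j i) ->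
  (forall i j, ~~ ((i < n) && (j < n))%N -> entry rho T i j = 0) -> Anu T.
Proof.
move=> cT lT sT zT; apply: A_nu_intro => // k k0.
pose w i j := weight k i j * lip_size (entry rho T i j).
have w0 i j : 0 <= w i j.
  by rewrite mulr_ge0 ?(ltW (weight_gt0 _ _ _)) ?lip_size_ge0.
exists (\sum_(i < n) \sum_(j < n) w i j) => i j.
have s0 : 0 <= \sum_(i < n) \sum_(j < n) w i j.
  by apply: sumr_ge0 => ? _; apply: sumr_ge0.
have [/andP[i_n j_n]|ij] := boolP ((i < n) && (j < n))%N; last first.
  by rewrite zT// lip_size0 mulr0.
rewrite (bigD1 (Ordinal i_n))//= (bigD1 (Ordinal j_n))//= -addrA lerDl.
by rewrite addr_ge0//; apply: sumr_ge0 => // ? _; apply: sumr_ge0.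
Qed.

Lemma A_nu_trunc T n : Anu T -> Anu (trunc rho T n).
Proof.
move=> aT; apply: (@A_nu_finite _ n).
- exact: ct_trunc.
- move=> i j; rewrite entry_trunc//; case: ifP => _; [exact: A_nu_lip|exact: us0].
- move=> i j; rewrite !entry_trunc// andbC; case: ifP => // _.
  by case: aT => _ _ -> _.
- by move=> i j /negbTE ij; rewrite entry_trunc// ij.
Qed.

(** [gram_op i j a] is [(e_i + e_j) (e_i + e_j)^*] tensored with [a]; it depends
    positively on [a], unlike the off-diagonal matrix units. *)
Definition gram_op i j a : l2 H -> l2 H :=
  (unit_op rho i i a + unit_op rho i j a) + (unit_op rho j i a + unit_op rho j j a).

Lemma ct_gram i j a : ct (gram_op i j a).
Proof. by do !apply: (ctD rf); exact: ct_unit. Qed.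

Lemma A_nu_gram i j a : LipA a -> Anu (gram_op i j a).
Proof.
move=> La.
have eE n l : entry rho (gram_op i j a) n l =
    ((if (n == i) && (l == i) then a else 0) + (if (n == i) && (l == j) then a else 0))
    + ((if (n == j) && (l == i) then a else 0) + (if (n == j) && (l == j) then a else 0)).
  rewrite /gram_op.
  have c1 := ct_unit rf i i a; have c2 := ct_unit rf i j a.
  have c3 := ct_unit rf j i a; have c4 := ct_unit rf j j a.
  by rewrite (entryD rf _ _ (ctD rf c1 c2) (ctD rf c3 c4)) !(entryD rf)// !entry_unit_op.
have L0 := us0 uL.
apply: (@A_nu_finite _ (maxn i j).+1).
- exact: ct_gram.
- by move=> n l; rewrite eE; do !apply: (usD uL); case: ifP.
- by move=> n l; rewrite !eE addrACA; congr (_ + _); congr (_ + _); rewrite andbC.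
- move=> n l h.
  have out m : (m == i) || (m == j) -> (m < (maxn i j).+1)%N.
    by move=> /orP[] /eqP ->; rewrite ltnS ?leq_maxl ?leq_maxr.
  have : ~~ (((n == i) || (n == j)) && ((l == i) || (l == j))).
    by apply: contra h => /andP[/out-> /out->].
  rewrite eE; case: (n == i); case: (n == j); case: (l == i); case: (l == j) => //= _;
    by rewrite !addr0.
Qed.

End RapidDecay.

(** * The Lip norm on the extension *)

Section Extension.
Variables (R : realType) (A : cstarType R) (H : hilbertType R) (rho : A -> H -> H).
Variables (LipA : set (realified A)) (L : realified A -> R) (nu : A -> R[i]).
Variables (At1 At2 : cstarType R) (iota : (l2 H -> l2 H) -> At1) (p : At1 -> At2).
Variables (s : At2 -> At1) (A2 : set (realified At2)) (L2 : realified At2 -> R) (k : R).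
Hypothesis rf : faithful_rep rho.
Hypothesis uL : @unital_subspace R A LipA.
Hypothesis lipL : @lip_norm R (realified A) (@cstar_le R A) (@cone R A) LipA L.
Hypothesis snu : cstar_state nu.
Hypothesis ex : short_exact rho iota p.
Hypothesis sp : positive_unital_splitting p s.
Hypothesis u2 : @unital_subspace R At2 A2.
Hypothesis lip2 : @lip_norm R (realified At2) (@cstar_le R At2) (@cone R At2) A2 L2.
Hypothesis k2 : 2 < k.
Implicit Types (S T : l2 H -> l2 H) (a b : A) (r : R).
Local Notation "x ** y" := (cmul x y).
Local Notation ct := (compact_tensor rho).
Local Notation Anu := (A_nu rho LipA L nu).
Local Notation Lk := (Lk rho L nu).
Local Notation A1 := (A_one rho LipA L nu iota s A2).
Local Notation L1 := (L_one rho LipA L nu iota p s L2 k).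
Local Notation eunit := (eunit rho iota).
Local Notation lip_size := (lip_size L nu).

Let k0 : 0 <= k. Proof. by rewrite ltW// (lt_trans _ k2). Qed.
Let h : R := k / 2.
Let h1 : 1 < h. Proof. by rewrite /h ltr_pdivlMr// mul1r. Qed.
Let hh : h + h = k. Proof. by rewrite /h -splitr. Qed.
Local Notation w := (pow_weight h).

(** With [h = k / 2 > 1], the weights [w] are summable. *)
Lemma entry_decay D T i j : (forall a, LipA a -> normR a <= D * lip_size a) ->
  0 <= D -> Anu T -> normR (entry rho T i j) <= D * Lk k T * w i * w j.
Proof.
move=> hD D0 aT; have lT := A_nu_lip i j aT.
apply: (le_trans (hD _ lT)); rewrite -!mulrA ler_wpM2l//.
have := weighted_le_Lk i j k0 aT; rewrite mulrC -ler_pdivlMr ?weight_gt0//.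
move/le_trans; apply; rewrite ler_wpM2l//; first exact: (Lk_ge0 uL lipL snu).
by rewrite /weight -hh; exact: (pow_weight_prod h1).
Qed.

(** The truncations are selfadjoint by the symmetry of [T], since the adjoint of
    [e_ij] is [e_ji]. *)
Lemma iota_sa T : Anu T -> star (iota T) = iota T.
Proof.
move=> aT; have cT := A_nu_ct aT.
have [D D0 hD] := normR_le_size rf uL lipL snu.
have cvgT := iota_trunc_cvg rf ex cT
  (mulr_ge0 (ltW D0) (Lk_ge0 uL lipL snu k0 aT)) (pow_weight_ge0 h)
  (pow_weight_sum_le h1) (fun i j => entry_decay i j hD (ltW D0) aT).
apply: (cstar_lim_unique (cvg_star cvgT)).
rewrite (_ : (fun n => _) = (fun n => iota (trunc rho T n)))//.
apply/funext => n; rewrite !(iota_trunc rf ex) /square_sum.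
rewrite (big_morph _ (@starD R At1) (@star0 R At1)).
under eq_bigr => i _.
  rewrite (big_morph _ (@starD R At1) (@star0 R At1)).
  under eq_bigr => j _.
    rewrite (eunit_star rf ex) (us_sa uL (A_nu_lip i j aT)).
    have [_ _ -> _] := aT.
    over.
  over.
by rewrite exchange_big.
Qed.

Lemma split_positive c : is_square c -> is_square (s c).
Proof. by move=> /positiveP/(splitting_positive sp)/positiveP. Qed.

Let s_lin := splitting_linear sp.

Lemma split_sa c : star c = c -> star (s c) = s c.
Proof.
move=> sc.
have -> : s c = scal At1 (normR c) - s (scal At2 (normR c) - c).
  by rewrite (linB s_lin) (linZ s_lin) (splitting_unital sp) opprB addrC subrK.
rewrite starB star_scal; congr (_ - _); apply: sq_sa; apply: split_positive.
exact: sq_normR_le.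
Qed.

Lemma A_oneI T c : Anu T -> A2 c -> A1 (iota T + s c).
Proof. by move=> aT Ac; exists T => //; exists c. Qed.

Lemma A_one_iota T : Anu T -> A1 (iota T).
Proof.
by move=> aT; have := A_oneI aT (us0 u2); rewrite (lin0 s_lin) addr0.
Qed.

Lemma A_one_split c : A2 c -> A1 (s c).
Proof.
move=> Ac; have := A_oneI (A_nu0 rf uL lipL snu) Ac.
by rewrite (iota0 ex) add0r.
Qed.

Lemma A_one_unital : @unital_subspace R At1 A1.
Proof.
split.
- move=> r _ _ [T aT [c Ac <-]] [T' aT' [c' Ac' <-]].
  have -> : r%:C *: (iota T + s c) + (iota T' + s c') =
      iota (r%:C *: T + T') + s (r%:C *: c + c').
    by rewrite (iota_lin ex _ (A_nu_ct aT) (A_nu_ct aT')) s_lin scalerDr addrACA.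
  by apply: A_oneI; [exact: A_nu_lin|exact: us_lin].
- by rewrite -(splitting_unital sp); apply: A_one_split; exact: us_cone u2.
- move=> _ [T aT [c Ac <-]]; rewrite starD iota_sa// split_sa//.
  exact (us_sa u2 Ac).
Qed.

Lemma p_A_one T c : ct T -> p (iota T + s c) = c.
Proof.
move=> cT; rewrite (linD (star_hom_linear (exact_hom ex))) (p_iota ex cT) add0r.
exact: (splittingK sp).
Qed.

Lemma L_oneE T c : Anu T -> L1 (iota T + s c) = L2 c + Lk k T.
Proof.
move=> aT; rewrite /L_one p_A_one; last exact: A_nu_ct aT.
have inj : {in Anu &, injective iota}.
  move=> S S' /set_mem aS /set_mem aS'.
  exact: (embed_inj (exact_embed ex) (A_nu_ct aS) (A_nu_ct aS')).
by rewrite addrK /embed_inv (pinvKV _ inj)//; exact: mem_set.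
Qed.

Definition gram i j a : At1 := iota (gram_op rho i j a).

Lemma gramE i j a :
  gram i j a = (eunit i i a + eunit i j a) + (eunit j i a + eunit j j a).
Proof.
have cu := ct_unit rf.
by rewrite /gram /gram_op !(iota_opD ex)//; apply: (ctD rf).
Qed.

Lemma gram_lin i j : linear (gram i j).
Proof.
move=> c a b; rewrite !gramE !(eunit_lin rf ex) !scalerDr.
rewrite [X in X + _]addrACA [X in _ + X]addrACA; exact: addrACA.
Qed.

(** [e_i + e_j] has squared norm [2], or [4] when [i = j], so the square of
    [gram i j y] is that multiple of [gram i j (y^2)]. *)
Lemma gram_sq i j a : is_square a -> is_square (gram i j a).
Proof.
case=> y sy <-.
have sg : star (gram i j y) = gram i j y.
  by rewrite gramE !starD !(eunit_star rf ex) sy addrACA.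
pose m := if i == j then 4%N else 2%N.
have gg : gram i j y ** gram i j y = (m%:R)%:C *: gram i j (y ** y).
  rewrite rmorph_nat scaler_nat !gramE !cmulDl !cmulDr !(eunitM rf ex) !eqxx /m.
  have [->|ij] := eqVneq i j; first by rewrite ?eqxx !mulrS mulr0n addr0 !addrA.
  rewrite ?[j == i]eq_sym ?(negbTE ij) !addr0 !add0r.
  by rewrite addrACA mulr2n.
have -> : gram i j (y ** y) = (m%:R^-1)%:C *: (gram i j y ** gram i j y).
  rewrite gg scalerA -rmorphM/= mulVf ?scale1r//.
  by rewrite /m; case: ifP; rewrite pnatr_eq0.
apply: sqZ; first by rewrite invr_ge0 ler0n.
by exists (gram i j y).
Qed.

Lemma A_one_gram i j a : LipA a -> A1 (gram i j a).
Proof. by move=> La; apply: A_one_iota; exact: A_nu_gram. Qed.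

(** Polarization: functionals on symmetric finite matrices are combinations of
    positive functionals of their entries. *)
Lemma gram_polarization i j a : eunit i j a + eunit j i a =
  gram i j a - (4^-1)%:C *: (gram i i a + gram j j a).
Proof.
have gd l : (4^-1)%:C *: gram l l a = eunit l l a.
  rewrite gramE; set e := eunit l l a.
  have -> : e + e + (e + e) = 4%:C *: e.
    by rewrite rmorph_nat scaler_nat !mulrS mulr0n addr0 !addrA.
  by rewrite scalerA -rmorphM/= mulVf ?scale1r// pnatr_eq0.
by rewrite scalerDr !gd gramE [eunit i i a + eunit i j a]addrC addrACA addrK.
Qed.

Lemma iota_trunc_gram T n : Anu T -> 2%:C *: iota (trunc rho T n) =
  square_sum (fun i j => gram i j (entry rho T i j) -
    (4^-1)%:C *: (gram i i (entry rho T i j) + gram j j (entry rho T i j))) n.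
Proof.
move=> aT; rewrite (iota_trunc rf ex) rmorph_nat scaler_nat mulr2n.
rewrite {2}/square_sum exchange_big /square_sum -big_split/=.
apply: eq_bigr => i _; rewrite -big_split/=; apply: eq_bigr => j _.
by have [_ _ -> _] := aT; rewrite gram_polarization.
Qed.

Local Notation states1 := (@states R (realified At1) (@cstar_le R At1) (@cone R At1) A1).
Implicit Types mu lam : A1 -> R.
Let u1 := A_one_unital.

Lemma ev_cvg mu x : A1 x ->
  (fun lam : {ptws A1 -> R} => ev lam x) @ nbhs (mu : {ptws A1 -> R}) --> ev mu x.
Proof.
move=> Ax; have := @ptws_eval_cvg R A1 mu (SigSub (mem_set Ax)).
rewrite -(evE mu Ax) (_ : (fun lam => lam _) = (fun lam : {ptws A1 -> R} => ev lam x))//.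
by apply/funext => lam; rewrite (evE _ Ax).
Qed.

Lemma state_gram_le mu i j a D : states1 mu -> LipA a -> normR a <= D ->
  `|ev mu (gram i j a)| <= D * ev mu (gram i j cone).
Proof.
move=> Smu La aD; have gl := gram_lin i j.
have Lc := us_cone uL; have sa := us_sa uL La.
have g1 := A_one_gram i j Lc; have ga := A_one_gram i j La.
have Dg := usZ u1 D g1.
have := state_ev_ge0 u1 Smu (A_one_gram i j (usB uL (us_scal uL D) La))
  (gram_sq i j (sq_normR_le sa aD)).
have := state_ev_ge0 u1 Smu (A_one_gram i j (usD uL (us_scal uL D) La))
  (gram_sq i j (sq_normR_le' sa aD)).
rewrite (linB gl) (linD gl) (linZ gl) (state_evB u1)// (state_evD u1)//.
rewrite (state_evZ u1)// ler_norml => h2 h3; lra.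
Qed.

Lemma gram_state mu i j : states1 mu -> 0 < ev mu (gram i j cone) ->
  @states R (realified A) (@cstar_le R A) (@cone R A) LipA
    (fun a : LipA => ev mu (gram i j (val a)) / ev mu (gram i j cone)).
Proof.
move=> Smu m0; set m := ev mu _ in m0 *.
pose f a := ev mu (gram i j a) / m.
apply: (@positive_state R A LipA uL f) => [r x y Lx Ly||a La qa].
- by rewrite /f (gram_lin i j) (state_ev_lin u1)// ?mulrDl ?mulrA//; exact: A_one_gram.
- by rewrite /f divff// gt_eqF.
- rewrite /f divr_ge0 ?(ltW m0)// (state_ev_ge0 u1)//; first exact: A_one_gram.
  exact: gram_sq.
Qed.

(** Normalizing [a |-> mu (gram i j a)] gives a state of [LipA] whose dependence on
    [mu] is weak-* continuous, so the Lip norm of [LipA] controls it uniformly. If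
    the normalizing constant vanishes at [mu], it is small nearby, and it bounds
    the functional. *)
Lemma near_gram mu i j eta : states1 mu -> 0 < eta ->
  \forall lam \near (mu : {ptws A1 -> R}), states1 lam ->
    forall a, LipA a -> lip_size a <= 1 ->
      `|ev mu (gram i j a) - ev lam (gram i j a)| <= eta.
Proof.
move=> Smu eta0.
have FF : Filter (nbhs (mu : {ptws A1 -> R})) := nbhs_filter _.
have [D D0 hD] := normR_le_size rf uL lipL snu.
have Dle a : LipA a -> lip_size a <= 1 -> normR a <= D.
  by move=> La a1; rewrite (le_trans (hD _ La))// ler_piMr// ltW.
have Lc := us_cone uL; have g1 := A_one_gram i j Lc.
pose M lam := ev lam (gram i j cone).
have Mcvg : (fun lam : {ptws A1 -> R} => M lam) @ nbhs (mu : {ptws A1 -> R}) --> M mu.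
  exact: ev_cvg.
have M0 lam : states1 lam -> 0 <= M lam.
  move=> Slam; apply: (state_ev_ge0 u1) => //; apply: gram_sq; exact: sq_cone.
have e0 : 0 < eta / (2 * D) by rewrite divr_gt0// mulr_gt0.
have nearM : \forall lam \near (mu : {ptws A1 -> R}), `|M mu - M lam| < eta / (2 * D).
  by move/cvgrPdist_lt: Mcvg; apply.
have [m0|m0] := eqVneq (M mu) 0.
  apply: filterS nearM => lam; rewrite m0 sub0r normrN => Mlam Slam a La a1.
  have := state_gram_le i j Smu La (Dle _ La a1).
  have := state_gram_le i j Slam La (Dle _ La a1).
  rewrite -/(M lam) -/(M mu) m0 mulr0 normr_le0 => h2 /eqP ->.
  rewrite sub0r normrN (le_trans h2)//.
  move: Mlam; rewrite ger0_norm ?M0// ltr_pdivlMr ?mulr_gt0// => Mlam.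
  by have := M0 _ Slam; nra.
have {}m0 : 0 < M mu by rewrite lt_neqAle eq_sym m0 M0.
pose Phi (lam : {ptws A1 -> R}) : {ptws LipA -> R} :=
  fun c : LipA => ev lam (gram i j (val c)) / M lam.
have Phi_cvg : Phi @ nbhs (mu : {ptws A1 -> R}) --> Phi mu.
  apply/ptws_cvgP => a.
  have La : LipA (val a) by exact: set_mem (valP a).
  apply: (@cvgM _ _ (nbhs (mu : {ptws A1 -> R}))); first exact: ev_cvg (A_one_gram i j La).
  by apply: cvgV => //; rewrite gt_eqF.
have e1 : 0 < eta / (2 * M mu) by rewrite divr_gt0// mulr_gt0.
have nearPhi : \forall lam \near (mu : {ptws A1 -> R}),
    @states R (realified A) (@cstar_le R A) (@cone R A) LipA (Phi lam) ->
    (@lip_dist R (realified A) LipA L (Phi mu) (Phi lam) < (eta / (2 * M mu))%:E)%E.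
  exact: (Phi_cvg _ (near_lip_dist lipL (us0 uL) (gram_state Smu m0) e1)).
have nearpos : \forall lam \near (mu : {ptws A1 -> R}), `|M mu - M lam| < M mu.
  by move/cvgrPdist_lt: Mcvg; apply.
apply: filterS (filterI nearM (filterI nearPhi nearpos)).
move=> lam [hM [hPhi hpos]] Slam a La a1.
have l0 : 0 < M lam by move: hpos; rewrite ltr_norml => /andP[h2 h3]; lra.
have {}hPhi := ltW (hPhi (gram_state Slam l0)).
pose a' : LipA := SigSub (mem_set La).
have L1a : L (val a') <= 1.
  by apply: le_trans a1; rewrite /= (lip_sizeE L uL snu La) lerDl.
have := le_trans (@lip_dist_ub R (realified A) LipA L (Phi mu) (Phi lam) a' L1a) hPhi.
rewrite lee_fin /Phi /=.
set x := ev mu _; set y := ev lam _ => hxy.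
have yl : `|y| <= D * M lam := state_gram_le i j Slam La (Dle _ La a1).
have -> : x - y = M mu * (x / M mu - y / M lam) + (M mu - M lam) * (y / M lam).
  by field; rewrite !gt_eqF.
rewrite (le_trans (ler_normD _ _))// !normrM (gtr0_norm m0).
have h2 : M mu * `|x / M mu - y / M lam| <= eta / 2.
  have := ler_wpM2l (ltW m0) hxy; rewrite (_ : M mu * (eta / _) = eta / 2)//.
  by field; rewrite gt_eqF.
have h3 : `|M mu - M lam| * (`|y| * `|(M lam)^-1|) <= eta / 2.
  have : `|y| * `|(M lam)^-1| <= D.
    by rewrite normfV (gtr0_norm l0) ler_pdivrMr.
  move=> yD; have := ler_pM (normr_ge0 _) (mulr_ge0 (normr_ge0 _) (normr_ge0 _)) (ltW hM) yD.
  move/le_trans; apply; rewrite (_ : eta / _ * D = eta / 2)//.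
  by field; rewrite gt_eqF.
by rewrite [leRHS]splitr lerD.
Qed.

(** [mu \o s] is a state of [A2] depending continuously on [mu]. *)
Lemma near_split mu eps : states1 mu -> 0 < eps ->
  \forall lam \near (mu : {ptws A1 -> R}), states1 lam ->
    forall c, A2 c -> L2 c <= 1 -> `|ev mu (s c) - ev lam (s c)| <= eps.
Proof.
move=> Smu e0.
have FF : Filter (nbhs (mu : {ptws A1 -> R})) := nbhs_filter _.
pose Psi (lam : {ptws A1 -> R}) : {ptws A2 -> R} := fun c => ev lam (s (val c)).
have Psi_cvg : Psi @ nbhs (mu : {ptws A1 -> R}) --> Psi mu.
  apply/ptws_cvgP => c; apply: ev_cvg; apply: A_one_split.
  exact: set_mem (valP c).
have Psi_state lam : states1 lam ->
    @states R (realified At2) (@cstar_le R At2) (@cone R At2) A2 (Psi lam).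
  move=> Slam; apply: (@positive_state R At2 A2 u2 (fun c => ev lam (s c))).
  - by move=> r x y Ax Ay; rewrite s_lin (state_ev_lin u1)//; exact: A_one_split.
  - by rewrite (splitting_unital sp) (state_ev_cone u1).
  - move=> c Ac qc; apply: (state_ev_ge0 u1) => //; first exact: A_one_split.
    exact: split_positive.
have nb : \forall lam \near (mu : {ptws A1 -> R}),
    @states R (realified At2) (@cstar_le R At2) (@cone R At2) A2 (Psi lam) ->
    (@lip_dist R (realified At2) A2 L2 (Psi mu) (Psi lam) < eps%:E)%E.
  exact: (Psi_cvg _ (near_lip_dist lip2 (us0 u2) (Psi_state _ Smu) e0)).
apply: filterS nb => lam hlam Slam c Ac c1.
pose c' : A2 := SigSub (mem_set Ac).
have := le_trans (@lip_dist_ub R (realified At2) A2 L2 (Psi mu) (Psi lam) c' c1)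
  (ltW (hlam (Psi_state _ Slam))).
by rewrite lee_fin.
Qed.

(** The entries are dominated by a multiple of [w i * w j], uniformly in [T], and
    [k > 2] makes this double series convergent. *)
Lemma uniform_tail eps : 0 < eps -> exists n, forall T, Anu T -> Lk k T <= 1 ->
  normR (iota T - iota (trunc rho T n)) <= eps.
Proof.
move=> e0; have [D D0 hD] := normR_le_size rf uL lipL snu.
pose sm n := \sum_(0 <= i < n) w i.
have w0 := pow_weight_ge0 h.
have smc : cvgn sm.
  apply: nondecreasing_is_cvgn.
    by apply/nondecreasing_seqP => n; rewrite /sm big_nat_recr//= lerDl.
  by exists (1 + (h - 1)^-1) => _ [n _ <-]; exact: pow_weight_sum_le.
have [l sml] : exists l : R, sm @ \oo --> l by exists (limn sm).
have sql : (fun n => D * (l ^+ 2 - sm n ^+ 2)) @ \oo --> (0 : R).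
  have -> : 0 = D * (l ^+ 2 - l ^+ 2) by rewrite subrr mulr0.
  apply: cvgMr.
  apply: cvgB; first exact: cvg_cst.
  by rewrite expr2; under eq_fun do rewrite expr2; exact: cvgM.
have /cvgrPdist_lt/(_ _ e0) near0 := sql.
have [n hn] := filter_ex near0.
exists n => T aT T1.
have := @iota_trunc_dist _ _ _ _ _ _ _ _ rf ex T D _ w l n (A_nu_ct aT) (ltW D0) w0
  (pow_weight_sum_le h1) sml.
move=> H1; apply: (le_trans (H1 _)).
  move=> i j; apply: (le_trans (entry_decay i j hD (ltW D0) aT)).
  rewrite -!mulrA ler_wpM2l ?(ltW D0)// ler_piMl// mulr_ge0//.
rewrite (le_trans (ler_norm _))//; move: hn; rewrite sub0r normrN; exact: ltW.
Qed.

(** The unit ball of [L1] splits into three parts: the component in [s A2], the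
    tail of the matrix, which is uniformly small in norm, and its finite head,
    which involves only finitely many of the functionals of [near_gram]. *)
Lemma near_lip_dist_one mu eps : states1 mu -> 0 < eps ->
  \forall lam \near (mu : {ptws A1 -> R}), states1 lam ->
    (@lip_dist R (realified At1) A1 L1 mu lam < eps%:E)%E.
Proof.
move=> Smu e0.
have FF : Filter (nbhs (mu : {ptws A1 -> R})) := nbhs_filter _.
have e8 : 0 < eps / 8 by rewrite divr_gt0.
have e4 : 0 < eps / 4 by rewrite divr_gt0.
(* The tail is seen by both [mu] and [lam], the head by at most [n^2] pairs of
   indices, each contributing [(1 + 1/4 + 1/4) eta] before division by [2]. *)
have [n tail] := uniform_tail e8.
pose eta := eps / 4 / (n%:R ^+ 2 + 1).
have n1 : 0 < n%:R ^+ 2 + 1 :> R by rewrite ltr_wpDl ?sqr_ge0.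
have eta0 : 0 < eta by rewrite divr_gt0.
pose P (i j : 'I_n) : set {ptws A1 -> R} := fun lam => states1 lam ->
  forall a, LipA a -> lip_size a <= 1 ->
    `|ev mu (gram i j a) - ev lam (gram i j a)| <= eta.
have nearP i j : nbhs (mu : {ptws A1 -> R}) (P i j) by exact: near_gram.
have nearG := filter_forall FF (fun ij : 'I_n * 'I_n => nearP ij.1 ij.2).
have nearGd := filter_forall FF (fun i : 'I_n => nearP i i).
apply: filterS (filterI nearG (filterI nearGd (near_split Smu e4))).
move=> lam [hG [hGd hS]] Slam.
apply: (@le_lt_trans _ _ (3 / 4 * eps)%:E); last first.
  by rewrite lte_fin; lra.
apply: ge_ereal_sup => _ [x L1x <-]; rewrite lee_fin -!ev_val.
have [T aT [c Ac xE]] : A1 (val x) by exact: set_mem (valP x).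
move: L1x; rewrite /= -xE L_oneE// => L1x.
have L2c0 : 0 <= L2 c := lip_ge0 lip2 Ac.
have LkT0 : 0 <= Lk k T := Lk_ge0 uL lipL snu k0 aT.
have LkT : Lk k T <= 1 by lra.
have L2c : L2 c <= 1 by lra.
have aTn := A_nu_trunc rf uL lipL snu n aT.
have iT := A_one_iota aT; have iTn := A_one_iota aTn; have isc := A_one_split Ac.
have hs := hS Slam c Ac L2c.
pose del y := ev mu y - ev lam y.
have delD y z : A1 y -> A1 z -> del (y + z) = del y + del z.
  by move=> Ay Az; rewrite /del !(state_evD u1)//; lra.
have delB y z : A1 y -> A1 z -> del (y - z) = del y - del z.
  by move=> Ay Az; rewrite /del !(state_evB u1)//; lra.
have delZ r y : A1 y -> del (r%:C *: y) = r * del y.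
  by move=> Ay; rewrite /del !(state_evZ u1)//; lra.
have tailT : `|del (iota T - iota (trunc rho T n))| <= eps / 4.
  have At := usB u1 iT iTn.
  rewrite /del (le_trans (ler_normB _ _))//.
  have := state_ev_le u1 Smu At (tail T aT LkT).
  have := state_ev_le u1 Slam At (tail T aT LkT); lra.
have headT : `|del (iota (trunc rho T n))| <= eps / 4.
  have asize i j : lip_size (entry rho T i j) <= 1.
    apply: le_trans LkT; apply: le_trans (weighted_le_Lk i j k0 aT).
    rewrite ler_peMl ?weight_ge1//; apply: (lip_size_ge0 uL lipL snu).
    exact: A_nu_lip aT.
  suff : `|2 * del (iota (trunc rho T n))| <= 2 * (n%:R ^+ 2 * eta).
    rewrite normrM ger0_norm// ler_pM2l// => /le_trans; apply.
    have -> : n%:R ^+ 2 * eta = eps / 4 * (n%:R ^+ 2 / (n%:R ^+ 2 + 1)).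
      by rewrite /eta mulrCA.
    by rewrite ler_piMr ?(ltW e4)// ler_pdivrMr// mul1r lerDl ler01.
  rewrite -delZ// iota_trunc_gram//.
  set F := fun i j => _.
  have AF i j : A1 (F i j).
    have La := A_nu_lip i j aT.
    apply: (usB u1); first exact: A_one_gram.
    by apply: (usZ u1); apply: (usD u1); exact: A_one_gram.
  have AFs i : A1 (\sum_(0 <= j < n) F i j) by exact: us_sum.
  have -> : del (square_sum F n) = \sum_(i < n) \sum_(j < n) del (F i j).
    rewrite /del /square_sum !(state_ev_sum u1)// -sumrB big_mkord.
    apply: eq_bigr => i _; rewrite !(state_ev_sum u1)// -sumrB big_mkord.
    by [].
  rewrite (le_trans (ler_norm_sum _ _ _))//.
  apply: (@le_trans _ _ (\sum_(i < n) \sum_(j < n) 2 * eta)); last first.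
    rewrite !sumr_const !card_ord -mulrnA -[leLHS]mulr_natr natrM expr2.
    by rewrite -[leLHS]mulrA [eta * _]mulrC.
  apply: ler_sum => i _; rewrite (le_trans (ler_norm_sum _ _ _))//.
  apply: ler_sum => j _; rewrite /F.
  have La := A_nu_lip i j aT.
  have g1 := A_one_gram i j La; have g2 := A_one_gram i i La; have g3 := A_one_gram j j La.
  rewrite delB//; last by apply: (usZ u1); exact: (usD u1).
  rewrite delZ ?delD//; last exact: (usD u1).
  have := hG (i, j) Slam _ La (asize i j); have := hGd i Slam _ La (asize i j).
  have := hGd j Slam _ La (asize i j); rewrite -/(del _) /=.
  rewrite -/(del (gram j j _)) -/(del (gram i i _)) -/(del (gram i j _)).
  rewrite !ler_norml => /andP[? ?] /andP[? ?] /andP[? ?]; apply/andP; split; lra.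
have -> : ev mu (iota T + s c) - ev lam (iota T + s c) =
    del (iota T - iota (trunc rho T n)) + del (iota (trunc rho T n)) + del (s c).
  by rewrite -!delD ?subrK//; exact: (usB u1).
rewrite (le_trans (ler_normD _ _))//; move: hs; rewrite -/(del (s c)) => hs.
have := ler_normD (del (iota T - iota (trunc rho T n))) (del (iota (trunc rho T n))).
lra.
Qed.

Lemma A_one_lip_norm : @lip_norm R (realified At1) (@cstar_le R At1) (@cone R At1) A1 L1.
Proof.
have ge0 x : A1 x -> 0 <= L1 x.
  move=> [T aT [c Ac <-]]; rewrite L_oneE// addr_ge0 ?(lip_ge0 lip2 Ac)//.
  exact: (Lk_ge0 uL lipL snu k0 aT).
have homog r x : A1 x -> L1 (r%:C *: x) = `|r| * L1 x.
  move=> [T aT [c Ac <-]].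
  have aT' := A_nuZ rf uL lipL snu r aT.
  have -> : r%:C *: (iota T + s c) = iota (r%:C *: T) + s (r%:C *: c).
    by rewrite scalerDr (iota_opZ ex) ?(linZ s_lin)//; exact: A_nu_ct aT.
  rewrite !L_oneE// (LkZ rf uL lipL snu)// mulrDr; congr (_ + _).
  exact: (lip_homog lip2 r Ac).
split.
- exact: ge0.
- by move=> r x; exact: homog.
- move=> _ _ [T aT [c Ac <-]] [T' aT' [c' Ac' <-]].
  have aTT' : Anu (T + T') by have := A_nu_lin rf uL lipL snu 1 aT aT'; rewrite scale1r.
  have -> : (iota T + s c) + (iota T' + s c') = iota (T + T') + s (c + c').
    rewrite (iota_opD ex) ?(linD s_lin); first exact: addrACA.
      exact: A_nu_ct aT.
    exact: A_nu_ct aT'.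
  rewrite !L_oneE// addrACA lerD ?(LkD rf uL lipL snu)//.
  exact: (lip_triangle lip2 Ac Ac').
- move=> _ [T aT [c Ac <-]]; rewrite L_oneE//.
  have L2c0 := lip_ge0 lip2 Ac; have LkT0 := Lk_ge0 uL lipL snu k0 aT.
  split=> [L0|[r xr]].
    have L2c : L2 c = 0 by lra.
    have LkT : Lk k T = 0 by lra.
    have [r cE] := (lip_eq0 lip2 Ac).1 L2c.
    exists r; rewrite (Lk_eq0 rf uL lipL snu k0 aT LkT) (iota0 ex) add0r cE.
    by rewrite -[r *: _]/(r%:C *: (cone : At2)) (linZ s_lin) (splitting_unital sp).
  have cE : c = r *: (cone : realified At2).
    have ph := star_hom_linear (exact_hom ex).
    rewrite -[LHS](p_A_one c (A_nu_ct aT)) xr.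
    rewrite -[r *: _]/(r%:C *: (cone : At1)) (linZ ph) -(splitting_unital sp).
    by rewrite (splittingK sp).
  have T0 : T = 0.
    apply: (embed_inj (exact_embed ex) (A_nu_ct aT) (ct0 rho)).
    apply: (addIr (s c)); rewrite xr (iota0 ex) add0r cE.
    by rewrite -[in RHS]/(r%:C *: (cone : At2)) (linZ s_lin) (splitting_unital sp).
  have -> : L2 c = 0 by apply/(lip_eq0 lip2 Ac); exists r.
  have := LkZ rf uL lipL snu 0 k0 (A_nu0 rf uL lipL snu).
  by rewrite scaler0 normr0 mul0r T0 => ->; rewrite addr0.
- apply: lip_weak_star_of_near => //.
  + exact: us0 u1.
  + by move=> r x Ax; exact: (usZ u1).
  + exact: near_lip_dist_one.
Qed.

End Extension.

Theorem theorem3p6 (R : realType)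
  (A : cstarType R) (H : hilbertType R) (rho : A -> H -> H)
  (LipA : set (realified A)) (L : realified A -> R) (nu : A -> R[i])
  (At1 At2 : cstarType R)
  (iota : (l2 H -> l2 H) -> At1) (p : At1 -> At2) (s : At2 -> At1)
  (A2 : set (realified At2)) (L2 : realified At2 -> R) (k : R) :
  faithful_rep rho ->
  dense_in_selfadjoint LipA ->
  cstar_cqms LipA L ->
  cstar_state nu ->
  short_exact rho iota p ->
  positive_unital_splitting p s ->
  dense_in_selfadjoint A2 ->
  cstar_cqms A2 L2 ->
  2 < k ->
  cstar_cqms (A_one rho LipA L nu iota s A2)
             (L_one rho LipA L nu iota p s L2 k).
Proof.
move=> rf dL cL snu ex sp d2 c2 k2.
have uL := cqms_unital_subspace dL cL; have u2 := cqms_unital_subspace d2 c2.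
case: cL c2 => [_ lipL] [_ lip2]; split.
  exact: order_unit_space_us (A_one_unital rf uL lipL snu ex sp u2 k2).
exact: A_one_lip_norm.
Qed.
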